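(* Let $\Omega\subset\mathbb{R}^3$ be a bounded polyhedral domain with a conforming simplicial finite element mesh $\mathcal{T}$. Let $k\ge 1$ and let $E\in\mathcal{E}$ be a critical edge in $\mathcal{T}$. For each endpoint $\mathbf{p}\in\mathcal{V}(E)$ the function $p_{k-1}^{E,\mathbf{p}}$ (defined in the context, for inner and for outer critical edges) satisfies $$\big(p_{k-1}^{E,\mathbf{p}},\operatorname{div}\mathbf{v}\big)_{L^2(\Omega)}=0\qquad\forall\,\mathbf{v}\in\mathbf{S}_{k,0}(\mathcal{T}).$$ Consequently, if $\mathcal{T}$ contains a critical edge $E\in\mathcal{E}_\Omega$, then the functions $p_{k-1}^{E,\mathbf{p}}$, $\mathbf{p}\in\mathcal{V}(E)$, are critical pressures for $\mathcal{T}$, and the pair $(\mathbf{S}_{k,0}(\mathcal{T}),\mathbb{P}_{k-1,0}(\mathcal{T}))$ is not inf-sup stable.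
   Context: $\mathcal{T}$ consists of closed tetrahedra. $\mathcal{F}$ and $\mathcal{E}$ are the sets of all (two-dimensional) facets and (one-dimensional) edges of the mesh; $\mathcal{E}_{\partial\Omega}:=\{E\in\mathcal{E}: E\subset\partial\Omega\}$ (outer edges) and $\mathcal{E}_\Omega:=\mathcal{E}\setminus\mathcal{E}_{\partial\Omega}$ (inner edges). For $E\in\mathcal{E}$, $\mathcal{T}_E:=\{K\in\mathcal{T}:E\subset K\}$ and $\mathcal{V}(E)$ is the set of the two endpoints of $E$. For $K\in\mathcal{T}$ and a vertex $\mathbf{z}$ of $K$, $\lambda_{K,\mathbf{z}}$ is the barycentric coordinate, i.e. the affine function on $K$ equal to $1$ at $\mathbf{z}$ and $0$ at the other vertices of $K$; $|K|$ is the volume of $K$ and $\chi_K$ its characteristic function. An edge $E\in\mathcal{E}$ is critical in $\mathcal{T}$ if all facets $F\in\mathcal{F}$ with $E\subset F$ lie in at most two flat planes. If a critical edge $E$ is inner, $\mathcal{T}_E$ consists of exactly four tetrahedra $K_1,\dots,K_4$, numbered cyclically ($K_5:=K_1$) so that $K_i$ and $K_{i+1}$ share a facet $F_i$, with $F_1,F_3$ lying in one plane and $F_2,F_4$ in one other plane. If a critical edge $E$ is outer, $\mathcal{T}_E=\{K_i:1\le i\le\iota_E\}$ with $\iota_E\in\{1,2,3\}$, numbered so that $K_i$ and $K_{i+1}$ share a facet. $P_n^{(\alpha,\beta)}$ denotes the Jacobi polynomial of degree $n$, orthogonal on $[-1,1]$ to all polynomials of degree less than $n$ with respect to the weight $(1-x)^\alpha(1+x)^\beta$,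 normalized by $P_n^{(\alpha,\beta)}(1)=(\alpha+1)_n/n!$ with $(a)_n=a(a+1)\cdots(a+n-1)$, $(a)_0=1$ (so $P_n^{(0,3)}(1)=1$). For a critical edge $E$ and $\mathbf{p}\in\mathcal{V}(E)$, $$p_{k-1}^{E,\mathbf{p}}:=\sum_{i=1}^{\iota_E}\frac{(-1)^i}{|K_i|}\,\chi_{K_i}\,P_{k-1}^{(0,3)}(1-2\lambda_{K_i,\mathbf{p}}),$$ where $\iota_E=4$ if $E\in\mathcal{E}_\Omega$ and $\iota_E\in\{1,2,3\}$ if $E\in\mathcal{E}_{\partial\Omega}$. $S_{k,0}(\mathcal{T})$ is the space of continuous functions on $\Omega$ that are polynomials of degree $\le k$ on every $K\in\mathcal{T}$ and vanish on $\partial\Omega$; $\mathbf{S}_{k,0}(\mathcal{T})=(S_{k,0}(\mathcal{T}))^3$. $\mathbb{P}_{k-1}(\mathcal{T})$ is the space of functions in $L^2(\Omega)$ that are polynomials of degree $\le k-1$ on each $K\in\mathcal{T}$, and $\mathbb{P}_{k-1,0}(\mathcal{T})$ is its subspace of functions with zero integral over $\Omega$. A critical pressure for $\mathcal{T}$ is a non-zero $p\in\mathbb{P}_{k-1}(\mathcal{T})$ with $\int_\Omega p=0$ and $(p,\operatorname{div}\mathbf{v})_{L^2(\Omega)}=0$ for all $\mathbf{v}\in\mathbf{S}_{k,0}(\mathcal{T})$. The pair $(\mathbf{S}_{k,0}(\mathcal{T}),\mathbb{P}_{k-1,0}(\mathcal{T}))$ is inf-sup stable if there is $\gamma>0$ with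 $$\inf_{p\in\mathbb{P}_{k-1,0}(\mathcal{T})\setminus\{0\}}\ \sup_{\mathbf{v}\in\mathbf{S}_{k,0}(\mathcal{T})\setminus\{\mathbf{0}\}}\frac{(p,\operatorname{div}\mathbf{v})_{L^2(\Omega)}}{\|\nabla\mathbf{v}\|_{L^2(\Omega)}\|p\|_{L^2(\Omega)}}\ge\gamma .$$ *)

(* Defs.v *)
From HB Require Import structures.
From mathcomp Require Import all_boot all_order all_algebra finmap.
From mathcomp Require Import all_classical all_reals all_analysis.
(* the notations of mpoly clash with those of MathComp-Analysis *)
From mathcomp Require Import -(notations) mpoly.

Set Implicit Arguments.
Unset Strict Implicit.
Unset Printing Implicit Defensive.

Import Order.TTheory GRing.Theory Num.Theory.
Import numFieldNormedType.Exports.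

Local Open Scope classical_set_scope.
Local Open Scope ring_scope.

(** * Integration on R^3

    Points of R^3 are row vectors, which carry the norm, the topology and the
    derivatives.  The library has product measures on products of types only,
    so Lebesgue measure is taken on the product of three copies of R and
    transported along the coordinate bijection [vec3].  [measurableTypeR R] is
    R with the Borel sigma-algebra on which [lebesgue_measure] is defined. *)

Notation coords3 R :=
  (measurableTypeR R * measurableTypeR R * measurableTypeR R)%type.

Definition vec3 (R : realType) (y : coords3 R) : 'rV[R]_3 :=
  \row_(i < 3) [:: y.1.1 : R; y.1.2 : R; y.2 : R]`_i.

Definition leb3 (R : realType) : {measure set (coords3 R) -> \bar R} :=
  ((@lebesgue_measure R \x @lebesgue_measure R) \x @lebesgue_measure R)%E.

Definition vol (R : realType) (A : set 'rV[R]_3) : R :=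
  fine (leb3 R (@vec3 R @^-1` A)).

Definition int3 (R : realType) (D : set 'rV[R]_3) (f : 'rV[R]_3 -> R) : R :=
  \int[leb3 R]_(y in @vec3 R @^-1` D) f (vec3 y).

Definition ae3 (R : realType) (P : 'rV[R]_3 -> Prop) : Prop :=
  {ae leb3 R, forall y, P (vec3 y)}.

Definition in_L2 (R : realType) (D : set 'rV[R]_3) (f : 'rV[R]_3 -> R) : Prop :=
  measurable_fun (@vec3 R @^-1` D) (f \o @vec3 R) /\
  (\int[leb3 R]_(y in @vec3 R @^-1` D) ((f (vec3 y)) ^+ 2)%:E < +oo)%E.

Definition ip_L2 (R : realType) (D : set 'rV[R]_3) (f g : 'rV[R]_3 -> R) : R :=
  int3 D (fun x => f x * g x).

Definition norm_L2 (R : realType) (D : set 'rV[R]_3) (f : 'rV[R]_3 -> R) : R :=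
  Num.sqrt (int3 D (fun x => f x ^+ 2)).

(** * Simplices and meshes

    A closed simplex is encoded by its finite set of vertices, and [hull]
    gives the corresponding subset of R^3. *)

Definition hull (R : realType) (S : {fset 'rV[R]_3}) : set 'rV[R]_3 :=
  [set x | exists w : 'rV[R]_3 -> R,
     [/\ forall z, z \in S -> 0 <= w z,
         \sum_(z <- S) w z = 1 &
         x = \sum_(z <- S) w z *: z]].

Definition affinely_independent (R : realType) (S : {fset 'rV[R]_3}) : Prop :=
  forall w : 'rV[R]_3 -> R,
    \sum_(z <- S) w z = 0 -> \sum_(z <- S) w z *: z = 0 ->
    forall z, z \in S -> w z = 0.

(* non-degenerate simplex with n vertices *)
Definition simplex (R : realType) (n : nat) (S : {fset 'rV[R]_3}) : Prop :=
  #|` S| = n /\ affinely_independent S.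

Definition boundary (R : realType) (A : set 'rV[R]_3) : set 'rV[R]_3 :=
  closure A `\` interior A.

(* The boundary consists of finitely many flat polygons; these are given
   through a triangulation, which is not related to any mesh. *)
Definition bounded_polyhedral_domain (R : realType) (Omega : set 'rV[R]_3)
    : Prop :=
  [/\ open Omega, connected Omega, Omega !=set0, bounded_set Omega &
      exists B : {fset {fset 'rV[R]_3}},
        (forall F, F \in B -> simplex 3 F) /\
        boundary Omega = [set x | exists2 F, F \in B & hull F x]].

(* The common face [S] may be empty, in which case [hull S = set0]. *)
Definition conforming_mesh (R : realType) (Omega : set 'rV[R]_3)
    (T : {fset {fset 'rV[R]_3}}) : Prop :=
  [/\ forall K, K \in T -> simplex 4 K,
      forall K L, K \in T -> L \in T ->
        exists S : {fset 'rV[R]_3},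
          [/\ (S `<=` K)%fset, (S `<=` L)%fset & hull K `&` hull L = hull S] &
      closure Omega = [set x | exists2 K, K \in T & hull K x]].

Definition is_facet (R : realType) (T : {fset {fset 'rV[R]_3}})
    (F : {fset 'rV[R]_3}) : Prop :=
  #|` F| = 3 /\ exists2 K, K \in T & (F `<=` K)%fset.

Definition is_edge (R : realType) (T : {fset {fset 'rV[R]_3}})
    (E : {fset 'rV[R]_3}) : Prop :=
  #|` E| = 2 /\ exists2 K, K \in T & (E `<=` K)%fset.

Definition outer_edge (R : realType) (Omega : set 'rV[R]_3)
    (T : {fset {fset 'rV[R]_3}}) (E : {fset 'rV[R]_3}) : Prop :=
  is_edge T E /\ hull E `<=` boundary Omega.

Definition inner_edge (R : realType) (Omega : set 'rV[R]_3)
    (T : {fset {fset 'rV[R]_3}}) (E : {fset 'rV[R]_3}) : Prop :=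
  is_edge T E /\ ~ outer_edge Omega T E.

Definition edge_patch (R : realType) (T : {fset {fset 'rV[R]_3}})
    (E K : {fset 'rV[R]_3}) : Prop :=
  K \in T /\ hull E `<=` hull K.

Definition is_plane (R : realType) (Pi : set 'rV[R]_3) : Prop :=
  exists (n : 'rV[R]_3) (c : R),
    n != 0 /\ Pi = [set x | \sum_(i < 3) n 0 i * x 0 i = c].

Definition critical_edge (R : realType) (T : {fset {fset 'rV[R]_3}})
    (E : {fset 'rV[R]_3}) : Prop :=
  is_edge T E /\
  exists Pi1 Pi2 : set 'rV[R]_3,
    [/\ is_plane Pi1, is_plane Pi2 &
        forall F, is_facet T F -> hull E `<=` hull F ->
          hull F `<=` Pi1 \/ hull F `<=` Pi2].

(** * Numberings K_1, ..., K_iota of the tetrahedra around a critical edge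

    Sequences are indexed from 1.  Only K_1, ..., K_iota matter, and for inner
    edges also K_5 := K_1; the other values are irrelevant. *)

Definition enumerates_patch (R : realType) (T : {fset {fset 'rV[R]_3}})
    (E : {fset 'rV[R]_3}) (iota : nat) (K : nat -> {fset 'rV[R]_3}) : Prop :=
  [/\ forall i, (1 <= i <= iota)%N -> edge_patch T E (K i),
      forall i j, (1 <= i <= iota)%N -> (1 <= j <= iota)%N ->
        K i = K j -> i = j &
      forall L, edge_patch T E L -> exists2 i, (1 <= i <= iota)%N & L = K i].

Definition shared_facet (R : realType) (K : nat -> {fset 'rV[R]_3}) (i : nat) :
    {fset 'rV[R]_3} := (K i `&` K i.+1)%fset.

Definition inner_numbering (R : realType) (T : {fset {fset 'rV[R]_3}})
    (E : {fset 'rV[R]_3}) (K : nat -> {fset 'rV[R]_3}) : Prop :=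
  [/\ enumerates_patch T E 4 K,
      K 5 = K 1,
      forall i, (1 <= i <= 4)%N -> #|` shared_facet K i| = 3 &
      exists Pi1 Pi2 : set 'rV[R]_3,
        [/\ is_plane Pi1, is_plane Pi2, Pi1 <> Pi2,
            hull (shared_facet K 1) `|` hull (shared_facet K 3) `<=` Pi1 &
            hull (shared_facet K 2) `|` hull (shared_facet K 4) `<=` Pi2]].

Definition outer_numbering (R : realType) (T : {fset {fset 'rV[R]_3}})
    (E : {fset 'rV[R]_3}) (iota : nat) (K : nat -> {fset 'rV[R]_3}) : Prop :=
  [/\ (1 <= iota <= 3)%N,
      enumerates_patch T E iota K &
      forall i, (1 <= i < iota)%N -> #|` shared_facet K i| = 3].

Definition edge_numbering (R : realType) (Omega : set 'rV[R]_3)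
    (T : {fset {fset 'rV[R]_3}}) (E : {fset 'rV[R]_3})
    (iota : nat) (K : nat -> {fset 'rV[R]_3}) : Prop :=
  (inner_edge Omega T E /\ iota = 4%N /\ inner_numbering T E K) \/
  (outer_edge Omega T E /\ outer_numbering T E iota K).

(** * The functions p_{k-1}^{E,p} *)

Definition pochhammer (R : realType) (a : R) (n : nat) : R :=
  \prod_(i < n) (a + i%:R).

Definition is_jacobi (R : realType) (alpha beta : R) (n : nat) (P : {poly R})
    : Prop :=
  [/\ size P = n.+1,
      forall q : {poly R}, (size q <= n)%N ->
        \int[@lebesgue_measure R]_(x in `[-1, 1])
          ((1 - x) `^ alpha * (1 + x) `^ beta * P.[x] * q.[x]) = 0 &
      P.[1] = pochhammer (alpha + 1) n / n`!%:R].

(* the unique polynomial with the above properties, for alpha, beta > -1 *)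
Definition jacobi (R : realType) (n : nat) (alpha beta : R) : {poly R} :=
  xget 0 [set P | is_jacobi alpha beta n P].

Definition is_barycentric (R : realType) (K : {fset 'rV[R]_3}) (z : 'rV[R]_3)
    (l : 'rV[R]_3 -> R) : Prop :=
  [/\ exists (n : 'rV[R]_3) (c : R),
        forall x, l x = \sum_(i < 3) n 0 i * x 0 i + c,
      l z = 1 &
      forall z', z' \in K -> z' != z -> l z' = 0].

(* unique on the whole of R^3 when [K] is a tetrahedron with vertex [z] *)
Definition barycentric (R : realType) (K : {fset 'rV[R]_3}) (z : 'rV[R]_3) :
    'rV[R]_3 -> R :=
  xget (fun=> 0) [set l | is_barycentric K z l].

Definition edge_function (R : realType) (k iota : nat)
    (K : nat -> {fset 'rV[R]_3}) (p : 'rV[R]_3) : 'rV[R]_3 -> R :=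
  fun x => \sum_(1 <= i < iota.+1)
    (-1) ^+ i / vol (hull (K i)) * \1_(hull (K i)) x *
    (jacobi k.-1 0 3).[1 - 2 * barycentric (K i) p x].

(** * Finite element spaces *)

Definition poly_fun (R : realType) (m : nat) (g : 'rV[R]_3 -> R) : Prop :=
  exists q : mpoly 3 R,
    (msize q <= m.+1)%N /\
    forall x, g x = meval (fun i => x 0 i) q.

Definition S_k0 (R : realType) (Omega : set 'rV[R]_3)
    (T : {fset {fset 'rV[R]_3}}) (k : nat) (f : 'rV[R]_3 -> R) : Prop :=
  [/\ {within closure Omega, continuous f},
      forall K, K \in T ->
        exists2 g, poly_fun k g & forall x, hull K x -> f x = g x &
      forall x, boundary Omega x -> f x = 0].

Definition vector_S_k0 (R : realType) (Omega : set 'rV[R]_3)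
    (T : {fset {fset 'rV[R]_3}}) (k : nat) (v : 'rV[R]_3 -> 'rV[R]_3) : Prop :=
  forall i : 'I_3, S_k0 Omega T k (fun x => v x 0 i).

(* Elements of L^2 are represented by functions; values on null sets, in
   particular on the facets of the mesh, play no role. *)
Definition P_m (R : realType) (Omega : set 'rV[R]_3)
    (T : {fset {fset 'rV[R]_3}}) (m : nat) (p : 'rV[R]_3 -> R) : Prop :=
  in_L2 Omega p /\
  forall K, K \in T ->
    exists2 g, poly_fun m g & ae3 (fun x => hull K x -> p x = g x).

Definition zero_in_L2 (R : realType) (Omega : set 'rV[R]_3)
    (p : 'rV[R]_3 -> R) : Prop :=
  ae3 (fun x => Omega x -> p x = 0).

Definition P_m0 (R : realType) (Omega : set 'rV[R]_3)
    (T : {fset {fset 'rV[R]_3}}) (m : nat) (p : 'rV[R]_3 -> R) : Prop :=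
  P_m Omega T m p /\ int3 Omega p = 0.

(* For a continuous piecewise polynomial field the classical partial
   derivatives exist off the facets of the mesh, hence almost everywhere, and
   represent the weak ones. *)
Definition partial (R : realType) (i : 'I_3) (f : 'rV[R]_3 -> R) :
    'rV[R]_3 -> R :=
  fun x => 'D_(delta_mx 0 i) f x.

Definition divergence (R : realType) (v : 'rV[R]_3 -> 'rV[R]_3) :
    'rV[R]_3 -> R :=
  fun x => \sum_(i < 3) partial i (fun y => v y 0 i) x.

Definition grad_norm_L2 (R : realType) (Omega : set 'rV[R]_3)
    (v : 'rV[R]_3 -> 'rV[R]_3) : R :=
  Num.sqrt (int3 Omega (fun x =>
    \sum_(i < 3) \sum_(j < 3) (partial j (fun y => v y 0 i) x) ^+ 2)).

Definition critical_pressure (R : realType) (Omega : set 'rV[R]_3)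
    (T : {fset {fset 'rV[R]_3}}) (k : nat) (p : 'rV[R]_3 -> R) : Prop :=
  [/\ P_m Omega T k.-1 p, ~ zero_in_L2 Omega p, int3 Omega p = 0 &
      forall v, vector_S_k0 Omega T k v -> ip_L2 Omega p (divergence v) = 0].

Definition inf_sup_quotient (R : realType) (Omega : set 'rV[R]_3)
    (p : 'rV[R]_3 -> R) (v : 'rV[R]_3 -> 'rV[R]_3) : R :=
  ip_L2 Omega p (divergence v) / (grad_norm_L2 Omega v * norm_L2 Omega p).

(* The infimum and supremum are taken in the extended reals. *)
Definition inf_sup_stable (R : realType) (Omega : set 'rV[R]_3)
    (T : {fset {fset 'rV[R]_3}}) (k : nat) : Prop :=
  exists2 gamma : R, 0 < gamma &
    (gamma%:E <= ereal_inf
       [set s | exists p : 'rV[R]_3 -> R,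
          [/\ P_m0 Omega T k.-1 p, ~ zero_in_L2 Omega p &
              s = ereal_sup
                [set r | exists v : 'rV[R]_3 -> 'rV[R]_3,
                   [/\ vector_S_k0 Omega T k v,
                       exists2 x, Omega x & v x != 0%R &
                       r = (inf_sup_quotient Omega p v)%:E]]]])%E.

(* Main.v *)
Require Import Defs.
From HB Require Import structures.
From mathcomp Require Import all_boot all_order all_algebra finmap.
From mathcomp Require Import all_classical all_reals all_analysis.
From mathcomp Require Import -(notations) mpoly.
From mathcomp Require Import measurable_realfun perm.
From mathcomp Require Import ring lra zify.

(** Let P be the Jacobi polynomial of degree k - 1 for the weight (1 + x)^3.

    The function P (1 - 2 lambda_p) on a tetrahedron K with vertex p acts as a
    point evaluation: integrated over K against a polynomial g of degree at
    most k - 1 it gives c |K| g(p), where c depends on P only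
    ([tetrahedron_point_evaluation]).  Indeed, cut K by the planes
    lambda_p = 1 - s.  In affine coordinates with origin p, a monomial of
    degree d integrates over such a slice to a multiple of s^(d + 2).  For
    1 <= d <= k - 1 this is the weight s^3 times the polynomial s^(d - 1) of
    degree less than k - 1, to which P (2 s - 1) is orthogonal, so only the
    constant term of g at p survives.

    On each K_i the divergence of v has degree at most k - 1.  The factors
    1 / |K_i| therefore reduce the pairing of the edge function with div v to
    c times the alternating sum of the values at p of the divergences of the
    polynomials v|K_i ([edge_function_integral]).  It remains to see that the
    alternating sum of the gradients at p vanishes for every component f of v
    ([alternating_gradient]).  The two planes through the edge cut space into
    four quadrants; each K_i has one facet at the edge in either plane, and no
    two of the K_i are in the same quadrant.  Along the numbering one passes
    from a quadrant to an adjacent one, so (-1)^i is, up to a global factor,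
    the product of the signs of the two affine functions that define the planes
    ([quadrant_sign_alternates]).  Now take a direction d in the first plane.
    Two tetrahedra on the same side of the second plane share their facet in
    the first one; there f is continuous, so that the derivatives along d of
    both polynomials agree and cancel in the sum.  A tetrahedron without such a
    partner has this facet on the boundary of the domain, where f = 0, so its
    derivative along d is zero ([quadrant_sum_eq0]).  The same holds for the
    second plane, and the directions of both planes span the space.

    At an inner edge there are four tetrahedra.  The computation with the
    constant 1 in place of div v gives the mean value
    c (- 1 + 1 - 1 + 1) = 0, and the edge function is not zero because a
    non-zero polynomial in lambda_p vanishes on finitely many planes only
    ([edge_function_critical]).  For a critical pressure the supremum in the
    inf-sup condition is at most 0.  Instability does not refer to a numbering;
    one is constructed from the existence of a point of the edge inside the
    domain, at which all four quadrants are occupied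
    ([inner_numbering_exists]). *)

Set Implicit Arguments.
Unset Strict Implicit.
Unset Printing Implicit Defensive.

Import Order.TTheory GRing.Theory Num.Theory.
Import numFieldNormedType.Exports.

Local Open Scope classical_set_scope.
Local Open Scope ring_scope.

(** * Affine maps and Lebesgue measure *)

Lemma lebesgue_measure_translate (R : realType) (t : R)
    (A : set (measurableTypeR R)) : measurable A ->
  lebesgue_measure [set x : measurableTypeR R | A (x + t)] =
  lebesgue_measure A.
Proof.
move=> mA.
have mf : measurable_fun [set: measurableTypeR R]
    (fun x : measurableTypeR R => x + t : measurableTypeR R).
  by apply: measurable_funD => //; apply: measurable_cst.
rewrite [RHS](@lebesgue_measure_unique R (pushforward lebesgue_measure
  (fun x : measurableTypeR R => x + t : measurableTypeR R))) //.
move=> _ [[a b] _ <-] /=.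
rewrite /pushforward.
rewrite (_ : _ @^-1` _ = [set` `]a - t, b - t]]); last first.
  by apply/seteqP; split => x /=; rewrite !in_itv/= ltrBlDr lerBrDr.
by rewrite !lebesgue_measure_itv/= !lte_fin ltrD2r; case: ifP => // _;
  rewrite -!EFinB opprB addrA subrK.
Qed.

Lemma product_measure_preserved d1 d2 (T1 : measurableType d1)
    (T2 : measurableType d2) (R : realType)
    (m1 : {sigma_finite_measure set T1 -> \bar R})
    (m2 : {sigma_finite_measure set T2 -> \bar R})
    (f1 : T1 -> T1) (f2 : T2 -> T2) :
  measurable_fun setT f1 -> measurable_fun setT f2 ->
  (forall A, measurable A -> m1 (f1 @^-1` A) = m1 A) ->
  (forall A, measurable A -> m2 (f2 @^-1` A) = m2 A) ->
  forall A, measurable A ->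
    (m1 \x m2)%E ((fun y => (f1 y.1, f2 y.2)) @^-1` A) = (m1 \x m2)%E A.
Proof.
move=> mf1 mf2 pf1 pf2 A mA.
have mf : measurable_fun setT (fun y : T1 * T2 => (f1 y.1, f2 y.2)).
  apply: measurable_fun_pair; first exact: measurableT_comp.
  exact: measurableT_comp.
rewrite [RHS](@product_measure_unique _ _ _ _ _ m1 m2
  (pushforward (m1 \x m2)%E (fun y : T1 * T2 => (f1 y.1, f2 y.2)))) //.
move=> B C mB mC.
rewrite -[LHS]/((m1 \x m2)%E ((f1 @^-1` B) `*` (f2 @^-1` C))).
rewrite product_measure1E //.
- by congr (_ * _)%E; [exact: pf1|exact: pf2].
- by rewrite -[X in measurable X]setTI; apply: mf1.
- by rewrite -[X in measurable X]setTI; apply: mf2.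
Qed.

Lemma sigma_finite_product d1 d2 (T1 : measurableType d1)
    (T2 : measurableType d2) (R : realType)
    (m1 : {sigma_finite_measure set T1 -> \bar R})
    (m2 : {sigma_finite_measure set T2 -> \bar R}) :
  sigma_finite setT (m1 \x m2)%E.
Proof.
have /sigma_finiteP[F [cF ndF finF]] := sigma_finiteT m1.
have /sigma_finiteP[G [cG ndG finG]] := sigma_finiteT m2.
exists (fun n => F n `*` G n); last first.
  move=> n; have [mFn Fn] := finF n; have [mGn Gn] := finG n.
  by split; [exact: measurableX | rewrite product_measure1E// lte_mul_pinfty// ge0_fin_numE].
apply/seteqP; split => // -[x y] _.
have [[n _ Fx] [k _ Gy]] : (\bigcup_n F n) x /\ (\bigcup_n G n) y by rewrite -cF -cG.
exists (maxn n k) => //; split => /=.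
  by have /subsetPset := ndF _ _ (leq_maxl n k); exact.
by have /subsetPset := ndG _ _ (leq_maxr n k); exact.
Qed.

(** Sigma-finiteness lets a product be a factor of a further product, as the
    coordinate plane is in [leb3]. *)
Definition product_sfm d1 d2 (T1 : measurableType d1)
    (T2 : measurableType d2) (R : realType)
    (m1 : {sigma_finite_measure set T1 -> \bar R})
    (m2 : {sigma_finite_measure set T2 -> \bar R}) :
    {sigma_finite_measure set (T1 * T2)%type -> \bar R} :=
  HB.pack (m1 \x m2)%E (Measure_isSigmaFinite.Build _ _ _ _ (sigma_finite_product m1 m2)).

Definition leb2 (R : realType) := 
  product_sfm (@lebesgue_measure R) (@lebesgue_measure R).

Lemma leb3_translate (R : realType) (t : coords3 R) (A : set (coords3 R)) :
  measurable A -> leb3 R [set y | A (y + t)] = leb3 R A.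
Proof.
move=> mA; rewrite /leb3.
have mt (s : R) : measurable_fun [set: measurableTypeR R]
    (fun x : measurableTypeR R => x + s : measurableTypeR R).
  by apply: measurable_funD => //; apply: measurable_cst.
have m12 : measurable_fun setT (fun y : measurableTypeR R * measurableTypeR R =>
    (y.1 + t.1.1 : measurableTypeR R, y.2 + t.1.2 : measurableTypeR R)).
  apply: measurable_fun_pair; apply: measurableT_comp (mt _) _; by [].
have p1 (s : R) (B : set (measurableTypeR R)) : measurable B ->
    (@lebesgue_measure R) ((fun x : measurableTypeR R => x + s) @^-1` B) =
    lebesgue_measure B.
  exact: lebesgue_measure_translate.
have p2 := @product_measure_preserved _ _ _ _ R (@lebesgue_measure R)
  (@lebesgue_measure R) _ _ (mt t.1.1) (mt t.1.2) (p1 _) (p1 _).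
exact: (@product_measure_preserved _ _ _ _ R (leb2 R) (@lebesgue_measure R)
  _ _ m12 (mt t.2) p2 (p1 _) A mA).
Qed.

Lemma measurable_coords3 d (T : measurableType d) (R : realType)
    (f : T -> coords3 R) :
  measurable_fun setT (fun x => (f x).1.1) ->
  measurable_fun setT (fun x => (f x).1.2) ->
  measurable_fun setT (fun x => (f x).2) -> measurable_fun setT f.
Proof.
move=> m1 m2 m3.
rewrite (_ : f = fun x => ((f x).1.1, (f x).1.2, (f x).2)); last first.
  by apply/funext => x; case: (f x) => [[? ?] ?].
by apply: measurable_fun_pair => //; apply: measurable_fun_pair.
Qed.

Lemma coords3_measurable d (T : measurableType d) (R : realType)
    (f : T -> coords3 R) : measurable_fun setT f ->
  measurable_fun setT (fun x => (f x).1.1 : R) *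
  measurable_fun setT (fun x => (f x).1.2 : R) *
  measurable_fun setT (fun x => (f x).2 : R).
Proof.
move=> mf; split; last exact: (measurableT_comp measurable_snd mf).
have m1 := measurableT_comp measurable_fst mf.
split; first exact: (measurableT_comp measurable_fst m1).
exact: (measurableT_comp measurable_snd m1).
Qed.

Lemma integral_indicZr d (T : measurableType d) (R : realType)
    (mu : {measure set T -> \bar R}) (A : set T) (c : \bar R) :
  measurable A -> (0 <= c)%E -> (\int[mu]_x ((\1_A x)%:E * c) = mu A * c)%E.
Proof.
move=> mA c0; rewrite ge0_integralZr //; first by rewrite integral_indic ?setIT.
exact/measurable_EFinP/measurable_indic.
Qed.

(** The indicator of {(x, y) | x in A, y - x in B} is integrated in both
    orders. By the invariance of nu and of mu, the second order is also that
    of {(x, y) | - x in B, x + y in A}. For a fixed A, and with nu = mu in a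
    first step, this makes nu proportional to mu. *)
Lemma translation_invariant_unique (R : realType)
    (mu nu : {sigma_finite_measure set (coords3 R) -> \bar R}) :
  (forall (t : coords3 R) (A : set (coords3 R)), measurable A ->
    mu [set y | A (y + t)] = mu A) ->
  (forall (t : coords3 R) (A : set (coords3 R)), measurable A ->
    nu [set y | A (y + t)] = nu A) ->
  forall A B : set (coords3 R), measurable A -> measurable B ->
    (mu A * nu B = mu [set y | B (- y)%R] * nu A)%E.
Proof.
move=> mut nut A B mA mB.
have m1 : measurable_fun setT (fun z : coords3 R * coords3 R => z.1 : coords3 R).
  exact: measurable_fst.
have m2 : measurable_fun setT (fun z : coords3 R * coords3 R => z.2 : coords3 R).
  exact: measurable_snd.
have [[m11 m12] m13] := coords3_measurable m1.
have [[m21 m22] m23] := coords3_measurable m2.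
have mD : measurable_fun setT
    (fun z : coords3 R * coords3 R => z.2 - z.1 : coords3 R).
  by apply: measurable_coords3; apply: measurable_funB.
have mN : measurable_fun setT
    (fun z : coords3 R * coords3 R => - z.1 : coords3 R).
  by apply: measurable_coords3; apply: measurable_funN.
have mS : measurable_fun setT
    (fun z : coords3 R * coords3 R => z.1 + z.2 : coords3 R).
  by apply: measurable_coords3; apply: measurable_funD.
have mN1 : measurable_fun setT (fun z : coords3 R => - z : coords3 R).
  have [[? ?] ?] := coords3_measurable (@measurable_id _ (coords3 R) setT).
  by apply: measurable_coords3; apply: measurable_funN.
have mNB : measurable [set y | B (- y)].
  by rewrite -[X in measurable X]setTI; apply: mN1.
pose S := [set z : coords3 R * coords3 R | A z.1 /\ B (z.2 - z.1)].
have mesS : measurable S.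
  apply: measurableI; rewrite -[X in measurable X]setTI.
    exact: measurable_fst.
  exact: mD.
pose S' := [set z : coords3 R * coords3 R | B (- z.1) /\ A (z.1 + z.2)].
have mesS' : measurable S'.
  by apply: measurableI; rewrite -[X in measurable X]setTI; [exact: mN|exact: mS].
have tonelli X : measurable X ->
    (\int[mu]_x nu (xsection X x) = \int[nu]_y mu (ysection X y))%E.
  by move=> mX; have := indic_fubini_tonelli mu nu mX;
    rewrite indic_fubini_tonelli_FE ?indic_fubini_tonelli_GE.
have E1 : (\int[mu]_x nu (xsection S x) = mu A * nu B)%E.
  rewrite -integral_indicZr //; apply: eq_integral => x _; rewrite indicE.
  have [xA|xA] := boolP (x \in A); last first.
    rewrite mul0e -(measure0 nu); congr (nu _); apply/seteqP; split => // y.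
    by rewrite /xsection/= in_setE => -[/mem_set]; rewrite (negbTE xA).
  rewrite mul1e -(nut (- x) B mB); congr (nu _); apply/seteqP.
  move/set_mem : xA => xA.
  by split => y; rewrite /xsection/= in_setE => //; case.
have E2 : (\int[mu]_x nu (xsection S' x) = mu [set y | B (- y)%R] * nu A)%E.
  rewrite -integral_indicZr //; apply: eq_integral => x _; rewrite indicE.
  have [xA|xA] := boolP (x \in [set y | B (- y)]); last first.
    rewrite mul0e -(measure0 nu); congr (nu _); apply/seteqP; split => // y.
    by rewrite /xsection/= in_setE => -[] + _; move: xA; rewrite notin_setE.
  rewrite mul1e -(nut x A mA); congr (nu _); apply/seteqP.
  move/set_mem : xA => xA.
  by split => y; rewrite /xsection/= in_setE addrC => //; case.
rewrite -E1 -E2 !tonelli //; apply: eq_integral => y _.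
rewrite -(mut y (ysection S y)); last exact: measurable_ysection.
have xyy (x : coords3 R) : y - (x + y) = - x.
  move: x y => [[x1 x2] x3] [[y1 y2] y3].
  by congr (_, _, _) => /=; rewrite opprD addrCA subrr addr0.
congr (mu _); apply/seteqP; split => x; rewrite /ysection/= !in_setE/=.
  by move=> -[p q]; split; [rewrite -xyy; exact: q | exact: p].
by move=> -[q p]; split; [exact: p | move: q; rewrite -xyy].
Qed.

Definition unvec3 (R : realType) (v : 'rV[R]_3) : coords3 R :=
  (v 0 0, v 0 1, v 0 2%:R).

Lemma vec3E (R : realType) (y : coords3 R) :
  (vec3 y 0 0 = y.1.1) * (vec3 y 0 1 = y.1.2) * (vec3 y 0 2%:R = y.2).
Proof. by rewrite !mxE. Qed.

Lemma ord3P (P : 'I_3 -> Prop) : P 0 -> P 1 -> P 2%:R -> forall i, P i.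
Proof.
move=> p0 p1 p2 [[|[|[|//]]] i3].
- by rewrite (_ : Ordinal i3 = 0) //; apply: val_inj.
- by rewrite (_ : Ordinal i3 = 1) //; apply: val_inj.
- by rewrite (_ : Ordinal i3 = 2%:R) //; apply: val_inj.
Qed.

Lemma sum_ord3 (V : nmodType) (F : 'I_3 -> V) :
  \sum_i F i = F 0 + F 1 + F 2%:R.
Proof.
rewrite !big_ord_recl big_ord0 addr0 addrA.
by congr (_ + F _ + F _); apply: val_inj.
Qed.

Lemma prod_ord3 (S : comNzSemiRingType) (F : 'I_3 -> S) :
  \prod_i F i = F 0 * F 1 * F 2%:R.
Proof.
rewrite !big_ord_recl big_ord0 mulr1 mulrA.
by congr (_ * F _ * F _); apply: val_inj.
Qed.

Lemma unvec3K (R : realType) : cancel (@unvec3 R) (@vec3 R).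
Proof. by move=> v; apply/rowP; apply: ord3P; rewrite vec3E. Qed.

Lemma vec3K (R : realType) : cancel (@vec3 R) (@unvec3 R).
Proof. by move=> [[x y] z]; rewrite /unvec3 !vec3E. Qed.

Lemma vec3D (R : realType) (x y : coords3 R) : vec3 (x + y) = vec3 x + vec3 y.
Proof. by apply/rowP; apply: ord3P; rewrite [RHS]mxE !vec3E. Qed.

Lemma measurable_vec3 (R : realType) (i : 'I_3) :
  measurable_fun [set: coords3 R] (fun y => vec3 y 0 i : R).
Proof.
have [[m1 m2] m3] := coords3_measurable (@measurable_id _ (coords3 R) setT).
move: i; apply: ord3P.
- by under eq_fun do rewrite vec3E.
- by under eq_fun do rewrite vec3E.
- by under eq_fun do rewrite vec3E.
Qed.

Definition affine3 (R : realType) (M : 'M[R]_3) (t : 'rV[R]_3)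
    (y : coords3 R) : coords3 R := unvec3 (vec3 y *m M + t).

Lemma measurable_affine3 (R : realType) (M : 'M[R]_3) (t : 'rV[R]_3) :
  measurable_fun setT (affine3 M t).
Proof.
have mc j : measurable_fun setT (fun y => (vec3 y *m M + t) 0 j).
  rewrite (_ : (fun y => _) =
      (fun y => \sum_i (vec3 y 0 i * M i j) + t 0 j)); last first.
    by apply/funext => y; rewrite !mxE.
  apply: measurable_funD; last exact: measurable_cst.
  apply: measurable_sum => i; apply: measurable_funM; last exact: measurable_cst.
  exact: measurable_vec3.
by apply: measurable_coords3; apply: mc.
Qed.

Definition box3 (R : realType) (r : R) : set (coords3 R) :=
  (`[- r, r] `*` `[- r, r]) `*` `[- r, r].

Lemma box3E (R : realType) (r : R) (y : coords3 R) :
  box3 r y <-> forall i, `|vec3 y 0 i| <= r.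
Proof.
rewrite /box3/=; split.
  by rewrite !in_itv/= => -[[h1 h2] h3]; apply: ord3P; rewrite vec3E ler_norml.
move=> h; have := (h 0, h 1, h 2%:R); rewrite !vec3E !ler_norml => -[[h1 h2] h3].
by rewrite !in_itv.
Qed.

Lemma measurable_box3 (R : realType) (r : R) : measurable (box3 r).
Proof. by apply: measurableX; [apply: measurableX|]; exact: measurable_itv. Qed.

Lemma leb3_box3 (R : realType) (r : R) : 0 < r ->
  leb3 R (box3 r) = ((2 * r) ^+ 3)%:E.
Proof.
move=> r0; rewrite /leb3 /box3.
have E : lebesgue_measure (`[- r, r] : set (measurableTypeR R)) = (2 * r)%:E.
  rewrite lebesgue_measure_itv/= lte_fin.
  rewrite ifT; last by lra.
  by rewrite -EFinB; congr EFin; ring.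
have mI : measurable (`[- r, r] : set (measurableTypeR R)) by exact: measurable_itv.
have E2 := @product_measure1E _ _ _ _ R (@lebesgue_measure R) (@lebesgue_measure R) _ _ mI mI.
have E3 := @product_measure1E _ _ _ _ R (leb2 R) (@lebesgue_measure R) _ _ (measurableX mI mI) mI.
have E2' : leb2 R (`[- r, r] `*` `[- r, r]) = ((2 * r) * (2 * r))%:E.
  by apply: etrans E2 _; rewrite EFinM; congr (_ * _)%E; exact: E.
apply: etrans E3 _; apply: (@etrans _ _ ((2 * r * (2 * r))%:E * (2 * r)%:E)%E).
  by congr (_ * _)%E; [exact: E2' | exact: E].
by rewrite -EFinM; congr EFin; ring.
Qed.

Lemma leb3_bounded (R : realType) (A : set (coords3 R)) (r : R) :
  measurable A -> A `<=` box3 r -> (leb3 R A < +oo)%E.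
Proof.
move=> mA Ar; apply: (@le_lt_trans _ _ (leb3 R (box3 (1 + `|r|)))).
  apply: le_measure; rewrite ?inE //; first exact: measurable_box3.
  move=> y /Ar/box3E h; apply/box3E => i; apply: (le_trans (h i)).
  by rewrite (le_trans (ler_norm _)) // lerDr.
by rewrite leb3_box3 ?ltry // ltr_pwDl.
Qed.

Lemma box3_cover (R : realType) : \bigcup_n box3 (n%:R : R) = setT.
Proof.
apply/seteqP; split => // y _.
pose b := \sum_i `|vec3 y 0 i|.
exists (Num.truncn b).+1 => //; apply/box3E => i.
rewrite (@le_trans _ _ b) //; last first.
  by apply/ltW/truncnS_gt.
by rewrite /b (bigD1 i) //= lerDl sumr_ge0.
Qed.

Lemma affine3_translate (R : realType) (M : 'M[R]_3) (t : 'rV[R]_3) y s :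
  M \in unitmx ->
  affine3 M t y + s = affine3 M t (y + unvec3 (vec3 s *m invmx M)).
Proof.
move=> uM; apply: (can_inj (@vec3K R)).
by rewrite vec3D !unvec3K vec3D unvec3K mulmxDl mulmxKV // addrAC.
Qed.

Lemma affine3_box3 (R : realType) (M : 'M[R]_3) (t : 'rV[R]_3) (r : R) :
  M \in unitmx -> exists2 s, 0 < s & affine3 M t @^-1` (box3 r) `<=` box3 s.
Proof.
move=> uM.
pose b := \sum_i \sum_j ((r + `|t 0 i|) * `|invmx M i j|).
exists (1 + `|b|); first by rewrite ltr_pwDl.
move=> y /= /box3E h; apply/box3E => j.
have -> : vec3 y = (vec3 (affine3 M t y) - t) *m invmx M.
  by rewrite unvec3K addrK mulmxK.
have r0 : 0 <= r by apply: le_trans (h 0).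
rewrite mxE (le_trans (ler_norm_sum _ _ _)) //.
apply: (@le_trans _ _ b); last by have := ler_norm b; lra.
apply: ler_sum => i _; rewrite (bigD1 j) //=.
rewrite -[leLHS]addr0 lerD //; last first.
  by apply: sumr_ge0 => k _; rewrite mulr_ge0 // addr_ge0.
rewrite normrM ler_wpM2r // [X in `|X|]mxE [X in _ + X]mxE.
by rewrite (le_trans (ler_normB _ _)) // lerD2r.
Qed.

Lemma muleI_EFin (R : realType) (c : R) (x y : \bar R) :
  c != 0 -> (c%:E * x = c%:E * y -> x = y)%E.
Proof.
move=> c0 /(congr1 (mule (c^-1)%:E)).
by rewrite !muleA -!EFinM mulVf // !mul1e.
Qed.

(** The image of Lebesgue measure under an affine bijection is again invariant
    under translations, hence proportional to Lebesgue measure. The factor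
    stays unspecified: in the integrals over tetrahedra it cancels against the
    one in the volume. *)
Lemma leb3_affine (R : realType) (M : 'M[R]_3) (t : 'rV[R]_3) :
  M \in unitmx -> exists2 c : R, 0 < c &
    forall B, measurable B -> (leb3 R (affine3 M t @^-1` B) = c%:E * leb3 R B)%E.
Proof.
move=> uM; have mA := measurable_affine3 M t.
have mpre B : measurable B -> measurable (affine3 M t @^-1` B).
  by move=> mB; rewrite -[X in measurable X]setTI; apply: mA.
pose mu := product_sfm (leb2 R) (@lebesgue_measure R).
pose nu0 : {measure set (coords3 R) -> \bar R} := 
   measure_function_pushforward__canonical__measure_function_Measure (leb3 R) mA.
have nusf : sigma_finite setT nu0.
  exists (fun n => box3 n%:R); first by rewrite box3_cover.
  move=> n; split; first exact: measurable_box3.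
  have [s s0 hs] := affine3_box3 t n%:R uM.
  exact: leb3_bounded (mpre _ (measurable_box3 _)) hs.
pose nu_ : {sigma_finite_measure set (coords3 R) -> \bar R} :=
  HB.pack (pushforward (leb3 R) (affine3 M t))
    (Measure_isSigmaFinite.Build _ _ _ _ nusf).
pose nu := nu_ mA.
have nuE B : nu B = leb3 R (affine3 M t @^-1` B) by [].
have mut (s : coords3 R) (A : set (coords3 R)) : measurable A -> mu [set y | A (y + s)] = mu A.
  exact: leb3_translate.
have nut (s : coords3 R) (A : set (coords3 R)) : measurable A -> nu [set y | A (y + s)] = nu A.
  move=> mesA; pose u := unvec3 (vec3 s *m invmx M).
  have E : affine3 M t @^-1` [set y | A (y + s)] =
      [set y | (affine3 M t @^-1` A) (y + u)].
    apply/seteqP; split => y h.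
      exact: (eq_ind _ A h _ (affine3_translate t y s uM)).
    exact: (eq_ind _ A h _ (esym (affine3_translate t y s uM))).
  exact: (etrans (f_equal (leb3 R) E) (leb3_translate u (mpre _ mesA))).
have mB1 : measurable (box3 (1 : R)) by exact: measurable_box3.
have H := translation_invariant_unique mut nut mB1.
have HN := translation_invariant_unique mut mut mB1.
have mB1E : mu (box3 1) = 8%:E.
  by rewrite [LHS]leb3_box3 //; congr EFin; ring.
have muN (B : set (coords3 R)) : measurable B -> mu [set y | B (- y)%R] = mu B.
  move=> mB; have := HN B mB; rewrite mB1E [RHS]muleC.
  by move/esym; apply: muleI_EFin.
have nu1 : (nu (box3 1) \is a fin_num).
  rewrite ge0_fin_numE // nuE.
  have [s s0 hs] := affine3_box3 t 1 uM.
  exact: leb3_bounded (mpre _ mB1) hs.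
pose c := fine (nu (box3 1)) / 8.
have cE (B : set (coords3 R)) : measurable B -> (nu B = c%:E * mu B)%E.
  move=> mB; apply: (@muleI_EFin _ 8) => //.
  have := H B mB; rewrite (muN _ mB) mB1E -(fineK nu1) => ->.
  by rewrite muleA -EFinM /c mulrC divfK // muleC.
exists c; last exact: cE.
rewrite lt_neqAle divr_ge0 ?fine_ge0 // andbT; apply/eqP => c0.
have : nu setT = 0 by rewrite cE // -c0 mul0e.
rewrite nuE preimage_setT => mu0.
have : (leb3 R (box3 1) <= leb3 R setT)%E by apply: le_measure; rewrite ?inE.
by rewrite mu0 leb3_box3 // lee_fin; lra.
Qed.

Section off_null.
Context d (T : measurableType d) (R : realType).
Variable mu : {measure set T -> \bar R}.
Import HBNNSimple.
Local Open Scope ereal_scope.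

Let ge0_integral_off_null_le (f g : T -> \bar R) (N : set T) :
  measurable N -> mu N = 0 -> (forall x, 0 <= f x) -> (forall x, 0 <= g x) ->
  (forall x, ~ N x -> f x = g x) -> \int[mu]_x f x <= \int[mu]_x g x.
Proof.
move=> mN N0 f0 g0 fg; rewrite !ge0_integralTE // ge_ereal_sup// => _ [h/= hf <-].
pose h' := proj_nnsfun h (measurableC mN).
apply: le_ereal_sup_tmp; exists (sintegral mu h'); last first.
  rewrite -!integralT_nnsfun le_eqVlt; apply/orP; left; apply/eqP.
  apply: ge0_ae_eq_integral => //.
  - by apply/measurable_EFinP.
  - by apply/measurable_EFinP.
  - by move=> x _; rewrite lee_fin.
  - by move=> x _; rewrite lee_fin.
  - exists N; split => // x /= /not_implyP[_] H; apply: contrapT => Nx; apply: H.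
    by rewrite /h' /= /mindic/= indicE mem_set ?mulr1.
exists h' => // x.
have [Nx|Nx] := pselect (N x).
  by rewrite /h' /= /mindic/= indicE memNset ?mulr0.
by rewrite -fg // (le_trans _ (hf x)) // /h' /= /mindic/= indicE mem_set ?mulr1.
Qed.

(** For non-negative functions the integral is the supremum of the integrals
    of the simple functions below, and cutting these off on N preserves their
    integrals. The divergence of a piecewise polynomial field, whose values on
    the facets are arbitrary, is integrated through this lemma. *)
Lemma integral_off_null (f g : T -> \bar R) (N : set T) :
  measurable N -> mu N = 0 -> (forall x, ~ N x -> f x = g x) ->
  \int[mu]_x f x = \int[mu]_x g x.
Proof.
move=> mN N0 fg; rewrite integralE [RHS]integralE.
by congr (_ - _); apply/eqP; rewrite eq_le; apply/andP; split;
  apply: (ge0_integral_off_null_le mN) => // x Nx; rewrite ?funeposE ?funenegE fg.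
Qed.

End off_null.

Lemma Rintegral_off_null d (T : measurableType d) (R : realType)
    (mu : {measure set T -> \bar R}) (D D' : set T) (f g : T -> R) (N : set T) :
  measurable N -> mu N = 0%E -> (forall x, ~ N x -> (f \_ D) x = (g \_ D') x) ->
  \int[mu]_(x in D) f x = \int[mu]_(x in D') g x.
Proof.
move=> mN N0 fg; rewrite Rintegral_mkcond [RHS]Rintegral_mkcond; congr fine.
by apply: (integral_off_null mN) => // x Nx; rewrite fg.
Qed.

Lemma Rintegral_affine3 (R : realType) (M : 'M[R]_3) (t : 'rV[R]_3) (c : R)
    (B : set (coords3 R)) (f : coords3 R -> R) :
  (forall B, measurable B -> (leb3 R (affine3 M t @^-1` B) = c%:E * leb3 R B)%E) ->
  0 < c -> measurable B -> measurable_fun setT f ->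
  (leb3 R).-integrable B (EFin \o f) ->
  \int[leb3 R]_(y in affine3 M t @^-1` B) f (affine3 M t y) =
  c * \int[leb3 R]_(y in B) f y.
Proof.
move=> cE c0 mB mf intf; have mA := measurable_affine3 M t.
pose k : {nonneg R} := NngNum (ltW c0).
have ge0E (g : coords3 R -> \bar R) : measurable_fun setT g -> (forall y, 0 <= g y)%E ->
  (\int[leb3 R]_(y in affine3 M t @^-1` B) g (affine3 M t y) =
  c%:E * \int[leb3 R]_(y in B) g y)%E.
  move=> mg g0.
  rewrite -[LHS](ge0_integral_pushforward mA) //; last exact: measurable_funTS.
  rewrite -(@ge0_integral_mscale _ _ _ (leb3 R) _ _ k) //; last exact: measurable_funTS.
  apply: eq_measure_integral => C mC _.
  exact: cE.
have mEf : measurable_fun setT (EFin \o f) by exact/measurable_EFinP.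
have Ep := ge0E _ (measurable_funepos mEf) (fun y => funepos_ge0 _ y).
have En := ge0E _ (measurable_funeneg mEf) (fun y => funeneg_ge0 _ y).
have finp := integrable_pos_fin_num mB intf.
have finn := integrable_neg_fin_num mB intf.
transitivity (fine
   (\int[leb3 R]_(y in affine3 M t @^-1` B) (((EFin \o f)^\+)%E (affine3 M t y)) -
    \int[leb3 R]_(y in affine3 M t @^-1` B) (((EFin \o f)^\-)%E (affine3 M t y)))).
  congr fine; rewrite [LHS]integralE; congr (_ - _)%E; apply: eq_integral => y _.
    by rewrite !funeposE.
  by rewrite !funenegE.
have fineMB (a b : \bar R) : a \is a fin_num -> b \is a fin_num ->
    fine (c%:E * a - c%:E * b)%E = c * fine (a - b)%E.
  by case: a => // a; case: b => // b _ _; rewrite -!EFinM -!EFinB /= mulrBr.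
rewrite Ep En; apply: etrans (fineMB _ _ finp finn) _.
by congr (c * fine _); apply: esym; exact: integralE.
Qed.

(** * Polynomial functions of three variables *)

Definition mev (R : realType) (q : mpoly 3 R) (x : 'rV[R]_3) : R :=
  meval (fun i => x 0 i) q.

Section mev.
Variable R : realType.
Implicit Types (q : mpoly 3 R) (x : 'rV[R]_3).

Lemma mevE q x : mev q x = \sum_(m <- msupp q) mcoeff m q * \prod_i x 0 i ^+ m i.
Proof. by rewrite /mev mevalE. Qed.

Lemma mevD p q x : mev (p + q) x = mev p x + mev q x.
Proof. exact: mevalD. Qed.

Lemma mevM p q x : mev (p * q) x = mev p x * mev q x.
Proof. exact: mevalM. Qed.

Lemma mevZ c q x : mev (c *: q) x = c * mev q x.
Proof. exact: mevalZ. Qed.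

Lemma mevC c x : mev (mpolyC 3 c) x = c.
Proof. exact: mevalC. Qed.

Lemma mevX i x : mev (mpolyX R (mnm1 i)) x = x 0 i.
Proof. exact: mevalXU. Qed.

Lemma mev_sum (I : Type) (r : seq I) (P : pred I) (F : I -> mpoly 3 R) x :
  mev (\sum_(i <- r | P i) F i) x = \sum_(i <- r | P i) mev (F i) x.
Proof.
elim/big_rec2: _ => [|i a p _ IH]; first exact: meval0.
by rewrite mevD IH.
Qed.

Lemma measurable_mev q : measurable_fun setT (fun y : coords3 R => mev q (vec3 y)).
Proof.
under eq_fun do rewrite mevE.
apply: measurable_sum => m; apply: measurable_funM; first exact: measurable_cst.
apply: measurable_prod => i _; apply: measurable_funX; exact: measurable_vec3.
Qed.

Lemma mev_bounded q (r : R) : exists M : R, forall x,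
  (forall i, `|x 0 i| <= r) -> `|mev q x| <= M.
Proof.
exists (\sum_(m <- msupp q) `|mcoeff m q| * \prod_i r ^+ m i) => x xr.
rewrite mevE (le_trans (ler_norm_sum _ _ _)) //; apply: ler_sum => m _.
rewrite normrM ler_wpM2l // normr_prod; apply: ler_prod => i _.
by rewrite normr_ge0 normrX lerXn2r // nnegrE (le_trans _ (xr i)).
Qed.

Lemma integrable_mev q (A : set (coords3 R)) (r : R) :
  measurable A -> A `<=` box3 r ->
  (leb3 R).-integrable A (fun y => (mev q (vec3 y))%:E).
Proof.
move=> mA Ar; apply: measurable_bounded_integrable => //.
- exact: leb3_bounded Ar.
- exact: measurable_funTS (measurable_mev q).
- have [M hM] := mev_bounded q r.
  exists M; split; first exact: num_real.
  move=> N MN y Ay /=; rewrite (le_trans (hM _ _)) ?ltW //.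
  by move=> i; move/Ar : Ay => /box3E.
Qed.

End mev.

Section poly_fun.
Variable R : realType.
Implicit Types (g h : 'rV[R]_3 -> R) (d e : nat).

Lemma poly_funP d g : poly_fun d g <->
  exists2 q : mpoly 3 R, (msize q <= d.+1)%N & g = mev q.
Proof.
split=> [[q [sq gq]]|[q sq ->]]; exists q => //.
by apply/funext => x; rewrite gq.
Qed.

Lemma poly_fun_le d e g : (d <= e)%N -> poly_fun d g -> poly_fun e g.
Proof. by move=> de [q [sq gq]]; exists q; split => //; apply: leq_trans sq _. Qed.

Lemma poly_fun_cst d (c : R) : poly_fun d (fun=> c).
Proof.
exists (mpolyC 3 c); split; last by move=> x; rewrite mevalC.
by rewrite mmeasureC; case: (_ != _).
Qed.

Lemma poly_fun_coord (i : 'I_3) : poly_fun 1 (fun x : 'rV[R]_3 => x 0 i).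
Proof.
by exists (mpolyX R (mnm1 i)); split => [|x]; rewrite ?mevalXU // msizeX mdeg1.
Qed.

Lemma poly_funD d g h : poly_fun d g -> poly_fun d h -> poly_fun d (fun x => g x + h x).
Proof.
move=> [p [sp gp]] [q [sq hq]]; exists (p + q).
split=> [|x]; last by rewrite mevalD gp hq.
by apply: leq_trans (mmeasureD_le _ _ _) _; rewrite geq_max sp.
Qed.

Lemma poly_funM d e g h : poly_fun d g -> poly_fun e h ->
  poly_fun (d + e) (fun x => g x * h x).
Proof.
move=> [p [sp gp]] [q [sq hq]]; exists (p * q).
split=> [|x]; last by rewrite mevalM gp hq.
have [->|p0] := eqVneq p 0; first by rewrite mul0r msize0.
have [->|q0] := eqVneq q 0; first by rewrite mulr0 msize0.
rewrite msizeM //; move: sp sq; move: (msize p) (msize q) => a b /=; lia.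
Qed.

Lemma poly_funZ d (c : R) g : poly_fun d g -> poly_fun d (fun x => c * g x).
Proof. exact: (poly_funM (poly_fun_cst 0 c)). Qed.

Lemma poly_fun_sum d (I : eqType) (r : seq I) (F : I -> 'rV[R]_3 -> R) :
  (forall i, i \in r -> poly_fun d (F i)) ->
  poly_fun d (fun x => \sum_(i <- r) F i x).
Proof.
elim: r => [|i r IH] F_d.
  by under eq_fun do rewrite big_nil; exact: poly_fun_cst.
under eq_fun do rewrite big_cons.
apply: poly_funD; first by apply: F_d; rewrite mem_head.
by apply: IH => j jr; apply: F_d; rewrite inE jr orbT.
Qed.

Lemma poly_fun_prod (I : eqType) (r : seq I) (D : I -> nat)
    (F : I -> 'rV[R]_3 -> R) : (forall i, i \in r -> poly_fun (D i) (F i)) ->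
  poly_fun (\sum_(i <- r) D i)%N (fun x => \prod_(i <- r) F i x).
Proof.
elim: r => [|i r IH] F_d.
  by rewrite big_nil; under eq_fun do rewrite big_nil; exact: poly_fun_cst.
rewrite big_cons; under [X in poly_fun _ X]eq_fun do rewrite big_cons.
apply: poly_funM; first by apply: F_d; rewrite mem_head.
by apply: IH => j jr; apply: F_d; rewrite inE jr orbT.
Qed.

Lemma poly_funX d n g : poly_fun d g -> poly_fun (d * n) (fun x => g x ^+ n).
Proof.
move=> gd; elim: n => [|n IH].
  by under eq_fun do rewrite expr0; exact: poly_fun_cst.
by under eq_fun do rewrite exprS; rewrite mulnS; exact: poly_funM.
Qed.

Lemma poly_fun_affine (n : 'rV[R]_3) (c : R) :
  poly_fun 1 (fun x => \sum_(i < 3) n 0 i * x 0 i + c).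
Proof.
apply: poly_funD; last exact: poly_fun_cst.
by apply: poly_fun_sum => i _; apply: poly_funZ; exact: poly_fun_coord.
Qed.

Lemma poly_fun_horner (n : nat) (P : {poly R}) g :
  (size P <= n.+1)%N -> poly_fun 1 g -> poly_fun n (fun x => P.[g x]).
Proof.
move=> sP g1; under eq_fun do rewrite horner_coef.
apply: poly_fun_sum => i _; apply: poly_funZ.
apply: (@poly_fun_le (1 * i)); last exact: poly_funX.
by rewrite mul1n; have := ltn_ord i; lia.
Qed.

Lemma poly_fun_comp d g (f : 'rV[R]_3 -> 'rV[R]_3) :
  (forall i, poly_fun 1 (fun x => f x 0 i)) -> poly_fun d g ->
  poly_fun d (fun x => g (f x)).
Proof.
move=> f1 /poly_funP[q sq ->]; under eq_fun do rewrite mevE.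
apply: poly_fun_sum => m mq; apply: poly_funZ.
have md : (mdeg m <= d)%N by have := msize_mdeg_lt mq; lia.
apply: (poly_fun_le md); rewrite mdegE.
apply: poly_fun_prod => i _; rewrite -[X in poly_fun X]mul1n; exact: poly_funX.
Qed.

Lemma poly_fun_integrable d g (A : set (coords3 R)) (r : R) :
  poly_fun d g -> measurable A -> A `<=` box3 r ->
  (leb3 R).-integrable A (fun y => (g (vec3 y))%:E).
Proof. by move=> /poly_funP[q _ ->]; exact: integrable_mev. Qed.

Lemma poly_fun_measurable d g :
  poly_fun d g -> measurable_fun setT (fun y : coords3 R => g (vec3 y)).
Proof. by move=> /poly_funP[q _ ->]; exact: measurable_mev. Qed.

Lemma poly_fun_bounded d g (r : R) : poly_fun d g ->
  exists M : R, forall x : 'rV[R]_3, (forall i, `|x 0 i| <= r) -> `|g x| <= M.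
Proof. by move=> /poly_funP[q _ ->]; exact: mev_bounded. Qed.

End poly_fun.

(** * Jacobi polynomials *)

Section poly_integral.
Variable R : realType.
Local Notation mu := (@lebesgue_measure R).
Implicit Types p q : {poly R}.

Lemma integral_deriv_poly p (a b : R) : a <= b ->
  (\int[mu]_(x in `[a, b]) (p^`().[x])%:E = (p.[b] - p.[a])%:E)%E.
Proof.
rewrite le_eqVlt => /predU1P[<-|ab].
  by rewrite set_itv1 integral_set1 subrr.
rewrite EFinB; apply: continuous_FTC2 => //.
- by apply: continuous_subspaceT; exact: continuous_horner.
- split.
  + by move=> x _; exact: derivable_horner.
  + by apply: cvg_at_right_filter; exact: continuous_horner.
  + by apply: cvg_at_left_filter; exact: continuous_horner.
- by move=> x _; rewrite derivE.
Qed.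

Definition primitive p : {poly R} :=
  \poly_(i < (size p).+1) (p`_i.-1 / i%:R).

Lemma deriv_primitive p : (primitive p)^`() = p.
Proof.
apply/polyP => i; rewrite coef_deriv coef_poly ltnS.
case: ltnP => sp /=; last by rewrite mul0rn nth_default.
by rewrite -(mulr_natr (_ / _)) mulfVK // pnatr_eq0.
Qed.

Lemma Rintegral_deriv_poly p (a b : R) : a <= b ->
  \int[mu]_(x in `[a, b]) p^`().[x] = p.[b] - p.[a].
Proof. by move=> ab; rewrite /Rintegral integral_deriv_poly. Qed.

Lemma Rintegral_poly p (a b : R) : a <= b ->
  \int[mu]_(x in `[a, b]) p.[x] = (primitive p).[b] - (primitive p).[a].
Proof. by move=> ab; rewrite -Rintegral_deriv_poly // deriv_primitive. Qed.

Lemma Rintegral_polyB p q (a b : R) : a <= b ->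
  \int[mu]_(x in `[a, b]) (p - q).[x] =
  \int[mu]_(x in `[a, b]) p.[x] - \int[mu]_(x in `[a, b]) q.[x].
Proof.
move=> ab; rewrite (_ : p - q = (primitive p - primitive q)^`()); last first.
  by rewrite derivB !deriv_primitive.
rewrite Rintegral_deriv_poly // !Rintegral_poly // !hornerE; ring.
Qed.

Lemma Rintegral_polyZ c p (a b : R) : a <= b ->
  \int[mu]_(x in `[a, b]) (c *: p).[x] = c * \int[mu]_(x in `[a, b]) p.[x].
Proof.
move=> ab; rewrite (_ : c *: p = (c *: primitive p)^`()); last first.
  by rewrite derivZ deriv_primitive.
rewrite Rintegral_deriv_poly // !Rintegral_poly // !hornerE; ring.
Qed.

(** The substitution x = 2 s - 1, between the interval of the Jacobi
    polynomial and the range of a barycentric coordinate. *)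
Lemma Rintegral_poly_comp p :
  \int[mu]_(x in `[0, 1]) (p \Po (2%:P * 'X - 1)).[x] =
  2^-1 * \int[mu]_(x in `[-1, 1]) p.[x].
Proof.
rewrite (_ : p \Po _ = (2^-1 *: (primitive p \Po (2%:P * 'X - 1)))^`()); last first.
  rewrite derivZ deriv_comp deriv_primitive derivB derivM !derivC derivX.
  by rewrite mul0r add0r mulr1 subr0 -mul_polyC mulrCA -polyCM mulVf ?mulr1 ?pnatr_eq0.
have le11 : (-1 : R) <= 1 by lra.
rewrite Rintegral_deriv_poly // Rintegral_poly // !hornerZ !horner_comp !hornerE.
rewrite -mulrBr; do 3 f_equal; lra.
Qed.

Lemma dvdp_exp_derivn (c : R) m n (V : {poly R}) :
  ('X - c%:P) ^+ (m + n) %| V -> ('X - c%:P) ^+ m %| V^`(n).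
Proof.
elim: n V => [|n IH] V; first by rewrite addn0 derivn0.
rewrite addnS derivSn => /dvdpP[r ->]; apply: IH.
rewrite derivM deriv_exp derivXsubC mul1r /=; apply: dvdp_add.
  by rewrite exprS mulrA dvdp_mull.
by rewrite -(mulr_natr (_ ^+ _)) dvdp_mull ?dvdp_mulr.
Qed.

Lemma horner_dvdp_exp (c : R) m (V : {poly R}) :
  (0 < m)%N -> ('X - c%:P) ^+ m %| V -> V.[c] = 0.
Proof.
case: m => // m _ /dvdpP[r ->]; rewrite hornerM horner_exp hornerXsubC subrr.
by rewrite expr0n mulr0.
Qed.

(** Iterated integration by parts: the boundary terms vanish because the end
    points are zeros of [S] of order at least [n]. *)
Lemma Rintegral_derivn_mul n (S q : {poly R}) :
  ('X - 1%:P) ^+ n %| S -> ('X - (-1)%:P) ^+ n %| S -> (size q <= n)%N ->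
  \int[mu]_(x in `[-1, 1]) (S^`(n) * q).[x] = 0.
Proof.
elim: n q => [|n IH] q dS1 dS2 sq.
  have -> : q = 0 by apply/eqP; rewrite -size_poly_leq0.
  rewrite mulr0; under eq_Rintegral do rewrite horner0.
  by rewrite Rintegral_cst // mul0r.
have le11 : (-1 : R) <= 1 by lra.
have -> : S^`(n.+1) * q = (S^`(n) * q)^`() - S^`(n) * q^`().
  by rewrite derivM -derivnS addrK.
rewrite Rintegral_polyB // Rintegral_deriv_poly // !hornerM.
rewrite (@horner_dvdp_exp 1 1) //; last exact: dvdp_exp_derivn.
rewrite (@horner_dvdp_exp (-1) 1) //; last exact: dvdp_exp_derivn.
rewrite IH ?mul0r ?subrr //.
- by apply: dvdp_trans dS1; rewrite dvdp_exp2l.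
- by apply: dvdp_trans dS2; rewrite dvdp_exp2l.
- have [->|q0] := eqVneq q 0; first by rewrite linear0 size_poly0.
  by rewrite -ltnS (leq_trans (lt_size_deriv q0)).
Qed.

Lemma size_derivn_char0 n p : size p^`(n) = (size p - n)%N.
Proof.
elim: n => [|n IH]; first by rewrite derivn0 subn0.
rewrite derivnS subnS -IH; move: (p^`(n)) => {IH}q.
have [->|q0] := eqVneq q 0; first by rewrite linear0 size_poly0.
apply/eqP; rewrite eqn_leq -ltnS prednK ?size_poly_gt0 // lt_size_deriv //=.
case sq : (size q) => [//|[//|m]] /=; rewrite ltnNge; apply/negP => sm.
have := nth_default 0 sm; rewrite coef_deriv => /eqP.
rewrite -mulr_natr mulf_eq0 pnatr_eq0 orbF => /eqP q_m.
by have := lead_coef_eq0 q; rewrite /lead_coef sq /= q_m eqxx (negbTE q0).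
Qed.

Lemma horner_derivn_exp (c : R) n (H : {poly R}) :
  (('X - c%:P) ^+ n * H)^`(n).[c] = n`!%:R * H.[c].
Proof.
elim: n H => [|n IH] H; first by rewrite derivn0 expr0 !mul1r.
rewrite derivSn derivM deriv_exp derivXsubC mul1r /=.
rewrite (_ : _ + _ = ('X - c%:P) ^+ n * (n.+1%:R *: H + ('X - c%:P) * H^`())).
  by rewrite IH !hornerE subrr mul0r addr0 factS natrM; ring.
by rewrite mulrDr mulrA -exprSr -scalerAr scaler_nat mulrnAl.
Qed.

Lemma pochhammer1 n : pochhammer (1 : R) n = n`!%:R.
Proof.
rewrite /pochhammer; elim: n => [|n IH]; first by rewrite big_ord0.
by rewrite big_ord_recr /= IH factS natrM -natr1; ring.
Qed.

(** Rodrigues' formula: up to scaling, P is the quotient by (1 + x)^3 of the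
    n-th derivative of (x - 1)^n (x + 1)^(n + 3). *)
Lemma jacobi03_exists n : exists P : {poly R}, is_jacobi 0 3 n P.
Proof.
pose S : {poly R} := ('X - 1%:P) ^+ n * ('X - (-1)%:P) ^+ (3 + n).
have dS1 : ('X - 1%:P) ^+ n %| S by rewrite dvdp_mulr.
have dS2 : ('X - (-1)%:P) ^+ (3 + n) %| S by rewrite dvdp_mull.
have /dvdpP[Q SQ] := dvdp_exp_derivn dS2.
have sizeS : size S = (n + (3 + n)).+1.
  rewrite size_mul ?expf_neq0 ?polyXsubC_eq0 // !size_exp_XsubC; lia.
have sizeQ : size Q = n.+1.
  have : size S^`(n) = (3 + n).+1 by rewrite size_derivn_char0 sizeS; lia.
  rewrite SQ size_Mmonic; last first.
  - by rewrite monic_exp // monicXsubC.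
  - apply/eqP => Q0; move: SQ; rewrite Q0 mul0r => /(congr1 (fun p : {poly R} => size p)).
    by rewrite size_derivn_char0 sizeS size_poly0; lia.
  by rewrite size_exp_XsubC addnS => -[]; rewrite addnC => /addnI.
have Q1 : Q.[1] = n`!%:R * 2 ^+ n.
  have := horner_derivn_exp 1 n (('X - (-1)%:P) ^+ (3 + n)).
  rewrite -/S SQ hornerM !horner_exp hornerXsubC opprK exprD => h.
  apply: (@mulIf _ ((1 + 1) ^+ 3)); last by rewrite h mulrCA mulrC.
  by rewrite expf_neq0 // (_ : 1 + 1 = 2%:R) // pnatr_eq0.
exists ((n`!%:R * 2 ^+ n)^-1 *: Q).
have c0 : n`!%:R * 2 ^+ n != 0 :> R.
  by rewrite mulf_neq0 // ?expf_neq0 // pnatr_eq0 -?lt0n ?fact_gt0.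
split.
- by rewrite size_scale // invr_eq0.
- move=> q sq.
  apply: (etrans _ (@Rintegral_derivn_mul n S ((n`!%:R * 2 ^+ n)^-1 *: q) dS1 _ _)).
  + apply: eq_Rintegral => x; rewrite inE/= in_itv/= => /andP[x1 x2].
    rewrite powRr0 mul1r powR_mulrn; last by lra.
    rewrite SQ hornerM hornerM !hornerZ horner_exp hornerXsubC opprK.
    by move: (n`!%:R * 2 ^+ n)^-1 Q.[x] q.[x] => c u w; ring.
  + by apply: dvdp_trans dS2; rewrite dvdp_exp2l // leq_addl.
  + by apply: leq_trans sq; rewrite size_scale_leq.
- by rewrite hornerZ Q1 mulVf // add0r pochhammer1 mulfV // pnatr_eq0 -lt0n fact_gt0.
Qed.

End poly_integral.

(** * A point evaluation *)

(** Reference tetrahedron with vertices 0, e1, e1 + e2 and e1 + e2 + e3. Its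
    slice at a fixed first coordinate s is a triangle of size s, and 1 - s is
    the barycentric coordinate at the vertex 0. *)
Definition kuhn (R : realType) : set (coords3 R) :=
  [set y | [/\ 0 <= y.2 :> R, y.2 <= y.1.2 :> R, y.1.2 <= y.1.1 :> R
             & y.1.1 <= 1 :> R]].
Arguments kuhn : clear implicits.

Lemma measurable_kuhn (R : realType) : measurable (kuhn R).
Proof.
have [[m1 m2] m3] := coords3_measurable (@measurable_id _ (coords3 R) setT).
have mle (f g : coords3 R -> R) : measurable_fun setT f -> measurable_fun setT g ->
    measurable [set y | f y <= g y].
  move=> mf mg; have := measurable_fun_ler mf mg => /(_ measurableT [set true]).
  by rewrite setTI; apply.
rewrite (_ : kuhn R = [set y | 0 <= y.2 :> R] `&` [set y | y.2 <= y.1.2 :> R] `&`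
  [set y | y.1.2 <= y.1.1 :> R] `&` [set y | y.1.1 <= 1 :> R]); last first.
  by apply/seteqP; split => y; [case | case=> -[[]]].
apply: measurableI; last by apply: mle => //; exact: measurable_cst.
apply: measurableI; last exact: mle.
apply: measurableI; last exact: mle.
by apply: mle => //; exact: measurable_cst.
Qed.

Lemma kuhn_box3 (R : realType) : kuhn R `<=` box3 1.
Proof.
move=> y [h1 h2 h3 h4]; apply/box3E; apply: ord3P; rewrite vec3E ler_norml.
- by apply/andP; split; lra.
- by apply/andP; split; lra.
- by apply/andP; split; lra.
Qed.

Section kuhn_integral.
Variable R : realType.
Local Notation mu := (@lebesgue_measure R).

Lemma integral_slice (k r : R) (m : nat) : 0 <= r ->
  (\int[mu]_z ((fun z => (k * z ^+ m)%:E) \_ `[0%R, r]) z =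
   (k / m.+1%:R * r ^+ m.+1)%:E)%E.
Proof.
move=> r0; rewrite -integral_mkcond.
transitivity (\int[mu]_(z in `[0%R, r]) (((k / m.+1%:R) *: 'X^(m.+1))^`().[z])%:E)%E.
  apply: eq_integral => z _; rewrite derivZ derivXn hornerZ hornerMn hornerXn.
  by rewrite -(mulr_natr (z ^+ m)) -mulrA [_^-1 * _]mulrC mulfK // pnatr_eq0.
by rewrite integral_deriv_poly // !hornerZ !hornerXn expr0n mulr0 subr0.
Qed.

(** Fubini: the third variable ranges from 0 to the second, and the second
    from 0 to the first. *)
Lemma Rintegral_kuhn (Q : {poly R}) (j l : nat) :
  \int[leb3 R]_(y in kuhn R) (Q.[y.1.1] * (y.1.2 ^+ j * y.2 ^+ l)) =
  (l.+1%:R * (j + l).+2%:R)^-1 * \int[mu]_(x in `[0, 1]) (Q * 'X^((j + l).+2)).[x].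
Proof.
pose f := fun y : coords3 R => (Q.[y.1.1] * (y.1.2 ^+ j * y.2 ^+ l))%:E.
have intf : (leb3 R).-integrable (kuhn R) f.
  have fp : poly_fun ((size Q).-1 + (j + l)) (fun x : 'rV[R]_3 =>
      Q.[x 0 0] * (x 0 1 ^+ j * x 0 2%:R ^+ l)).
    apply: poly_funM; first by apply: poly_fun_horner; [exact: leqSpred|exact: poly_fun_coord].
    by apply: poly_funM; rewrite -[X in poly_fun X]mul1n; apply: poly_funX; exact: poly_fun_coord.
  have := poly_fun_integrable fp (@measurable_kuhn R) (@kuhn_box3 R).
  by apply: eq_integrable; [exact: measurable_kuhn | move=> y _; rewrite !vec3E].
have intf' : (leb3 R).-integrable setT (f \_ (kuhn R)).
  by apply/integrable_restrict => //; [exact: measurable_kuhn | rewrite setTI].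
have F3 := @integral12_prod_meas1 _ _ _ _ R (leb2 R) mu _ intf'.
have I2 := @integrable_fubini_F _ _ _ _ R (leb2 R) mu _ intf'.
pose g := fun z : measurableTypeR R * measurableTypeR R =>
  ((Q.[z.1] / l.+1%:R) * z.2 ^+ (j + l).+1)%:E.
pose tri := [set z : measurableTypeR R * measurableTypeR R |
  [/\ 0 <= z.2 :> R, z.2 <= z.1 :> R & z.1 <= 1 :> R]].
have E2 : fubini_F mu (f \_ (kuhn R)) = g \_ tri.
  apply/funext => -[x y]; rewrite /fubini_F [RHS]patchE.
  have [/set_mem[/= y0 yx x1]|/negP ntri] := boolP ((x, y) \in tri).
    rewrite /g /= (_ : _ * _ = (Q.[x] * y ^+ j) / l.+1%:R * y ^+ l.+1); last first.
      by rewrite -addnS exprD; ring.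
    rewrite -integral_slice //; apply: eq_integral => z _; rewrite !patchE.
    rewrite (_ : (_ \in kuhn R) = (z \in `[0, y]%classic)).
      by case: ifP => // _; rewrite /f /= mulrA.
    apply/idP/idP; rewrite !inE /kuhn/= in_itv/=.
      by move=> [-> ->].
    by move=> /andP[].
  apply: integral0_eq => z _; rewrite patchE ifF //; apply/negP => /set_mem[/= h1 h2 h3 h4].
  by apply: ntri; apply/mem_set; split => //=; lra.
rewrite E2 in F3 I2.
have F2 := @integral12_prod_meas1 _ _ _ _ R mu mu _ I2.
have E1 : fubini_F mu (g \_ tri) =
    (fun x => ((l.+1%:R * (j + l).+2%:R)^-1 * (Q * 'X^((j + l).+2)).[x])%:E) \_ `[0, 1].
  apply/funext => x; rewrite /fubini_F [RHS]patchE.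
  have [|/negP nx] := boolP (x \in `[0, 1]%classic).
    rewrite inE/= in_itv/= => /andP[x0 x1].
    rewrite (_ : _ * _ = (Q.[x] / l.+1%:R) / (j + l).+2%:R * x ^+ (j + l).+2); last first.
      by rewrite hornerM hornerXn invfM; ring.
    rewrite -integral_slice //; apply: eq_integral => y _; rewrite !patchE.
    rewrite (_ : (_ \in tri) = (y \in `[0, x]%classic)); first by case: ifP.
    apply/idP/idP; rewrite !inE /tri/= in_itv/=.
      by move=> [-> ->].
    by move=> /andP[].
  apply: integral0_eq => y _; rewrite patchE ifF //; apply/negP => /set_mem[/= h1 h2 h3].
  by apply: nx; rewrite inE/= in_itv/=; apply/andP; split; lra.
rewrite E1 in F2.
have F : (\int[leb3 R]_(y in kuhn R) f y = \int[mu]_(x in `[0%R, 1%R])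
   ((l.+1%:R * (j + l).+2%:R)^-1 * (Q * 'X^((j + l).+2)).[x])%:E)%E.
  by rewrite integral_mkcond [RHS]integral_mkcond; apply: etrans (esym F3) (esym F2).
rewrite [LHS](congr1 fine F).
transitivity (\int[mu]_(x in `[0, 1]) ((l.+1%:R * (j + l).+2%:R)^-1 *: (Q * 'X^((j + l).+2))).[x]).
  by apply: eq_Rintegral => x _; rewrite hornerZ.
exact: Rintegral_polyZ.
Qed.

Section point_evaluation.
Variables (n : nat) (P : {poly R}).
Hypothesis P_jacobi : is_jacobi 0 3 n P.

(** With x = 2 s - 1 the power s^(d + 2) is, up to a factor, the weight (1 +
    x)^3 times the polynomial (1 + x)^(d - 1) of degree less than n. *)
Lemma jacobi03_orthogonal d : (0 < d <= n)%N ->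
  \int[mu]_(x in `[0, 1]) ((P \Po (2%:P * 'X - 1)) * 'X^(d.+2)).[x] = 0.
Proof.
move=> /andP[d0 dn]; have [_ orth _] := P_jacobi.
pose q : {poly R} := (2^-1 ^+ d.+2) *: (1 + 'X) ^+ d.-1.
rewrite (_ : _ * _ = (P * ((1 + 'X) ^+ 3 * q)) \Po (2%:P * 'X - 1)); last first.
  rewrite comp_polyM; congr (_ * _); rewrite /q -scalerAr -exprD comp_polyZ.
  rewrite (_ : (3 + d.-1)%N = d.+2); last by lia.
  rewrite rmorphXn rmorphD/= rmorph1 comp_polyX addrC subrK exprMn -rmorphXn/=.
  by rewrite mul_polyC scalerA -exprMn mulVf ?pnatr_eq0 // expr1n scale1r.
rewrite Rintegral_poly_comp -[RHS](mulr0 2^-1); congr (_ * _).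
rewrite -[RHS](orth q); last first.
  rewrite (leq_trans (size_scale_leq _ _)) // (leq_trans (size_poly_exp_leq _ _)) //.
  by rewrite addrC -[1]/(1%:P) size_XaddC; lia.
apply: eq_Rintegral => x; rewrite inE/= in_itv/= => /andP[x1 x2].
rewrite powRr0 mul1r powR_mulrn; last by lra.
rewrite hornerM hornerM horner_exp hornerD hornerX hornerC; ring.
Qed.

Lemma kuhn_jacobi_monomial i j l : (0 < i + j + l <= n)%N ->
  \int[leb3 R]_(y in kuhn R)
    (P.[2 * y.1.1 - 1] * (y.1.1 ^+ i * y.1.2 ^+ j * y.2 ^+ l)) = 0.
Proof.
move=> ijl.
have := Rintegral_kuhn ((P \Po (2%:P * 'X - 1)) * 'X^i) j l.
rewrite -mulrA -exprD (_ : (i + (j + l).+2)%N = (i + j + l).+2); last by lia.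
rewrite (jacobi03_orthogonal ijl) mulr0 => <-.
apply: eq_Rintegral => y _.
rewrite hornerM horner_comp hornerXn !hornerE; ring.
Qed.

End point_evaluation.
End kuhn_integral.

(** * Barycentric coordinates *)

Section barycentric.
Variable R : realType.
Implicit Types (K L S : {fset 'rV[R]_3}) (x y z : 'rV[R]_3).

Definition affine_fun (l : 'rV[R]_3 -> R) :=
  exists (n : 'rV[R]_3) (c : R), forall x, l x = \sum_(i < 3) n 0 i * x 0 i + c.

Lemma affine_fun_comb (l : 'rV[R]_3 -> R) (s : seq 'rV[R]_3) (w : 'rV[R]_3 -> R) :
  affine_fun l -> \sum_(z <- s) w z = 1 ->
  l (\sum_(z <- s) w z *: z) = \sum_(z <- s) w z * l z.
Proof.
move=> [n [c lE]] w1; rewrite lE.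
under [RHS]eq_bigr do rewrite lE mulrDr mulr_sumr.
rewrite big_split /= -mulr_suml w1 mul1r; congr (_ + c).
rewrite exchange_big /=; apply: eq_bigr => i _.
by rewrite summxE mulr_sumr; apply: eq_bigr => z _; rewrite mxE; ring.
Qed.

Lemma affine_fun_line (l : 'rV[R]_3 -> R) x d (t : R) : affine_fun l ->
  l (x + t *: d) = l x + t * (l (x + d) - l x).
Proof.
move=> [n [c lE]]; rewrite !lE.
rewrite !sum_ord3 !mxE; ring.
Qed.

Lemma sum_perm4 (V : nmodType) K p q a b (F : 'rV[R]_3 -> V) :
  perm_eq K [:: p; q; a; b] -> \sum_(z <- K) F z = F p + F q + F a + F b.
Proof.
by move=> K4; rewrite (perm_big _ K4) /= !big_cons big_nil addr0 !addrA.
Qed.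

Lemma simplex4_enum K p : simplex 4 K -> p \in K ->
  exists q a b, perm_eq K [:: p; q; a; b].
Proof.
move=> [cK _] pK; have := perm_to_rem pK.
have := size_rem pK; rewrite -[X in _ = X.-1]/(#|` K|) cK.
by case: (rem p K) => [//|q [//|a [//|b []]]] // _ h; exists q, a, b.
Qed.

Lemma simplex4_enum2 K p q : simplex 4 K -> p \in K -> q \in K -> p != q ->
  exists a b, perm_eq K [:: p; q; a; b].
Proof.
move=> sK pK qK pq; have [q' [a [b pqab]]] := simplex4_enum sK pK.
have : q \in [:: q'; a; b].
  have := perm_mem pqab q; rewrite qK !inE eq_sym (negbTE pq) /=.
  by move=> /esym.
move=> /perm_to_rem h; have := perm_size h.
case: (rem q _) h => [//|a' [//|b' []]] // h _.
exists a', b'; apply: perm_trans pqab _.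
by rewrite perm_cons.
Qed.

Section frame.
Variables (K : {fset 'rV[R]_3}) (p q a b : 'rV[R]_3).
Hypotheses (sK : simplex 4 K) (K4 : perm_eq K [:: p; q; a; b]).

Lemma frame_uniq : uniq [:: p; q; a; b].
Proof. by rewrite -(perm_uniq K4) fset_uniq. Qed.

Lemma frame_free (c0 c1 c2 c3 : R) :
  c0 + c1 + c2 + c3 = 0 -> c0 *: p + c1 *: q + c2 *: a + c3 *: b = 0 ->
  [/\ c0 = 0, c1 = 0, c2 = 0 & c3 = 0].
Proof.
move=> c1E cE; have [_ fK] := sK.
pose w z := if z == p then c0 else if z == q then c1 else if z == a then c2 else c3.
have := frame_uniq; rewrite /= !inE !negb_or.
move=> /and4P[/and3P[pq pa pb] /andP[qa qb] ab _].
have wE : [/\ w p = c0, w q = c1, w a = c2 & w b = c3].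
  have neq (u v : 'rV[R]_3) : u != v -> (v == u) = false.
    by rewrite eq_sym => /negbTE.
  by rewrite /w !eqxx !(neq _ _ pq, neq _ _ pa, neq _ _ pb, neq _ _ qa, neq _ _ qb, neq _ _ ab).
have [wp wq wa wb] := wE.
have h : forall z, z \in K -> w z = 0.
  by apply: fK; rewrite (sum_perm4 _ K4) wp wq wa wb.
by rewrite -wp -wq -wa -wb; split; apply: h; rewrite (perm_mem K4) !inE eqxx ?orbT.
Qed.

(** The rows are the steps of the path p, q, a, b, so that y |-> y M + p maps
    the path 0, e1, e1 + e2, e1 + e2 + e3 of [kuhn] to it. *)
Definition frame_mx : 'M[R]_3 :=
  \matrix_(i, j) [:: q 0 j - p 0 j; a 0 j - q 0 j; b 0 j - a 0 j]`_i.

Lemma mul_frame_mx (u : 'rV[R]_3) : u *m frame_mx =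
  u 0 0 *: (q - p) + u 0 1 *: (a - q) + u 0 2%:R *: (b - a).
Proof. by apply/rowP => j; rewrite !mxE sum_ord3 !mxE. Qed.

Lemma frame_mx_unit : frame_mx \in unitmx.
Proof.
rewrite -row_free_unit -kermx_eq0; apply/rowV0P => u /sub_kermxP.
rewrite mul_frame_mx => uM.
have [] := @frame_free (- u 0 0) (u 0 0 - u 0 1) (u 0 1 - u 0 2%:R) (u 0 2%:R).
- ring.
- by rewrite -uM !scalerBl !scalerBr scaleNr; apply/rowP => j; rewrite !mxE; ring.
- move=> h0 h1 h2 h3; apply/rowP; apply: ord3P; rewrite mxE; lra.
Qed.

Lemma frame_point (u : 'rV[R]_3) : u *m frame_mx + p =
  (1 - u 0 0) *: p + (u 0 0 - u 0 1) *: q + (u 0 1 - u 0 2%:R) *: a + u 0 2%:R *: b.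
Proof. by rewrite mul_frame_mx; apply/rowP => j; rewrite !mxE; ring. Qed.

Definition frame_coord x : 'rV[R]_3 := (x - p) *m invmx frame_mx.

Lemma frame_coordK x : frame_coord x *m frame_mx + p = x.
Proof. by rewrite mulmxKV ?frame_mx_unit // subrK. Qed.

Lemma frame_coord_point (u : 'rV[R]_3) : frame_coord (u *m frame_mx + p) = u.
Proof. by rewrite /frame_coord addrK mulmxK ?frame_mx_unit. Qed.

Lemma is_barycentric_frame : is_barycentric K p (fun x => 1 - frame_coord x 0 0).
Proof.
have E (c0 c1 c2 : R) x : x = (1 - c0) *: p + (c0 - c1) *: q + (c1 - c2) *: a + c2 *: b ->
    frame_coord x 0 0 = c0.
  pose u : 'rV[R]_3 := \row_i [:: c0; c1; c2]`_i.
  have -> : c0 = u 0 0 by rewrite mxE.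
  have -> : c1 = u 0 1 by rewrite mxE.
  have -> : c2 = u 0 2%:R by rewrite mxE.
  by rewrite -frame_point => ->; rewrite frame_coord_point.
split.
- exists (\row_i - invmx frame_mx i 0), (1 + (p *m invmx frame_mx) 0 0) => x.
  rewrite /frame_coord; move: (invmx _) => N.
  rewrite mulmxBl !mxE !sum_ord3 !mxE; ring.
- rewrite (E 0 0 0) ?subr0 //.
  by apply/rowP => j; rewrite !mxE; ring.
- move=> z; rewrite (perm_mem K4) !inE => /or4P[] /eqP ->; rewrite ?eqxx // => _.
  + by rewrite (E 1 0 0) ?subrr //; apply/rowP => j; rewrite !mxE; ring.
  + by rewrite (E 1 1 0) ?subrr //; apply/rowP => j; rewrite !mxE; ring.
  + by rewrite (E 1 1 1) ?subrr //; apply/rowP => j; rewrite !mxE; ring.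
Qed.

End frame.

Lemma affine_combination K x : simplex 4 K -> exists w : 'rV[R]_3 -> R,
  \sum_(z <- K) w z = 1 /\ \sum_(z <- K) w z *: z = x.
Proof.
move=> sK; have [cK _] := sK.
have [p pK] : exists p, p \in K by apply/fset0Pn; rewrite -cardfs_gt0 cK.
have [q [a [b K4]]] := simplex4_enum sK pK.
pose u := frame_coord p q a b x.
pose w z := if z == p then 1 - u 0 0 else if z == q then u 0 0 - u 0 1
  else if z == a then u 0 1 - u 0 2%:R else u 0 2%:R.
have := frame_uniq K4; rewrite /= !inE !negb_or.
move=> /and4P[/and3P[pq pa pb] /andP[qa qb] ab _].
have [wp wq wa wb] : [/\ w p = 1 - u 0 0, w q = u 0 0 - u 0 1,
    w a = u 0 1 - u 0 2%:R & w b = u 0 2%:R].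
  have neq (y z : 'rV[R]_3) : y != z -> (z == y) = false.
    by rewrite eq_sym => /negbTE.
  by rewrite /w !eqxx !(neq _ _ pq, neq _ _ pa, neq _ _ pb, neq _ _ qa, neq _ _ qb, neq _ _ ab).
exists w; rewrite !(sum_perm4 _ K4) wp wq wa wb; split; first by ring.
by rewrite -frame_point; exact: (frame_coordK sK K4).
Qed.

Lemma barycentricP K z : simplex 4 K -> z \in K ->
  is_barycentric K z (barycentric K z).
Proof.
move=> sK zK; have [q [a [b K4]]] := simplex4_enum sK zK.
by apply: xgetPex; eexists; exact: is_barycentric_frame K4.
Qed.

Lemma barycentric_affine K z : simplex 4 K -> z \in K -> affine_fun (barycentric K z).
Proof. by move=> sK /(barycentricP sK)[]. Qed.

Lemma barycentric_unique K x (w : 'rV[R]_3 -> R) z : simplex 4 K ->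
  \sum_(z <- K) w z = 1 -> \sum_(z <- K) w z *: z = x -> z \in K ->
  barycentric K z x = w z.
Proof.
move=> sK w1 <- zK; have [lA lz l0] := barycentricP sK zK.
rewrite affine_fun_comb // (big_fsetD1 z) //= lz mulr1 big1_fset ?addr0 //.
by move=> y; rewrite !inE => /andP[yz yK] _; rewrite l0 ?mulr0.
Qed.

Lemma barycentric_sum1 K x : simplex 4 K -> \sum_(z <- K) barycentric K z x = 1.
Proof.
move=> sK; have [w [w1 wx]] := affine_combination x sK.
rewrite -[RHS]w1; apply: eq_big_seq => z zK; exact: barycentric_unique.
Qed.

Lemma barycentric_sum K x : simplex 4 K -> \sum_(z <- K) barycentric K z x *: z = x.
Proof.
move=> sK; have [w [w1 wx]] := affine_combination x sK.
rewrite -[RHS]wx; apply: eq_big_seq => z zK; congr (_ *: _); exact: barycentric_unique.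
Qed.

Lemma hull_barycentric K x : simplex 4 K ->
  hull K x <-> forall z, z \in K -> 0 <= barycentric K z x.
Proof.
move=> sK; split.
  move=> [w [w0 w1 wx]] z zK; rewrite (barycentric_unique sK w1 _ zK) //; exact: w0.
move=> h; exists (fun z => barycentric K z x).
by rewrite barycentric_sum1 ?barycentric_sum.
Qed.

Lemma sum_fsub (V : nmodType) S K (F : 'rV[R]_3 -> V) : (S `<=` K)%fset ->
  \sum_(z <- K) (if z \in S then F z else 0) = \sum_(z <- S) F z.
Proof.
move=> SK; rewrite -big_mkcond /= -big_filter.
apply: perm_big; apply: uniq_perm; rewrite ?filter_uniq ?fset_uniq // => z.
by rewrite mem_filter andb_idr // => /(fsubsetP SK).
Qed.

Lemma hull_fsub S K x : (S `<=` K)%fset -> hull S x -> hull K x.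
Proof.
move=> SK [w [w0 w1 wx]]; exists (fun z => if z \in S then w z else 0); split.
- by move=> z _; case: ifP => // zS; exact: w0.
- by rewrite sum_fsub.
- rewrite wx -(sum_fsub _ SK); apply: eq_bigr => z _.
  by case: ifP; rewrite ?scale0r.
Qed.

(** Weights on the face, extended by zero, are barycentric coordinates. *)
Lemma hull_face S K x z : simplex 4 K -> (S `<=` K)%fset -> hull S x ->
  z \in K -> barycentric K z x != 0 -> z \in S.
Proof.
move=> sK SK [w [w0 w1 wx]] zK; apply: contraNT => zS.
rewrite (@barycentric_unique _ _ (fun z => if z \in S then w z else 0)) ?(negbTE zS) //.
  by rewrite sum_fsub.
rewrite wx -(sum_fsub _ SK); apply: eq_bigr => y _.
by case: ifP; rewrite ?scale0r.
Qed.

Lemma hull_vertex S z : z \in S -> hull S z.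
Proof.
move=> zS; exists (fun y => (y == z)%:R); split.
- by move=> y _; rewrite ler0n.
- rewrite (big_fsetD1 z) //= eqxx big1_fset ?addr0 //.
  by move=> y; rewrite !inE => /andP[/negbTE ->].
- rewrite (big_fsetD1 z) //= eqxx scale1r big1_fset ?addr0 //.
  by move=> y; rewrite !inE => /andP[/negbTE ->]; rewrite scale0r.
Qed.

End barycentric.

Section tetrahedron.
Variable R : realType.
Implicit Types (K L S : {fset 'rV[R]_3}) (x z : 'rV[R]_3).

Lemma affine_fun4 (l : 'rV[R]_3 -> R) (p q a b : 'rV[R]_3) (c0 c1 c2 c3 : R) :
  affine_fun l -> c0 + c1 + c2 + c3 = 1 ->
  l (c0 *: p + c1 *: q + c2 *: a + c3 *: b) = c0 * l p + c1 * l q + c2 * l a + c3 * l b.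
Proof.
move=> [n [c lE]] /eqP; rewrite -subr_eq0 => /eqP h; rewrite !lE !sum_ord3 !mxE.
apply/eqP; rewrite -subr_eq0 -[X in _ == X](mulr0 (- c)) -h; apply/eqP; ring.
Qed.

Lemma barycentric_frame K p q a b (u : 'rV[R]_3) :
  simplex 4 K -> perm_eq K [:: p; q; a; b] ->
  let x := u *m frame_mx p q a b + p in
  [/\ barycentric K p x = 1 - u 0 0, barycentric K q x = u 0 0 - u 0 1,
      barycentric K a x = u 0 1 - u 0 2%:R & barycentric K b x = u 0 2%:R].
Proof.
move=> sK K4 x.
have := frame_uniq K4; rewrite /= !inE !negb_or.
move=> /and4P[/and3P[pq pa pb] /andP[qa qb] ab _].
have neq (y z : 'rV[R]_3) : y != z -> z != y by rewrite eq_sym.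
have inK z : (z \in K) = (z \in [:: p; q; a; b]) by exact: perm_mem.
have E z : z \in K -> barycentric K z x =
    (1 - u 0 0) * barycentric K z p + (u 0 0 - u 0 1) * barycentric K z q +
    (u 0 1 - u 0 2%:R) * barycentric K z a + u 0 2%:R * barycentric K z b.
  move=> zK; rewrite /x frame_point affine_fun4 //; first exact: barycentric_affine.
  ring.
clearbody x.
have dl y z : y \in K -> z \in K -> y != z -> barycentric K z y = 0.
  by move=> yK zK; have [_ _] := barycentricP sK zK; exact.
have d1 z : z \in K -> barycentric K z z = 1.
  by move=> zK; have [] := barycentricP sK zK.
have pK : p \in K by rewrite inK !inE eqxx.
have qK : q \in K by rewrite inK !inE eqxx orbT.
have aK : a \in K by rewrite inK !inE eqxx !orbT.
have bK : b \in K by rewrite inK !inE eqxx !orbT.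
move: E dl d1; move: (barycentric K) => l E dl d1; split.
- rewrite (E p pK) (d1 p pK) (dl q p qK pK (neq _ _ pq)) (dl a p aK pK (neq _ _ pa)).
  rewrite (dl b p bK pK (neq _ _ pb)); ring.
- rewrite (E q qK) (d1 q qK) (dl p q pK qK pq) (dl a q aK qK (neq _ _ qa)).
  rewrite (dl b q bK qK (neq _ _ qb)); ring.
- rewrite (E a aK) (d1 a aK) (dl p a pK aK pa) (dl q a qK aK qa).
  rewrite (dl b a bK aK (neq _ _ ab)); ring.
- rewrite (E b bK) (d1 b bK) (dl p b pK bK pb) (dl q b qK bK qb).
  rewrite (dl a b aK bK ab); ring.
Qed.

Lemma hull_frame K p q a b : simplex 4 K -> perm_eq K [:: p; q; a; b] ->
  affine3 (frame_mx p q a b) p @^-1` (@vec3 R @^-1` hull K) = kuhn R.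
Proof.
move=> sK K4; apply/seteqP; split => y /=; rewrite unvec3K.
  move=> /(hull_barycentric _ sK) h.
  have [e0 e1 e2 e3] := barycentric_frame (vec3 y) sK K4.
  move: e0 e1 e2 e3; rewrite !vec3E => e0 e1 e2 e3.
  have inK z : (z \in K) = (z \in [:: p; q; a; b]) by exact: perm_mem.
  have := h p; rewrite inK mem_head e0 => /(_ isT) h0.
  have := h q; rewrite inK !inE eqxx orbT e1 => /(_ isT) h1.
  have := h a; rewrite inK !inE eqxx !orbT e2 => /(_ isT) h2.
  have := h b; rewrite inK !inE eqxx !orbT e3 => /(_ isT) h3.
  by split; lra.
move=> [h0 h1 h2 h3]; apply/hull_barycentric => // z.
have [e0 e1 e2 e3] := barycentric_frame (vec3 y) sK K4.
move: e0 e1 e2 e3; rewrite !vec3E => e0 e1 e2 e3.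
by rewrite (perm_mem K4) !inE => /or4P[] /eqP ->; rewrite ?e0 ?e1 ?e2 ?e3; lra.
Qed.

Lemma barycentric_poly K z : simplex 4 K -> z \in K -> poly_fun 1 (barycentric K z).
Proof.
move=> sK zK; have [n [c lE]] := barycentric_affine sK zK.
by rewrite (funext lE); exact: poly_fun_affine.
Qed.

Lemma measurable_barycentric K z : simplex 4 K -> z \in K ->
  measurable_fun setT (fun y : coords3 R => barycentric K z (vec3 y)).
Proof. by move=> sK zK; exact: poly_fun_measurable (barycentric_poly sK zK). Qed.

Lemma measurable_hull K : simplex 4 K -> measurable (@vec3 R @^-1` hull K).
Proof.
move=> sK; rewrite (_ : _ @^-1` _ =
  \big[setI/setT]_(z <- K) [set y | (z \in K) ==> (0 <= barycentric K z (vec3 y))]).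
  apply: bigsetI_measurable => z _; have [zK|zK] := boolP (z \in K); last first.
    by rewrite [X in measurable X](_ : _ = setT) //; apply/seteqP; split.
  have := measurable_fun_ler (measurable_cst (0 : R)) (measurable_barycentric sK zK).
  by move=> /(_ measurableT [set true]); rewrite setTI; apply.
rewrite -bigcap_seq; apply/seteqP; split => y /=.
  by move=> /(hull_barycentric _ sK) h z /= zK; rewrite zK h.
move=> h; apply/hull_barycentric => // z zK.
by have := h z zK; rewrite /= zK.
Qed.

Lemma hull_box3 S : exists r : R, (@vec3 R @^-1` hull S) `<=` box3 r.
Proof.
exists (\sum_(z <- S) \sum_i `|z 0 i|) => y /= [w [w0 w1 yE]].
apply/box3E => i; rewrite yE summxE (le_trans (ler_norm_sum _ _ _)) //.
rewrite !big_seq; apply: ler_sum => z zS; rewrite mxE normrM.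
have wz1 : `|w z| <= 1.
  rewrite ger0_norm ?w0 // -w1 (big_fsetD1 z) //= lerDl big_seq sumr_ge0 //.
  by move=> t; rewrite !inE => /andP[_ tS]; rewrite w0.
apply: (@le_trans _ _ (`|z 0 i|)); first by rewrite ler_piMl.
by rewrite (bigD1 i) //= lerDl sumr_ge0.
Qed.

Lemma mdeg3 (m : multinom 3) : mdeg m = (m 0%R + m 1%R + m 2%:R%R)%N.
Proof.
rewrite mdegE !big_ord_recl big_ord0 addn0 addnA.
by congr (m _ + m _ + m _)%N; apply: val_inj.
Qed.

Definition kuhn_weight (P : {poly R}) : R :=
  \int[leb3 R]_(y in kuhn R) P.[2 * y.1.1 - 1].

(** Expanding [g] in monomials about the vertex at the origin, every
    non-constant monomial is killed by orthogonality. *)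
Lemma kuhn_point_evaluation n (P : {poly R}) (g : 'rV[R]_3 -> R) :
  is_jacobi 0 3 n P -> poly_fun n g ->
  \int[leb3 R]_(y in kuhn R) (P.[2 * y.1.1 - 1] * g (vec3 y)) =
  kuhn_weight P * g 0.
Proof.
move=> PJ /poly_funP[q sq ->].
pose F (m : multinom 3) (y : coords3 R) : R :=
  y.1.1 ^+ m 0 * y.1.2 ^+ m 1 * y.2 ^+ m 2%:R.
have F_poly (m : multinom 3) : poly_fun (mdeg m) (fun x : 'rV[R]_3 =>
    x 0 0 ^+ m 0 * x 0 1 ^+ m 1 * x 0 2%:R ^+ m 2%:R).
  rewrite mdeg3.
  do 2?apply: poly_funM; rewrite -[X in poly_fun X]mul1n;
    by apply: poly_funX; exact: poly_fun_coord.
have P_poly : poly_fun (size P).-1 (fun x : 'rV[R]_3 => P.[2 * x 0 0 - 1]).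
  apply: poly_fun_horner; first exact: leqSpred.
  apply: poly_funD; last exact: poly_fun_cst.
  by apply: poly_funZ; exact: poly_fun_coord.
have int_of d (h : 'rV[R]_3 -> R) (h' : coords3 R -> R) : poly_fun d h ->
    (forall y, h' y = h (vec3 y)) ->
    (leb3 R).-integrable (kuhn R) (fun y => (P.[2 * y.1.1 - 1] * h' y)%:E).
  move=> hd h'E.
  have := poly_fun_integrable (poly_funM P_poly hd) (@measurable_kuhn R) (@kuhn_box3 R).
  by apply: eq_integrable; [exact: measurable_kuhn | move=> y _; rewrite h'E !vec3E].
have FE (m : multinom 3) (y : coords3 R) :
    F m y = vec3 y 0 0 ^+ m 0 * vec3 y 0 1 ^+ m 1 * vec3 y 0 2%:R ^+ m 2%:R.
  by rewrite !vec3E.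
have mevF (x : 'rV[R]_3) : mev q x = \sum_(m <- msupp q)
    mcoeff m q * (x 0 0 ^+ m 0 * x 0 1 ^+ m 1 * x 0 2%:R ^+ m 2%:R).
  by rewrite mevE; apply: eq_bigr => m _; rewrite prod_ord3.
have mon (m : multinom 3) : (mdeg m <= n)%N ->
    \int[leb3 R]_(y in kuhn R) (P.[2 * y.1.1 - 1] * F m y) =
    kuhn_weight P * ((0 : 'rV[R]_3) 0 0 ^+ m 0 * (0 : 'rV[R]_3) 0 1 ^+ m 1 *
      (0 : 'rV[R]_3) 0 2%:R ^+ m 2%:R).
  rewrite mdeg3 => mn; rewrite !mxE -!exprD expr0n.
  have [m0|m0] := posnP (m 0%R + m 1%R + m 2%:R%R)%N; last first.
    by rewrite (kuhn_jacobi_monomial PJ) ?m0 // mulr0.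
  rewrite mulr1; apply: eq_Rintegral => y _.
  rewrite /F; have [-> -> ->] : [/\ m 0%R = 0%N, m 1%R = 0%N & m 2%:R = 0%N] by split; lia.
  by rewrite !expr0 !mulr1.
have lin (r : seq (multinom 3)) : (forall m, m \in r -> (mdeg m <= n)%N) ->
    \int[leb3 R]_(y in kuhn R) (P.[2 * y.1.1 - 1] * \sum_(m <- r) mcoeff m q * F m y) =
    kuhn_weight P * \sum_(m <- r) mcoeff m q *
    ((0 : 'rV[R]_3) 0 0 ^+ m 0 * (0 : 'rV[R]_3) 0 1 ^+ m 1 * (0 : 'rV[R]_3) 0 2%:R ^+ m 2%:R).
  elim: r => [|m r IH] rn.
    rewrite big_nil mulr0 -[RHS](mul0r (fine (leb3 R (kuhn R)))).
    rewrite -Rintegral_cst; last exact: measurable_kuhn.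
    by apply: eq_Rintegral => y _; rewrite big_nil mulr0.
  rewrite big_cons mulrDr -IH; last by move=> i ir; apply: rn; rewrite inE ir orbT.
  rewrite [kuhn_weight P * (_ * _)]mulrCA -mon ?rn ?mem_head //.
  rewrite -RintegralZl //; last first.
  - exact: int_of (F_poly m) (FE m).
  - exact: measurable_kuhn.
  rewrite -RintegralD //.
  - by apply: eq_Rintegral => y _; rewrite big_cons; ring.
  - exact: measurable_kuhn.
  - have := @int_of _ _ (fun y => mcoeff m q * F m y) (poly_funZ (mcoeff m q) (F_poly m))
      (fun y => congr1 (fun t => mcoeff m q * t) (FE m y)).
    apply: eq_integrable; first exact: measurable_kuhn.
    by move=> y _; rewrite /= mulrCA.
  - apply: (@int_of n (fun x => \sum_(i <- r) mcoeff i q *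
      (x 0 0 ^+ i 0 * x 0 1 ^+ i 1 * x 0 2%:R ^+ i 2%:R))).
      apply: poly_fun_sum => i ir; apply: poly_funZ; apply: poly_fun_le (F_poly i).
      by apply: rn; rewrite inE ir orbT.
    by move=> y; apply: eq_bigr => i _; rewrite FE.
rewrite mevF -lin; last by move=> m /msize_mdeg_lt h; rewrite -ltnS (leq_trans h).
by apply: eq_Rintegral => y _; rewrite mevF; congr (_ * _); apply: eq_bigr => m _; rewrite FE.
Qed.

End tetrahedron.

Lemma leb3_kuhn (R : realType) : leb3 R (kuhn R) = (6^-1)%:E.
Proof.
have fk : leb3 R (kuhn R) \is a fin_num.
  by rewrite ge0_fin_numE //; exact: leb3_bounded (@measurable_kuhn R) (@kuhn_box3 R).
rewrite -(fineK fk); congr EFin.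
have := Rintegral_kuhn (1 : {poly R}) 0 0.
under eq_Rintegral do rewrite hornerC !expr0 !mulr1.
rewrite Rintegral_cst ?mul1r; last exact: measurable_kuhn.
move=> ->; rewrite (_ : 'X^2 = (3^-1 *: 'X^3 : {poly R})^`()); last first.
  by rewrite derivZ derivXn -scalerMnr scalerMnl -(mulr_natr 3^-1) mulVf ?scale1r // pnatr_eq0.
rewrite Rintegral_deriv_poly // !hornerZ !hornerXn expr1n expr0n /= mulr0 subr0 mulr1 -invfM.
by congr (_^-1); ring.
Qed.

Section tetrahedron_integral.
Variable R : realType.
Variables (K : {fset 'rV[R]_3}) (p : 'rV[R]_3).
Hypotheses (sK : simplex 4 K) (pK : p \in K).

(** Here phi is the affine map from [kuhn] onto the tetrahedron that sends the
    vertex 0 to p, and c^-1 is its factor on volumes. *)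
Lemma tetrahedron_scaling : exists2 c : R, 0 < c &
  vol (hull K) = c^-1 / 6 /\
  exists2 phi : 'rV[R]_3 -> 'rV[R]_3, [/\ phi 0 = p,
      forall i, poly_fun 1 (fun x => phi x 0 i) &
      forall x, barycentric K p (phi x) = 1 - x 0 0] &
    forall (d : nat) (f : 'rV[R]_3 -> R), poly_fun d f ->
      int3 (hull K) f = c^-1 * \int[leb3 R]_(y in kuhn R) f (phi (vec3 y)).
Proof.
have [q [a [b K4]]] := simplex4_enum sK pK.
pose M := frame_mx p q a b.
have [c c0 cE] := leb3_affine p (frame_mx_unit sK K4).
have mH := measurable_hull sK; have [r Hr] := hull_box3 K.
exists c => //; split.
  have := cE _ mH; rewrite hull_frame // leb3_kuhn /vol.
  have fH : leb3 R (@vec3 R @^-1` hull K) \is a fin_num.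
    by rewrite ge0_fin_numE //; exact: leb3_bounded mH Hr.
  rewrite -(fineK fH) -EFinM => -[->]; rewrite mulrA mulVf ?mul1r ?gt_eqF //.
exists (fun x => x *m M + p).
  split; first by rewrite mul0mx add0r.
  - move=> i; rewrite (_ : (fun x => _) = (fun x : 'rV[R]_3 =>
       \sum_(j < 3) (\row_j M j i) 0 j * x 0 j + p 0 i)); first exact: poly_fun_affine.
    by apply/funext => x; rewrite !mxE; congr (_ + _); apply: eq_bigr => j _;
      rewrite mxE mulrC.
  - by move=> x; have [] := barycentric_frame x sK K4.
move=> d f fd; apply: (@mulfI _ c); first by rewrite gt_eqF.
rewrite mulVKf ?gt_eqF // /int3.
rewrite -(Rintegral_affine3 cE c0 mH (poly_fun_measurable fd) (poly_fun_integrable fd mH Hr)).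
rewrite hull_frame //; apply: eq_Rintegral => y _.
by rewrite /affine3 unvec3K.
Qed.

Lemma vol_hull_gt0 : 0 < vol (hull K).
Proof.
have [c c0 [-> _]] := tetrahedron_scaling.
by rewrite divr_gt0 ?invr_gt0.
Qed.

(** Transport of [kuhn_point_evaluation] by an affine map, which preserves
    degrees and sends the vertex 0 to p. *)
Lemma tetrahedron_point_evaluation n (P : {poly R}) (g : 'rV[R]_3 -> R) :
  is_jacobi 0 3 n P -> poly_fun n g ->
  int3 (hull K) (fun x => P.[1 - 2 * barycentric K p x] * g x) =
  vol (hull K) * (6 * kuhn_weight P * g p).
Proof.
move=> PJ gn; have [c c0 [-> [phi [phi0 phi1 phip] intE]]] := tetrahedron_scaling.
have f_poly : poly_fun ((size P).-1 + n) (fun x => P.[1 - 2 * barycentric K p x] * g x).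
  apply: poly_funM gn; apply: poly_fun_horner; first exact: leqSpred.
  apply: poly_funD; first exact: poly_fun_cst.
  under eq_fun do rewrite -mulNr; apply: poly_funZ; exact: barycentric_poly.
rewrite (intE _ _ f_poly) -phi0 -(mulrA c^-1); congr (_ * _).
have := kuhn_point_evaluation PJ (poly_fun_comp phi1 gn).
rewrite (_ : 6^-1 * _ = kuhn_weight P * g (phi 0)); last by field.
move=> <-; apply: eq_Rintegral => y _ /=; rewrite phi0 phip vec3E; congr (P.[_] * _); ring.
Qed.

End tetrahedron_integral.

(** * Derivatives of polynomial functions *)

Section derivative.
Variable R : realType.
Implicit Types (q : mpoly 3 R) (x v : 'rV[R]_3).

Lemma mpoly_alg_ind (Q : mpoly 3 R -> Prop) :
  (forall c, Q (mpolyC 3 c)) -> (forall i, Q (mpolyX R (mnm1 i))) ->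
  (forall p q, Q p -> Q q -> Q (p + q)) ->
  (forall p q, Q p -> Q q -> Q (p * q)) -> forall q, Q q.
Proof.
move=> QC QX QD QM q.
have Q1 : Q 1 by rewrite -mpolyC1; exact: QC.
rewrite (mpolyE q).
apply: (big_ind Q) => [|a b|m _]; [by rewrite -mpolyC0; exact: QC | exact: QD |].
rewrite -mul_mpolyC; apply: (QM) => //; rewrite mpolyXE_id.
apply: (big_ind Q) => [//|a b|i _]; first exact: QM.
elim: (m i) => [|n IH]; first by rewrite expr0.
by rewrite exprS; exact: QM.
Qed.

(** Reduces derivatives on R^3, and identities that hold on a segment, to
    univariate polynomials. *)
Lemma mev_line q x v : exists U : {poly R},
  (forall t, U.[t] = mev q (t *: v + x)) /\
  U^`().[0] = \sum_i v 0 i * mev (mderiv i q) x.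
Proof.
elim/mpoly_alg_ind: q => [c|i|p q [U [UE U0]] [W [WE W0]]|p q [U [UE U0]] [W [WE W0]]].
- exists c%:P; split; first by move=> t; rewrite hornerC mevC.
  rewrite derivC horner0 big1 // => i _.
  by rewrite mderivC -mpolyC0 mevC mulr0.
- exists ((v 0 i)%:P * 'X + (x 0 i)%:P); split.
    by move=> t; rewrite !hornerE mevX !mxE mulrC.
  rewrite derivD derivC addr0 derivM derivC mul0r add0r derivX mulr1 hornerC.
  rewrite (bigD1 i) //= mderivX big1 => [|j ji]; last first.
    by rewrite mderivX mnm1E eq_sym (negbTE ji) mevZ mul0r mulr0.
  rewrite mnm1E eqxx scale1r /mev mevalX big1 ?mulr1 ?addr0 // => j _.
  by rewrite mnmBE subnn expr0.
- exists (U + W); split; first by move=> t; rewrite hornerD mevD UE WE.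
  rewrite derivD hornerD U0 W0 -big_split; apply: eq_bigr => i _ /=.
  by rewrite mderivD mevD mulrDr.
- exists (U * W); split; first by move=> t; rewrite hornerM mevM UE WE.
  rewrite derivM hornerD !hornerM U0 W0 !UE !WE scale0r add0r.
  rewrite mulr_suml mulr_sumr -big_split; apply: eq_bigr => i _ /=.
  by rewrite mderivM mevD !mevM; ring.
Qed.

Lemma derive_mev q x v : 'D_v (mev q) x = \sum_i v 0 i * mev (mderiv i q) x.
Proof.
have [U [UE <-]] := mev_line q x v.
rewrite derivE derive1E /derive.
rewrite (_ : (fun h : R => h^-1 *: ((mev q \o shift x) (h *: v) - mev q x)) =
  (fun h => h^-1 *: ((horner U \o shift 0) (h *: (1 : R)) - U.[0]))) //.
by apply/funext => h /=; rewrite !UE scale0r add0r addr0 [h *: 1]mulr1.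
Qed.

Lemma partial_mev i q : partial i (mev q) = mev (mderiv i q).
Proof.
apply/funext => x; rewrite /partial derive_mev (bigD1 i) //= mxE !eqxx mul1r.
by rewrite big1 ?addr0 // => j ji; rewrite mxE (negbTE ji) andbF mul0r.
Qed.

Lemma poly_fun_partial d i (g : 'rV[R]_3 -> R) :
  poly_fun d g -> poly_fun d.-1 (partial i g).
Proof.
move=> /poly_funP[q sq ->]; rewrite partial_mev.
rewrite (_ : mev _ = fun x => \sum_(m <- msupp q)
  mev (((m i)%:R * mcoeff m q) *: mpolyX R (mnm_sub m (mnm1 i))) x); last first.
  by apply/funext => x; rewrite /mderiv mev_sum.
apply: poly_fun_sum => m mq; under eq_fun do rewrite mevZ.
have [m0|m0] := posnP (m i).
  by under eq_fun do rewrite m0 mul0r mul0r; exact: poly_fun_cst.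
apply: poly_funZ; eexists; split; last by move=> x; reflexivity.
rewrite msizeX.
have := mdegD (mnm_sub m (mnm1 i)) (mnm1 i).
rewrite submK ?lep1mP -?lt0n // mdeg1 => e.
by have := msize_mdeg_lt mq; rewrite e; move: sq; move: (msize q) (mdeg _) => s1 s2; lia.
Qed.

(** The polynomial t |-> g (x + t v) has infinitely many roots. *)
Lemma partial_eq0_line d (g : 'rV[R]_3 -> R) x v (e : R) :
  poly_fun d g -> 0 < e -> (forall t, 0 < t < e -> g (x + t *: v) = 0) ->
  \sum_i v 0 i * partial i g x = 0.
Proof.
move=> /poly_funP[q sq ->] e0 g0; have [U [UE UD]] := mev_line q x v.
under eq_bigr do rewrite partial_mev.
rewrite -UD (_ : U = 0) ?deriv0 ?horner0 //.
pose rs := [seq e / n.+2%:R | n <- iota 0 (size U)].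
apply: (@roots_geq_poly_eq0 _ U rs).
- apply/allP => _ /mapP[n _ ->]; rewrite /root UE addrC g0 //.
  rewrite divr_gt0 ?ltr0n //= ltr_pdivrMr ?ltr0n // ltr_pMr // ltr1n //.
- rewrite map_inj_uniq ?iota_uniq // => n m /(mulfI (lt0r_neq0 e0))/invr_inj/eqP.
  by rewrite eqr_nat => /eqP[].
- by rewrite size_map size_iota.
Qed.

End derivative.

(** * Null sets *)

Section null_sets.
Variable R : realType.

Lemma measurable_level (n : 'rV[R]_3) (c : R) :
  measurable [set y : coords3 R | \sum_(i < 3) n 0 i * vec3 y 0 i = c].
Proof.
have mf : measurable_fun setT (fun y : coords3 R => \sum_(i < 3) n 0 i * vec3 y 0 i).
  apply: measurable_sum => i; apply: measurable_funM; first exact: measurable_cst.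
  exact: measurable_vec3.
have := mf measurableT [set c] (measurable_set1 c).
by rewrite setTI.
Qed.

(** After a permutation of the coordinates the plane meets each line in the
    third direction in one point. *)
Lemma leb3_level (n : 'rV[R]_3) (c : R) : n != 0 ->
  leb3 R [set y | \sum_(i < 3) n 0 i * vec3 y 0 i = c] = 0%E.
Proof.
have main (m : 'rV[R]_3) : m 0 2%:R != 0 ->
    leb3 R [set y | \sum_(i < 3) m 0 i * vec3 y 0 i = c] = 0%E.
  move=> m2; apply: integral0_eq => -[x y] _ /=.
  rewrite (_ : xsection _ _ = [set (c - m 0 0 * x - m 0 1 * y) / m 0 2%:R]).
    exact: lebesgue_measure_set1.
  apply/seteqP; split => z; rewrite /xsection/= inE/= sum_ord3 !vec3E/=.
    by move=> <-; field.
  by move=> ->; field.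
move=> n0; have [i ni] : exists i, n 0 i != 0.
  by move/rV0Pn : n0.
have uM : @tperm_mx R 3 i 2%:R \in unitmx by rewrite unitmx_perm.
have [k k0 kE] := leb3_affine 0 uM.
apply: (@muleI_EFin _ k); rewrite ?gt_eqF // -kE; last exact: measurable_level.
rewrite mule0 -(main (xcol i 2%:R n)); last by rewrite mxE tpermR.
congr (leb3 R _); apply/seteqP; split => y /=.
  move=> <-; rewrite /affine3 unvec3K addr0 -xcolE.
  rewrite [RHS](reindex_inj (@perm_inj _ (tperm i 2%:R))) /=.
  by apply: eq_bigr => j _; rewrite !mxE tpermK.
move=> <-; rewrite /affine3 unvec3K addr0 -xcolE.
rewrite [LHS](reindex_inj (@perm_inj _ (tperm i 2%:R))) /=.
by apply: eq_bigr => j _; rewrite !mxE tpermK.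
Qed.

(** Null for the completed measure, which is the notion behind [ae3]. *)
Definition null3 (A : set 'rV[R]_3) : Prop :=
  exists N : set (coords3 R), [/\ measurable N, leb3 R N = 0%E & @vec3 R @^-1` A `<=` N].

Lemma null3_sub (A B : set 'rV[R]_3) : A `<=` B -> null3 B -> null3 A.
Proof. by move=> AB [N [mN N0 BN]]; exists N; split => // y /AB/BN. Qed.

Lemma null3U (A B : set 'rV[R]_3) : null3 A -> null3 B -> null3 (A `|` B).
Proof.
move=> [N [mN N0 AN]] [M [mM M0 BM]]; exists (N `|` M); split.
- exact: measurableU.
- by rewrite null_set_setU.
- by move=> y [/AN|/BM]; [left|right].
Qed.

Lemma null3_bigcup (I : eqType) (r : seq I) (A : I -> set 'rV[R]_3) :
  (forall i, i \in r -> null3 (A i)) -> null3 [set x | exists2 i, i \in r & A i x].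
Proof.
elim: r => [|i r IH] h.
  by exists set0; split; [exact: measurable0|exact: measure0|move=> y []].
apply: (@null3_sub _ (A i `|` [set x | exists2 i, i \in r & A i x])).
  move=> x [j]; rewrite inE => /predU1P[->|jr] Ax; first by left.
  by right; exists j.
apply: null3U; first by apply: h; rewrite mem_head.
by apply: IH => j jr; apply: h; rewrite inE jr orbT.
Qed.

Lemma null3_plane (A : set 'rV[R]_3) : is_plane A -> null3 A.
Proof.
move=> [n [c [n0 ->]]]; exists [set y | \sum_(i < 3) n 0 i * vec3 y 0 i = c].
by split; [exact: measurable_level | exact: leb3_level |].
Qed.

Lemma null3_affine_zero (l : 'rV[R]_3 -> R) x : affine_fun l -> l x != 0 ->
  null3 [set z | l z = 0].
Proof.
move=> [n [c lE]] lx; have [n0|n0] := eqVneq n 0.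
  exists set0; split; [exact: measurable0|exact: measure0|].
  have lc z : l z = c by rewrite lE n0 big1 ?add0r // => i _; rewrite mxE mul0r.
  by move=> y /=; rewrite lc => c0; move: lx; rewrite lc c0 eqxx.
apply: null3_plane; exists n, (- c); split => //; apply/seteqP; split => z /=.
  by rewrite lE => /eqP; rewrite addr_eq0 => /eqP.
by rewrite lE => ->; rewrite addNr.
Qed.

Lemma null3_triangle (F : {fset 'rV[R]_3}) : #|` F| = 3 -> null3 (hull F).
Proof.
move=> F3; have [a [b [c Fabc]]] : exists a b c, enum_fset F = [:: a; b; c].
  by move: F3; rewrite -[#|` F|]/(size F);
    case: (enum_fset F) => [//|a [//|b [//|c []]]] // _; exists a, b, c.
(* a normal vector n of the plane through a, b and c *)
pose N : 'M[R]_(3, 2) := \matrix_(i, j) [:: b 0 i - a 0 i; c 0 i - a 0 i]`_j.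
have /rowV0Pn[n /sub_kermxP nN n0] : kermx N != 0.
  rewrite kermx_eq0 /row_free neq_ltn (leq_ltn_trans (rank_leq_col N)) //.
apply: (@null3_sub _ [set x | \sum_(i < 3) n 0 i * x 0 i = \sum_(i < 3) n 0 i * a 0 i]).
  move=> x [w [w0 w1 ->]].
  have /affine_fun_comb E : affine_fun (fun x : 'rV[R]_3 => \sum_(i < 3) n 0 i * x 0 i + 0).
    by exists n, 0.
  have := E F w w1; rewrite /= addr0 => ->.
  have nz z : z \in F -> \sum_(i < 3) n 0 i * z 0 i = \sum_(i < 3) n 0 i * a 0 i.
    have Nb := congr1 (fun B : 'rV_2 => B 0 0) nN.
    have Nc := congr1 (fun B : 'rV_2 => B 0 1) nN.
    move: Nb Nc; rewrite !mxE !sum_ord3 !mxE /= => Nb Nc.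
    move=> zF; have : z \in enum_fset F by [].
    rewrite Fabc !inE => /or3P[] /eqP ->; lra.
  rewrite -[RHS]mul1r -w1 mulr_suml [LHS]big_seq [RHS]big_seq; apply: eq_bigr => z zF.
  by rewrite addr0 nz.
apply: null3_plane; by exists n, (\sum_(i < 3) n 0 i * a 0 i).
Qed.

Lemma box_not_null3 (a : 'rV[R]_3) (r : R) (A : set 'rV[R]_3) : 0 < r ->
  (forall x : 'rV[R]_3, (forall i, `|x 0 i - a 0 i| <= r) -> A x) -> ~ null3 A.
Proof.
move=> r0 rA [N [mN N0 AN]].
have : (leb3 R [set y | box3 r (y + unvec3 (- a))%R] <= leb3 R N)%E.
  apply: le_measure; rewrite ?inE //.
    have [[m1 m2] m3] := coords3_measurable (@measurable_id _ (coords3 R) setT).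
    have mt : measurable_fun setT (fun y : coords3 R => y + unvec3 (- a)).
      by apply: measurable_coords3; apply: measurable_funD => //; exact: measurable_cst.
    by rewrite -[X in measurable X]setTI; apply: mt => //; exact: measurable_box3.
  move=> y /box3E h; apply: AN; apply: rA => i; have := h i.
  by rewrite vec3D unvec3K !mxE.
rewrite N0 leb3_translate; last exact: measurable_box3.
rewrite leb3_box3 // lee_fin leNgt => /negP; apply.
by rewrite exprn_gt0 // mulr_gt0.
Qed.

Lemma int3_off_null (D D' N : set 'rV[R]_3) (f g : 'rV[R]_3 -> R) :
  null3 N -> (forall x, ~ N x -> (f \_ D) x = (g \_ D') x) ->
  int3 D f = int3 D' g.
Proof.
move=> [M [mM M0 NM]] fg; apply: (Rintegral_off_null mM) => // y My.
have -> : ((fun y => f (vec3 y)) \_ (@vec3 R @^-1` D)) y = (f \_ D) (vec3 y) by [].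
by rewrite fg // => /NM.
Qed.

Lemma ae3_null (P : 'rV[R]_3 -> Prop) : ae3 P <-> null3 [set x | ~ P x].
Proof. by split=> -[N [mN N0 h]]; exists N; split. Qed.

End null_sets.

(** * The mesh near a point *)

Section small.
Variable R : realType.
Implicit Types (P Q : R -> Prop).

(** A set is explored from a point x along the rays x + t d with t -> 0. *)
Definition small P : Prop := exists2 e : R, 0 < e & forall t, 0 < t < e -> P t.

Lemma smallW P Q : (forall t, 0 < t -> P t -> Q t) -> small P -> small Q.
Proof.
move=> PQ [e e0 Pe]; exists e => // t te; apply: PQ; last exact: Pe.
by case/andP: te.
Qed.

Lemma small_and P Q : small P -> small Q -> small (fun t => P t /\ Q t).
Proof.
move=> [e e0 Pe] [d d0 Qd]; exists (Num.min e d); first by rewrite lt_min e0.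
by move=> t; rewrite lt_min => /and3P[t0 te td]; split; [apply: Pe|apply: Qd]; rewrite t0.
Qed.

Lemma small_true P : (forall t, 0 < t -> P t) -> small P.
Proof. by move=> h; exists 1 => // t /andP[/h]. Qed.

Lemma small_all (I : eqType) (r : seq I) (P : I -> R -> Prop) :
  (forall i, i \in r -> small (P i)) -> small (fun t => forall i, i \in r -> P i t).
Proof.
elim: r => [|i r IH] h; first by exists 1.
have [] := small_and (h i (mem_head _ _)) (IH _).
  by move=> j jr; apply: h; rewrite inE jr orbT.
move=> e e0 he; exists e => // t te j; have [Pi Pr] := he t te.
by rewrite inE => /predU1P[->|/Pr].
Qed.

Lemma small_ex P : small P -> exists2 t, 0 < t & P t.
Proof.
move=> [e e0 Pe]; exists (e / 2); first by rewrite divr_gt0.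
by apply: Pe; apply/andP; split; lra.
Qed.

Lemma small_affine_gt0 (l : 'rV[R]_3 -> R) x d : affine_fun l -> 0 < l x ->
  small (fun t => 0 < l (x + t *: d)).
Proof.
move=> al lx; set D := l (x + d) - l x.
exists (l x / (1 + `|D|)); first by rewrite divr_gt0 // ltr_pwDl.
move=> t /andP[t0]; rewrite ltr_pdivlMr ?ltr_pwDl // => tD.
rewrite affine_fun_line // -/D.
have : - `|t * D| <= t * D by have := ler_norm (- (t * D)); rewrite normrN; lra.
rewrite normrM (gtr0_norm t0); nra.
Qed.

Lemma small_affine_lt0 (l : 'rV[R]_3 -> R) x d : affine_fun l -> l x < 0 ->
  small (fun t => l (x + t *: d) < 0).
Proof.
move=> [n [c lE]] lx.
have al : affine_fun (fun x => - l x).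
  exists (- n), (- c) => y; rewrite lE !sum_ord3 !mxE; ring.
have := @small_affine_gt0 _ x d al; rewrite oppr_gt0 => /(_ lx).
by apply: smallW => t _; rewrite oppr_gt0.
Qed.

End small.

Section mesh.
Variables (R : realType) (Omega : set 'rV[R]_3) (T : {fset {fset 'rV[R]_3}}).
Hypotheses (openO : open Omega) (hT : conforming_mesh Omega T).
Implicit Types (K L F : {fset 'rV[R]_3}) (x y z d : 'rV[R]_3).

Lemma mesh_simplex K : K \in T -> simplex 4 K.
Proof. by have [h _ _] := hT; exact: h. Qed.

Lemma mesh_closure K x : K \in T -> hull K x -> closure Omega x.
Proof. by have [_ _ ->] := hT; exists K. Qed.

(** In a conforming mesh, a point common to two tetrahedra lies on a common
    face, so its carrier in one is contained in the other. *)
Lemma mesh_face K L x z : K \in T -> L \in T -> hull K x -> hull L x ->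
  z \in K -> barycentric K z x != 0 -> z \in L.
Proof.
move=> KT LT Kx Lx zK lz; have [_ /(_ K L KT LT)[S [SK SL KLS]] _] := hT.
have Sx : hull S x by rewrite -KLS.
by apply: (fsubsetP SL); exact: hull_face (mesh_simplex KT) SK Sx zK lz.
Qed.

Lemma open_line x d : Omega x -> small (fun t => Omega (x + t *: d)).
Proof.
move=> Ox; have /nbhs_ballP[r /= r0 rO] : nbhs x Omega by exact: open_nbhs_nbhs.
pose D := 1 + \sum_i `|d 0 i|.
have D0 : 0 < D by rewrite ltr_pwDl ?sumr_ge0.
exists (r / D); first by rewrite divr_gt0.
move=> t /andP[t0]; rewrite ltr_pdivlMr // => tD; apply: rO; split=> // i j.
rewrite [i]ord1 /ball/= !mxE opprD addrA subrr add0r normrN normrM gtr0_norm //.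
apply: le_lt_trans tD; rewrite ler_pM2l // /D (bigD1 j) //= addrCA lerDl.
by rewrite addr_ge0 ?sumr_ge0.
Qed.

(** A short segment from x meets only the tetrahedra that contain x, since the
    finitely many others are closed, and the mesh covers it. *)
Lemma near_cover x d : Omega x -> small (fun t =>
  exists L, [/\ L \in T, hull L x & hull L (x + t *: d)]).
Proof.
move=> Ox; have [_ _ clO] := hT.
have far : small (fun t => forall L, L \in T -> ~ hull L x -> ~ hull L (x + t *: d)).
  apply: small_all => L LT; have sL := mesh_simplex LT.
  have [Lx|Lx] := pselect (hull L x); first by apply: small_true.
  have [z zL lz] : exists2 z, z \in L & barycentric L z x < 0.
    apply: contrapT => h; apply: Lx; apply/hull_barycentric => // z zL.
    by rewrite leNgt; apply/negP => lz; apply: h; exists z.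
  have := small_affine_lt0 d (barycentric_affine sL zL) lz.
  by apply: smallW => t _ lt0 _ /(hull_barycentric _ sL)/(_ z zL); rewrite leNgt lt0.
apply: smallW (small_and far (open_line d Ox)) => t _ [ft Ot].
have /= : closure Omega (x + t *: d) by exact: subset_closure.
rewrite clO => -[L LT Lt]; exists L; split => //.
by apply: contrapT => Lx; exact: ft LT Lx Lt.
Qed.

Lemma not_Omega_boundary K x : K \in T -> hull K x -> ~ Omega x -> boundary Omega x.
Proof.
move=> KT Kx Ox; split; first exact: mesh_closure Kx.
by move=> /interior_subset.
Qed.

End mesh.

(** * The tetrahedra around a critical edge *)

Section patch.
Variables (R : realType) (Omega : set 'rV[R]_3) (T : {fset {fset 'rV[R]_3}}).
Hypotheses (openO : open Omega) (hT : conforming_mesh Omega T).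
Implicit Types (K L F : {fset 'rV[R]_3}) (x y z d a b : 'rV[R]_3).
Implicit Types (l : 'rV[R]_3 -> R).

Lemma barycentric_comb4 K p q a b (c0 c1 c2 c3 : R) :
  simplex 4 K -> perm_eq K [:: p; q; a; b] -> c0 + c1 + c2 + c3 = 1 ->
  let x := c0 *: p + c1 *: q + c2 *: a + c3 *: b in
  [/\ barycentric K p x = c0, barycentric K q x = c1,
      barycentric K a x = c2 & barycentric K b x = c3].
Proof.
move=> sK K4 c1E; pose u : 'rV[R]_3 := \row_i [:: 1 - c0; c2 + c3; c3]`_i.
have := barycentric_frame u sK K4; rewrite /= frame_point.
have -> : u 0 0 = 1 - c0 by rewrite mxE.
have -> : u 0 1 = c2 + c3 by rewrite mxE.
have -> : u 0 2%:R = c3 by rewrite mxE.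
have -> : 1 - (1 - c0) = c0 by ring.
have -> : 1 - c0 - (c2 + c3) = c1 by rewrite -c1E; ring.
by have -> : c2 + c3 - c3 = c2 by ring.
Qed.

(** The planes [l1 = 0] and [l2 = 0] through a critical edge with end points p
    and q cut space into four quadrants.  A tetrahedron at the edge has a facet
    p, q, a in the first plane and a facet p, q, b in the second one; the signs
    of [l1 b] and [l2 a] tell the quadrant that contains it. *)
Definition wedge (p q : 'rV[R]_3) l1 l2 K a b : Prop :=
  [/\ K \in T, perm_eq K [:: p; q; a; b],
      [/\ l1 p = 0, l1 q = 0, l1 a = 0 & l1 b != 0] &
      [/\ l2 p = 0, l2 q = 0, l2 b = 0 & l2 a != 0]].

Section wedge.
Variables (p q : 'rV[R]_3) (l1 l2 : 'rV[R]_3 -> R).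
Hypotheses (al1 : affine_fun l1) (al2 : affine_fun l2).

Lemma wedge_sym K a b : wedge p q l1 l2 K a b -> wedge p q l2 l1 K b a.
Proof.
move=> [KT K4 h1 h2]; split => //; apply: perm_trans K4 _.
by rewrite !perm_cons; apply/seq.permP => P /=; rewrite !addn0 addnC.
Qed.

Lemma wedge_mem K a b z : wedge p q l1 l2 K a b -> (z \in K) = (z \in [:: p; q; a; b]).
Proof. by move=> [_ K4 _ _]; exact: perm_mem. Qed.

Lemma wedge_fourth K a b x : wedge p q l1 l2 K a b -> l1 x = barycentric K b x * l1 b.
Proof.
move=> W; have [KT K4 [l1p l1q l1a l1b] _] := W; have sK := mesh_simplex hT KT.
rewrite -{1}(barycentric_sum x sK) affine_fun_comb ?barycentric_sum1 //.
by rewrite (sum_perm4 _ K4) l1p l1q l1a !mulr0 !add0r.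
Qed.

End wedge.

Section two_planes.
Variables (p q : 'rV[R]_3) (l1 l2 : 'rV[R]_3 -> R).
Hypotheses (al1 : affine_fun l1) (al2 : affine_fun l2).
Local Notation wdg := (wedge p q l1 l2).

Lemma wedge_third K a b x : wdg K a b -> l2 x = barycentric K a x * l2 a.
Proof. by move=> /wedge_sym W; exact: wedge_fourth W. Qed.

Lemma wedge_hull K a b x : wdg K a b ->
  hull K x <-> [/\ 0 <= barycentric K p x, 0 <= barycentric K q x,
                   0 <= barycentric K a x & 0 <= barycentric K b x].
Proof.
move=> W; have [KT K4 _ _] := W; rewrite (hull_barycentric x (mesh_simplex hT KT)).
split=> [h|[hp hq ha hb] z].
  by split; apply: h; rewrite (wedge_mem _ W) !inE eqxx ?orbT.
by rewrite (wedge_mem _ W) !inE => /or4P[] /eqP ->.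
Qed.

Lemma wedge_midpoint K a b : wdg K a b -> let m := 2^-1 *: (p + q) in
  [/\ barycentric K p m = 2^-1, barycentric K q m = 2^-1,
      barycentric K a m = 0 & barycentric K b m = 0].
Proof.
move=> [KT K4 _ _] m.
have := @barycentric_comb4 K p q a b 2^-1 2^-1 0 0 (mesh_simplex hT KT) K4.
rewrite /= (_ : _ + _ *: b = m); last first.
  by apply/rowP => j; rewrite !mxE; ring.
by apply; field.
Qed.

Lemma wedge_inward_pos K a b d : wdg K a b -> let m := 2^-1 *: (p + q) in
  small (fun t => 0 < barycentric K p (m + t *: d)) /\
  small (fun t => 0 < barycentric K q (m + t *: d)).
Proof.
move=> W m; have [KT K4 _ _] := W; have [mp mq _ _] := wedge_midpoint W.
have sK := mesh_simplex hT KT.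
have h2 : 0 < 2^-1 :> R by rewrite invr_gt0.
split; apply: small_affine_gt0; rewrite ?mp ?mq //; apply: barycentric_affine => //;
  by rewrite (wedge_mem _ W) !inE eqxx ?orbT.
Qed.

(** At the midpoint of the edge the coordinates of p and q are positive, and
    those of a and b are zero; the latter are multiples of l2 and l1. *)
Lemma wedge_inward K a b d : wdg K a b -> let m := 2^-1 *: (p + q) in
  0 <= l1 (m + d) / l1 b -> 0 <= l2 (m + d) / l2 a ->
  small (fun t => hull K (m + t *: d)).
Proof.
move=> W m d1 d2; have [KT K4 [_ _ _ l1b] [_ _ _ l2a]] := W.
have sK := mesh_simplex hT KT.
have [mp mq ma mb] := wedge_midpoint W; rewrite -/m in ma mb.
have inK z : z \in [:: p; q; a; b] -> z \in K by rewrite (wedge_mem _ W).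
have pK : p \in K by rewrite inK ?mem_head.
have qK : q \in K by rewrite inK // !inE eqxx orbT.
have aK : a \in K by rewrite inK // !inE eqxx !orbT.
have bK : b \in K by rewrite inK // !inE eqxx !orbT.
have [sp sq] := wedge_inward_pos d W.
apply: smallW (small_and sp sq) => t t0 [tp tq].
apply/(wedge_hull _ W); split; [exact: ltW|exact: ltW| |].
- rewrite affine_fun_line; last exact: barycentric_affine.
  rewrite ma add0r subr0; apply: mulr_ge0; first exact: ltW.
  by move: d2; rewrite (wedge_third _ W) mulfK.
- rewrite affine_fun_line; last exact: barycentric_affine.
  rewrite mb add0r subr0; apply: mulr_ge0; first exact: ltW.
  by move: d1; rewrite (wedge_fourth al1 _ W) mulfK.
Qed.

Lemma affine_at_midpoint l a b (c e : R) : affine_fun l -> l p = 0 -> l q = 0 ->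
  l (2^-1 *: (p + q) + (c *: (a - p) + e *: (b - p))) = c * l a + e * l b.
Proof.
move=> al lp lq.
rewrite (_ : _ + _ = (2^-1 - c - e) *: p + 2^-1 *: q + c *: a + e *: b); last first.
  by apply/rowP => j; rewrite !mxE; ring.
by rewrite affine_fun4 // ?lp ?lq; [ring | field].
Qed.

(** The direction [a - p + e (b - p)] points from the midpoint of the edge into
    both tetrahedra.  With [e = 1] it points into the interior and is used for
    two tetrahedra in the same quadrant; with [e = 0] it stays in the facet
    p, q, a, and only the second plane has to have both on the same side. *)
Lemma wedge_common K a b L a' b' (e : R) : wdg K a b -> wdg L a' b' ->
  0 <= e -> 0 < l2 a * l2 a' -> 0 <= e * (l1 b * l1 b') ->
  exists x, [/\ hull K x, hull L x &
    [/\ 0 < barycentric K p x, 0 < barycentric K q x,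
        0 < barycentric K a x & 0 < e -> 0 < barycentric K b x]].
Proof.
move=> W W' e0 s2 s1.
have [KT K4 [l1p l1q l1a l1b] [l2p l2q l2b l2a]] := W.
have [LT _ [_ _ l1a' l1b'] [_ _ l2b' l2a']] := W'.
pose m := 2^-1 *: (p + q); pose d := 1 *: (a - p) + e *: (b - p).
have l1m : l1 m = 0.
  have := @affine_at_midpoint l1 a b 0 0 al1 l1p l1q.
  by rewrite !scale0r !addr0 !mul0r addr0.
have l2m : l2 m = 0.
  have := @affine_at_midpoint l2 a b 0 0 al2 l2p l2q.
  by rewrite !scale0r !addr0 !mul0r addr0.
have l1d : l1 (m + d) = e * l1 b by rewrite affine_at_midpoint // l1a mulr0 add0r.
have l2d : l2 (m + d) = l2 a by rewrite affine_at_midpoint // l2b mulr0 addr0 mul1r.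
have ratio (u v : R) : v != 0 -> 0 <= u * v -> 0 <= u / v.
  move=> v0 uv; rewrite (_ : u / v = u * v / v ^+ 2); last by field.
  by rewrite divr_ge0 // sqr_ge0.
have inK : small (fun t => hull K (m + t *: d)).
  apply: (wedge_inward W); rewrite -/m ?l1d ?l2d ?divff ?mulfK //; lra.
have inL : small (fun t => hull L (m + t *: d)).
  apply: (wedge_inward W'); rewrite -/m ?l1d ?l2d; apply: ratio => //.
    by rewrite -mulrA.
  exact: ltW.
have [sp sq] := wedge_inward_pos d W.
have [t t0 [[Kt Lt] [tp tq]]] := small_ex (small_and (small_and inK inL) (small_and sp sq)).
exists (m + t *: d); split => //; split => //.
- have := wedge_third (m + t *: d) W.
  rewrite affine_fun_line // l2m subr0 add0r l2d => /(mulIf l2a) <-; exact: t0.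
- move=> e_gt0; have := wedge_fourth al1 (m + t *: d) W.
  rewrite affine_fun_line // l1m subr0 add0r l1d mulrA => /(mulIf l1b) <-.
  by rewrite mulr_gt0.
Qed.

(** The interior of the first tetrahedron meets the second one, so conformity
    makes all its vertices vertices of the second. *)
Lemma wedge_same_quadrant K a b L a' b' : wdg K a b -> wdg L a' b' ->
  0 < l1 b * l1 b' -> 0 < l2 a * l2 a' -> K = L.
Proof.
move=> W W' s1 s2; have [KT _ _ _] := W; have [LT _ _ _] := W'.
have [|x [Kx Lx [xp xq xa /(_ ltr01) xb]]] := @wedge_common K a b L a' b' 1 W W' ler01 s2.
  by rewrite mul1r ltW.
apply/eqP; rewrite eqEfcard.
have [[cK _] [cL _]] := (mesh_simplex hT KT, mesh_simplex hT LT).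
rewrite cK cL leqnn andbT; apply/fsubsetP => z zK.
apply: (mesh_face hT KT LT Kx Lx zK).
by move: zK; rewrite (wedge_mem _ W) !inE => /or4P[] /eqP ->; rewrite gt_eqF.
Qed.

Lemma wedge_third_notin K a b : wdg K a b -> a \notin [:: p; q; b].
Proof.
move=> [_ _ [l1p l1q l1a l1b] [l2p l2q l2b l2a]]; rewrite !inE !negb_or.
by apply/and3P; split; apply: contra_neq l2a => ->.
Qed.

(** A point in the relative interior of the facet p, q, a lies in both
    tetrahedra, so a is a vertex of the second one; being on the first plane it
    is the third vertex. *)
Lemma wedge_same_third K a b L a' b' : wdg K a b -> wdg L a' b' ->
  0 < l2 a * l2 a' -> a = a'.
Proof.
move=> W W' s2; have [KT _ [l1p l1q l1a l1b] _] := W.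
have [LT _ [_ _ l1a' l1b'] [_ _ l2b' l2a']] := W'.
have [|x [Kx Lx [xp xq xa _]]] := @wedge_common K a b L a' b' 0 W W' (lexx _) s2.
  by rewrite mul0r.
have aK : a \in K by rewrite (wedge_mem _ W) !inE eqxx !orbT.
have := mesh_face hT KT LT Kx Lx aK; rewrite gt_eqF // => /(_ isT).
rewrite (wedge_mem _ W') !inE; have := wedge_third_notin W.
rewrite !inE !negb_or => /and3P[/negbTE -> /negbTE -> _] /= /orP[/eqP //|/eqP e].
by move: l1b'; rewrite -e l1a eqxx.
Qed.

(** The point x of the facet p, q, a is inside Omega, so the ray from x in the
    direction p - b, away from the given tetrahedron, starts in a tetrahedron of
    the mesh; it contains x, hence the whole facet. *)
Lemma wedge_neighbour K a b x : 
  (forall L, L \in T -> p \in L -> q \in L -> exists a' b', wdg L a' b') ->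
  wdg K a b -> Omega x -> hull K x -> 0 < barycentric K p x ->
  0 < barycentric K q x -> 0 < barycentric K a x -> barycentric K b x = 0 ->
  exists L a' b', [/\ wdg L a' b', l1 b * l1 b' < 0 & 0 < l2 a * l2 a'].
Proof.
move=> allW W Ox Kx xp xq xa xb.
have [KT K4 [l1p l1q l1a l1b] [l2p l2q l2b l2a]] := W.
have inK z : z \in [:: p; q; a; b] -> z \in K by rewrite (wedge_mem _ W).
pose d := p - b.
have [t t0 [L [LT Lx Lt]]] := small_ex (near_cover openO hT d Ox).
have inL z : z \in [:: p; q; a] -> z \in L.
  move=> zpqa; apply: (mesh_face hT KT LT Kx Lx).
    by apply: inK; move: zpqa; rewrite !inE => /or3P[] ->; rewrite ?orbT.
  by move: zpqa; rewrite !inE => /or3P[] /eqP ->; rewrite gt_eqF.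
have [a' [b' W']] := allW L LT (inL p (mem_head _ _)) (inL q ltac:(by rewrite !inE eqxx orbT)).
have [_ _ [_ _ l1a' l1b'] [_ _ l2b' l2a']] := W'.
exists L, a', b'; split => //.
  have l1x : l1 x = 0 by rewrite (wedge_fourth al1 x W) xb mul0r.
  have := wedge_fourth al1 (x + t *: d) W'.
  have l1xd : l1 (x + d) = - l1 b.
    have [n [c lE]] := al1; have := l1x; have := l1p; rewrite !lE /d !sum_ord3 !mxE; lra.
  rewrite affine_fun_line // l1x l1xd subr0 add0r => e.
  have [_ _ _ lb0] := (wedge_hull _ W').1 Lt.
  rewrite lt_neqAle mulf_neq0 //=.
  have e2 : l1 b * l1 b' * t = - (barycentric L b' (x + t *: d) * (l1 b') ^+ 2).
    by rewrite expr2 mulrA -e; ring.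
  by rewrite -(pmulr_lle0 _ t0) e2 oppr_le0 mulr_ge0 // sqr_ge0.
have e := wedge_third x W'; have e' := wedge_third x W.
have [_ _ la0 _] := (wedge_hull _ W').1 Lx.
rewrite lt_neqAle eq_sym mulf_neq0 //=.
by rewrite -(pmulr_rge0 _ xa) mulrA -e' e -mulrA mulr_ge0 // -expr2 sqr_ge0.
Qed.

End two_planes.
End patch.

Section gradients.
Variables (R : realType) (Omega : set 'rV[R]_3) (T : {fset {fset 'rV[R]_3}}).
Hypotheses (openO : open Omega) (hT : conforming_mesh Omega T).
Implicit Types (K L F : {fset 'rV[R]_3}) (x y z d a b : 'rV[R]_3).

Lemma sgr_opp (u v : R) : u * v < 0 -> Num.sg v = - Num.sg u.
Proof.
have [u0|u0|->] := ltrgt0P u; last by rewrite mul0r ltxx.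
  by rewrite pmulr_rlt0 // => v0; rewrite (gtr0_sg u0) (ltr0_sg v0).
by rewrite nmulr_rlt0 // => v0; rewrite (ltr0_sg u0) (gtr0_sg v0) opprK.
Qed.

Lemma mulr_gt0_trans (u v w : R) : 0 < (u * v) * (u * w) -> 0 < v * w.
Proof.
rewrite (_ : _ * (u * w) = u ^+ 2 * (v * w)); last by ring.
have [->|u0] := eqVneq u 0; first by rewrite expr0n mul0r ltxx.
by rewrite pmulr_rgt0 // lt_neqAle eq_sym sqr_ge0 andbT expf_neq0.
Qed.

(** The involution [rho] that exchanges partners and fixes the indices without
    partner turns the sum into its opposite. *)
Lemma sum_signed_pairs n (e : rel 'I_n) (tau h : 'I_n -> R) :
  (forall i j, e i j = e j i) ->
  (forall i j, e i j -> tau j = - tau i /\ h j = h i) ->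
  (forall i j k, e i j -> e i k -> j = k) ->
  (forall i, (forall j, ~~ e i j) -> h i = 0) ->
  \sum_i tau i * h i = 0.
Proof.
move=> e_sym e_pair e_uniq e_none.
pose rho i := odflt i [pick j | e i j].
have rhoE i j : e i j -> rho i = j.
  by rewrite /rho => eij; case: pickP => [k eik|/(_ j)]; [exact: e_uniq eik eij|rewrite eij].
have rhoN i : (forall j, ~~ e i j) -> rho i = i.
  by rewrite /rho => ni; case: pickP => [k eik|//]; have := ni k; rewrite eik.
have cases i : (exists j, e i j) \/ (forall j, ~~ e i j).
  by have [/existsP|/existsPn] := boolP [exists j, e i j]; [left|right].
have rhoK : involutive rho.
  move=> i; have [[j eij]|ni] := cases i; last by rewrite !rhoN.
  by rewrite (rhoE _ _ eij); apply: rhoE; rewrite e_sym.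
suff : \sum_i tau i * h i = - \sum_i tau i * h i by lra.
rewrite {1}(reindex_inj (inv_inj rhoK)) -sumrN; apply: eq_bigr => i _.
have [[j eij]|ni] := cases i.
  by rewrite (rhoE _ _ eij); have [-> ->] := e_pair _ _ eij; rewrite mulNr.
by rewrite rhoN // e_none // !mulr0 oppr0.
Qed.

Definition dderiv (g : 'rV[R]_3 -> R) p d : R := \sum_(j < 3) d 0 j * partial j g p.

Lemma dderiv_comb g p (al be : R) s w :
  dderiv g p (al *: s + be *: w) = al * dderiv g p s + be * dderiv g p w.
Proof.
rewrite /dderiv !mulr_sumr -big_split; apply: eq_bigr => j _ /=.
by rewrite !mxE mulrDl !mulrA.
Qed.

Lemma dderiv_eq_line k g h p d : poly_fun k g -> poly_fun k h ->
  small (fun t => g (p + t *: d) = h (p + t *: d)) -> dderiv g p d = dderiv h p d.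
Proof.
move=> gk hk [e e0 gh].
have ghk : poly_fun k (fun x => g x + (-1) * h x).
  by apply: poly_funD => //; exact: poly_funZ.
have := @partial_eq0_line _ _ _ p d e ghk e0.
have partialB j : partial j (fun x => g x + -1 * h x) p = partial j g p - partial j h p.
  have /poly_funP[r _ ->] := gk; have /poly_funP[s _ ->] := hk.
  rewrite (_ : (fun x => _) = mev (r + (-1) *: s)); last first.
    by apply/funext => x; rewrite mevD mevZ.
  by rewrite !partial_mev mderivD mderivZ mevD mevZ mulN1r.
rewrite /dderiv => H; apply/eqP; rewrite -subr_eq0 -sumrB; apply/eqP.
rewrite -[RHS]H; last by move=> t te; rewrite gh // mulN1r subrr.
by apply: eq_bigr => j _; rewrite partialB mulrBr.
Qed.

(** The directions q - p and a - p lie on the boundary of the cone of directions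
    that enter the facet, so they are recovered from two interior ones. *)
Lemma dderiv_eq_facet k g h p q a : poly_fun k g -> poly_fun k h ->
  (forall al be, 0 < al -> 0 < be -> small (fun t =>
     let x := p + t *: (al *: (q - p) + be *: (a - p)) in g x = h x)) ->
  forall al be, dderiv g p (al *: (q - p) + be *: (a - p)) =
                dderiv h p (al *: (q - p) + be *: (a - p)).
Proof.
move=> gk hk gh al be.
have h1 := dderiv_eq_line gk hk (gh 1 1 ltr01 ltr01).
have h2 := dderiv_eq_line gk hk (gh 2 1 (ltr0Sn _ _) ltr01).
rewrite !dderiv_comb in h1 h2 *.
have e1 : dderiv g p (q - p) = dderiv h p (q - p) by lra.
have e2 : dderiv g p (a - p) = dderiv h p (a - p) by lra.
by rewrite e1 e2.
Qed.

Section two_planes.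
Variables (p q : 'rV[R]_3) (l1 l2 : 'rV[R]_3 -> R).
Hypotheses (al1 : affine_fun l1) (al2 : affine_fun l2).
Local Notation wdg := (wedge T p q l1 l2).

Lemma wedge_p K a b : wdg K a b -> p \in K.
Proof. by move=> /wedge_mem ->; rewrite mem_head. Qed.

Lemma wedge_q K a b : wdg K a b -> q \in K.
Proof. by move=> /wedge_mem ->; rewrite !inE eqxx orbT. Qed.

Lemma wedge_third_unique m1 m2 K a b a' b' :
  wedge T p q m1 m2 K a b -> wedge T p q m1 m2 K a' b' -> a = a'.
Proof.
move=> V V'; have := wedge_mem a V; rewrite (wedge_mem _ V') !inE eqxx !orbT.
have := wedge_third_notin V; rewrite !inE !negb_or => /and3P[/negbTE -> /negbTE -> _] /=.
case/orP => [/eqP //|/eqP e].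
by have [_ _ [_ _ + _] _] := V; have [_ _ [_ _ _ +] _] := V'; rewrite -e => /eqP.
Qed.

(** In the same quadrant the tetrahedra would coincide, and in opposite
    quadrants they have only the edge in common. *)
Lemma wedge_adjacent K a b L a' b' : wdg K a b -> wdg L a' b' ->
  #|` (K `&` L)%fset| = 3 -> (l1 b * l2 a) * (l1 b' * l2 a') < 0.
Proof.
move=> W W' KL; have [KT K4 [l1p l1q l1a l1b] [l2p l2q l2b l2a]] := W.
have [LT L4 [_ _ l1a' l1b'] [_ _ l2b' l2a']] := W'.
have E : l1 b * l2 a * (l1 b' * l2 a') = (l1 b * l1 b') * (l2 a * l2 a') by ring.
have [s1|s1|s1] := ltrgt0P (l1 b * l1 b'); last first.
- by move/eqP: s1; rewrite mulf_eq0 (negbTE l1b) (negbTE l1b').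
- have [s2|s2|s2] := ltrgt0P (l2 a * l2 a'); last first.
  + by move/eqP: s2; rewrite mulf_eq0 (negbTE l2a) (negbTE l2a').
  + suff : (#|` (K `&` L)%fset| <= 2)%N by rewrite KL.
    apply: (@leq_trans #|` [fset p; q]%fset|); last by rewrite cardfs2; case: (_ != _).
    apply: fsubset_leq_card; apply/fsubsetP => z; rewrite inE => /andP[].
    rewrite (wedge_mem _ W) (wedge_mem _ W') !inE.
    case: eqVneq => //= zp; case: eqVneq => //= zq /orP[/eqP ->|/eqP ->] /orP[/eqP e|/eqP e].
    * by move: s2; rewrite e; have := sqr_ge0 (l2 a'); rewrite expr2; lra.
    * by move: l1b'; rewrite -e l1a eqxx.
    * by move: l1b; rewrite e l1a' eqxx.
    * by move: s1; rewrite e; have := sqr_ge0 (l1 b'); rewrite expr2; lra.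
  + by rewrite E nmulr_rlt0.
- have [s2|s2|s2] := ltrgt0P (l2 a * l2 a'); last first.
  + by move/eqP: s2; rewrite mulf_eq0 (negbTE l2a) (negbTE l2a').
  + by rewrite E pmulr_rlt0.
  + have KL' := wedge_same_quadrant hT al1 al2 W W' s1 s2.
    by move: KL; rewrite -KL' fsetIid; have [-> _] := mesh_simplex hT KT.
Qed.

Lemma wedge_direction K a b d : wdg K a b -> l1 (p + d) = 0 ->
  exists al be, d = al *: (q - p) + be *: (a - p).
Proof.
move=> W l1d; have [KT K4 [_ _ _ l1b] _] := W; have sK := mesh_simplex hT KT.
exists (barycentric K q (p + d)), (barycentric K a (p + d)).
have lb : barycentric K b (p + d) = 0.
  have := wedge_fourth hT al1 (p + d) W; rewrite l1d => /esym/eqP.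
  by rewrite mulf_eq0 (negbTE l1b) orbF => /eqP.
have := barycentric_sum1 (p + d) sK; rewrite (sum_perm4 _ K4) lb addr0 => e1.
have := barycentric_sum (p + d) sK; rewrite (sum_perm4 _ K4) lb scale0r addr0.
move: e1; move: (barycentric K p _) (barycentric K q _) (barycentric K a _) => u v w.
move=> e1; have -> : u = 1 - v - w by rewrite -e1; ring.
by move=> /rowP e2; apply/rowP => j; have := e2 j; rewrite !mxE; lra.
Qed.

Variables (n : nat) (K : nat -> {fset 'rV[R]_3}) (A B : nat -> 'rV[R]_3).
Hypotheses (W : forall i, (1 <= i <= n)%N -> wdg (K i) (A i) (B i))
  (K_inj : forall i j, (1 <= i <= n)%N -> (1 <= j <= n)%N -> K i = K j -> i = j)
  (K_all : forall L, L \in T -> p \in L -> q \in L -> exists2 i, (1 <= i <= n)%N & L = K i)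
  (K_adj : forall i, (1 <= i < n)%N -> #|` shared_facet K i| = 3).
Variables (k : nat) (f : 'rV[R]_3 -> R) (g : nat -> 'rV[R]_3 -> R).
Hypotheses (g_poly : forall i, (1 <= i <= n)%N -> poly_fun k (g i))
  (fg : forall i, (1 <= i <= n)%N -> forall x, hull (K i) x -> f x = g i x)
  (f0 : forall x, boundary Omega x -> f x = 0).

Definition quadrant_sign i : R := Num.sg (l1 (B i) * l2 (A i)).

Lemma quadrant_sign_neq0 i : (1 <= i <= n)%N -> l1 (B i) * l2 (A i) != 0.
Proof. by move=> /W[_ _ [_ _ _ h1] [_ _ _ h2]]; rewrite mulf_neq0. Qed.

(** The quadrant of a tetrahedron is adjacent to that of its predecessor, so
    exactly one of the two factors of the sign changes. *)
Lemma quadrant_sign_alternates i : (1 <= i <= n)%N ->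
  (-1) ^+ i = - quadrant_sign 1 * quadrant_sign i.
Proof.
elim: i => [//|i IH] /andP[_ iLn]; have [i0|i0] := posnP i.
  rewrite i0 expr1 mulNr /quadrant_sign -sgrM -expr2 gtr0_sg //.
  rewrite lt_neqAle eq_sym sqr_ge0 andbT expf_neq0 // quadrant_sign_neq0 //; lia.
have ri : (1 <= i <= n)%N by rewrite i0 ltnW.
have := wedge_adjacent (W ri) (W _) (K_adj _); rewrite iLn i0 => /(_ isT isT) s.
by rewrite exprS IH // mulN1r -mulrN /quadrant_sign (sgr_opp s).
Qed.

Let all_wedge L : L \in T -> p \in L -> q \in L -> exists a b, wdg L a b.
Proof. by move=> LT pL qL; have [i ri ->] := K_all LT pL qL; exists (A i), (B i); exact: W. Qed.

(** The points at which [dderiv_eq_facet] compares two polynomials lie in the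
    relative interior of the facet. *)
Let facet_point i al be : (1 <= i <= n)%N -> 0 < al -> 0 < be ->
  small (fun t => let x := p + t *: (al *: (q - p) + be *: (A i - p)) in
    [/\ 0 < barycentric (K i) p x, 0 < barycentric (K i) q x,
        0 < barycentric (K i) (A i) x & barycentric (K i) (B i) x = 0] /\ hull (K i) x).
Proof.
move=> ri al0 be0; have [KT K4 _ _] := W ri; have sK := mesh_simplex hT KT.
exists (al + be)^-1; first by rewrite invr_gt0 addr_gt0.
move=> t /andP[t0]; rewrite -[_^-1]mul1r ltr_pdivlMr ?addr_gt0 // => t1 x.
have [] := @barycentric_comb4 _ (K i) p q (A i) (B i) (1 - t * al - t * be) (t * al) (t * be) 0 sK K4.
  by ring.
rewrite (_ : _ + _ *: B i = x); last by apply/rowP => j; rewrite !mxE; ring.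
move=> ep eq ea eb.
have b4 : [/\ 0 < barycentric (K i) p x, 0 < barycentric (K i) q x,
    0 < barycentric (K i) (A i) x & barycentric (K i) (B i) x = 0].
  by rewrite ep eq ea eb !mulr_gt0 //; split => //; nra.
split => //; apply/(wedge_hull hT _ (W ri)).
by case: b4 => h1 h2 h3 ->; split => //; exact: ltW.
Qed.

(** The direction d is in the first plane. Tetrahedra on opposite sides of
    this plane and on the same side of the second one share their facet in the
    first plane, where f is continuous; their terms cancel. If a tetrahedron
    has no such partner, that facet lies on the boundary of the domain, where
    f vanishes. *)
Lemma quadrant_sum_eq0 d : l1 (p + d) = 0 ->
  \sum_(i < n) quadrant_sign i.+1 * dderiv (g i.+1) p d = 0.
Proof.
move=> l1d; pose e (i j : 'I_n) := (l1 (B i.+1) * l1 (B j.+1) < 0) &&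
  (0 < l2 (A i.+1) * l2 (A j.+1)).
have r (i : 'I_n) : (1 <= i.+1 <= n)%N by rewrite ltn_ord.
apply: (@sum_signed_pairs n e (fun i => quadrant_sign i.+1) (fun i => dderiv (g i.+1) p d)).
- by move=> i j; rewrite /e mulrC [l2 _ * _]mulrC.
- move=> i j /andP[s1 s2]; split.
    apply: sgr_opp; rewrite (_ : _ * _ = (l1 (B i.+1) * l1 (B j.+1)) *
      (l2 (A i.+1) * l2 (A j.+1))); last by ring.
    by rewrite pmulr_llt0.
  have AE : A j.+1 = A i.+1 by rewrite (wedge_same_third hT al1 al2 (W (r i)) (W (r j)) s2).
  have [al [be ->]] := wedge_direction (W (r i)) l1d.
  rewrite -AE; apply: (dderiv_eq_facet (g_poly (r j)) (g_poly (r i))) => a0 b0 a0_gt0 b0_gt0.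
  have sj := facet_point (r j) a0_gt0 b0_gt0.
  have si := facet_point (r i) a0_gt0 b0_gt0.
  rewrite -AE in si; apply: smallW (small_and si sj) => t t0 [[_ hi] [_ hj]] x.
  by rewrite -(fg (r i) hi) -(fg (r j) hj).
- move=> i j m /andP[s1 s2] /andP[s1' s2']; apply: ord_inj; apply: succn_inj.
  apply: K_inj => //; apply: (wedge_same_quadrant hT al1 al2 (W (r j)) (W (r m))).
    by apply: (@mulr_gt0_trans (l1 (B i.+1))); rewrite nmulr_rgt0.
  by apply: (@mulr_gt0_trans (l2 (A i.+1))); rewrite mulr_gt0.
- move=> i ni; have [al [be ->]] := wedge_direction (W (r i)) l1d.
  have c0 := @poly_fun_cst R k 0.
  rewrite (dderiv_eq_facet (g_poly (r i)) c0).
    rewrite /dderiv big1 // => j _.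
    rewrite /partial derive_cst mulr0 //.
  move=> a0 b0 a0_gt0 b0_gt0; apply: smallW (facet_point (r i) a0_gt0 b0_gt0).
  move=> t t0 /= [[xp xq xa xb] hx]; set x := p + _ in xp xq xa xb hx *.
  have [KT _ _ _] := W (r i).
  rewrite -(fg (r i) hx) f0 //; apply: (not_Omega_boundary hT KT hx) => Ox.
  have [L [a' [b' [W' s1 s2]]]] :=
    wedge_neighbour openO hT al1 al2 all_wedge (W (r i)) Ox hx xp xq xa xb.
  have [LT _ _ _] := W'.
  have [m rm Lm] := K_all LT (wedge_p W') (wedge_q W').
  have Wm := W rm; rewrite -Lm in Wm.
  have [a'E b'E] := (wedge_third_unique W' Wm, wedge_third_unique (wedge_sym W') (wedge_sym Wm)).
  case: m rm Lm Wm a'E b'E => // m rm _ _ a'E b'E.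
  by have := ni (Ordinal rm); rewrite /e /= -a'E -b'E s1 s2.
Qed.

End two_planes.
End gradients.

Section critical.
Variables (R : realType) (Omega : set 'rV[R]_3) (T : {fset {fset 'rV[R]_3}}).
Hypotheses (openO : open Omega) (hT : conforming_mesh Omega T).
Implicit Types (K L F : {fset 'rV[R]_3}) (x y z d a b : 'rV[R]_3).

(** The sum is orthogonal to the directions of both planes, that is, to all
    edge vectors of one tetrahedron. *)
Lemma alternating_gradient (p q : 'rV[R]_3) (l1 l2 : 'rV[R]_3 -> R) n
    (K : nat -> {fset 'rV[R]_3}) (k : nat) (f : 'rV[R]_3 -> R)
    (g : nat -> 'rV[R]_3 -> R) (j : 'I_3) :
  affine_fun l1 -> affine_fun l2 ->
  (forall L, L \in T -> p \in L -> q \in L -> exists a b, wedge T p q l1 l2 L a b) ->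
  (forall i, (1 <= i <= n)%N -> [/\ K i \in T, p \in K i & q \in K i]) ->
  (forall i i', (1 <= i <= n)%N -> (1 <= i' <= n)%N -> K i = K i' -> i = i') ->
  (forall L, L \in T -> p \in L -> q \in L -> exists2 i, (1 <= i <= n)%N & L = K i) ->
  (forall i, (1 <= i < n)%N -> #|` shared_facet K i| = 3) ->
  (forall i, (1 <= i <= n)%N -> poly_fun k (g i)) ->
  (forall i, (1 <= i <= n)%N -> forall x, hull (K i) x -> f x = g i x) ->
  (forall x, boundary Omega x -> f x = 0) ->
  \sum_(1 <= i < n.+1) (-1) ^+ i * partial j (g i) p = 0.
Proof.
move=> al1 al2 allW KT K_inj K_all K_adj g_poly fg f0.
have [n0|n_gt0] := posnP n; first by rewrite n0 big_geq.
have [AB hAB] : exists AB : nat -> 'rV[R]_3 * 'rV[R]_3, forall i, (1 <= i <= n)%N ->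
    wedge T p q l1 l2 (K i) (AB i).1 (AB i).2.
  have : forall i, exists ab : 'rV[R]_3 * 'rV[R]_3, (1 <= i <= n)%N -> wedge T p q l1 l2 (K i) ab.1 ab.2.
    move=> i; have [ri|] := boolP (1 <= i <= n)%N; last by exists (0, 0).
    have [Ti pi qi] := KT i ri.
    by have [a [b W]] := allW _ Ti pi qi; exists (a, b).
  by move=> /choice[AB h]; exists AB.
pose A i := (AB i).1; pose B i := (AB i).2.
have W i : (1 <= i <= n)%N -> wedge T p q l1 l2 (K i) (A i) (B i) by exact: hAB.
have W' i : (1 <= i <= n)%N -> wedge T p q l2 l1 (K i) (B i) (A i).
  by move=> /W/wedge_sym.
pose tau i := quadrant_sign l1 l2 A B i.
pose V : 'cV[R]_3 := \col_j \sum_(i < n) tau i.+1 * partial j (g i.+1) p.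
have VE d : \sum_(i < n) tau i.+1 * dderiv (g i.+1) p d = \sum_j d 0 j * V j 0.
  under eq_bigr do rewrite /dderiv mulr_sumr.
  rewrite exchange_big; apply: eq_bigr => m _ /=; rewrite mxE mulr_sumr.
  by apply: eq_bigr => i _; rewrite mulrCA.
have r1 : (1 <= 1 <= n)%N by rewrite leqnn.
have [K1T K4 [l1p l1q l1a _] [l2p l2q l2b _]] := W 1%N r1.
have V1 d : l1 (p + d) = 0 -> \sum_j d 0 j * V j 0 = 0.
  by rewrite -VE; exact: (quadrant_sum_eq0 openO hT al1 al2 W K_inj K_all g_poly fg f0).
have V2 d : l2 (p + d) = 0 -> \sum_j d 0 j * V j 0 = 0.
  move=> l2d; rewrite -VE.
  rewrite -[RHS](quadrant_sum_eq0 openO hT al2 al1 W' K_inj K_all g_poly fg f0 l2d).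
  by apply: eq_bigr => i _; rewrite /tau /quadrant_sign [l1 _ * _]mulrC.
have V0 : V = 0.
  rewrite -[V](mulKmx (frame_mx_unit (mesh_simplex hT K1T) K4)).
  suff -> : frame_mx p q (A 1%N) (B 1%N) *m V = 0 by rewrite mulmx0.
  have SE d : \sum_j d 0 j * V j 0 = 0 -> d *m V = 0.
    by move=> dV; apply/rowP => m; rewrite ord1 !mxE.
  have hq : (q - p) *m V = 0 by apply/SE/V1; rewrite addrC subrK.
  have ha : (A 1%N - p) *m V = 0 by apply/SE/V1; rewrite addrC subrK.
  have hb : (B 1%N - p) *m V = 0 by apply/SE/V2; rewrite addrC subrK.
  apply/row_matrixP => i; rewrite row_mul row0; move: i; apply: ord3P.
  - by rewrite (_ : row _ _ = q - p) //; apply/rowP => m; rewrite !mxE.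
  - have -> : row 1 (frame_mx p q (A 1%N) (B 1%N)) = (A 1%N - p) - (q - p).
      by apply/rowP => m; rewrite 2!mxE -[LHS]/(A 1%N 0 m - q 0 m) !mxE; ring.
    by rewrite mulmxBl ha hq subrr.
  - have -> : row 2%:R (frame_mx p q (A 1%N) (B 1%N)) = (B 1%N - p) - (A 1%N - p).
      by apply/rowP => m; rewrite 2!mxE -[LHS]/(B 1%N 0 m - A 1%N 0 m) !mxE; ring.
    by rewrite mulmxBl ha hb subrr.
have := congr1 (fun v : 'cV[R]_3 => v j 0) V0; rewrite !mxE => Vj.
transitivity (- tau 1%N * \sum_(i < n) tau i.+1 * partial j (g i.+1) p); last first.
  by rewrite Vj mulr0.
rewrite big_add1 big_mkord /= mulr_sumr; apply: eq_bigr => i _; rewrite mulrA.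
have ri : (1 <= i.+1 <= n)%N by rewrite ltn_ord.
by rewrite (quadrant_sign_alternates hT al1 al2 W K_adj ri).
Qed.

Lemma edge_patchE E K p q : is_edge T E -> E = [fset p; q]%fset ->
  edge_patch T E K <-> [/\ K \in T, p \in K & q \in K].
Proof.
move=> [_ [K0 K0T EK0]] Epq; split.
  move=> [KT EK]; have inK z : z \in E -> z \in K.
    move=> zE; have zK0 := fsubsetP EK0 z zE.
    have h0 := hull_fsub EK0 (hull_vertex zE).
    apply: (mesh_face hT K0T KT h0 (EK z (hull_vertex zE)) zK0).
    by have [_ -> _] := barycentricP (mesh_simplex hT K0T) zK0; rewrite oner_eq0.
  by split => //; apply: inK; rewrite Epq !inE eqxx ?orbT.
move=> [KT pK qK]; split => // x; apply: hull_fsub.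
by rewrite Epq; apply/fsubsetP => z; rewrite !inE => /orP[] /eqP ->.
Qed.

(** The two facets at the edge of a tetrahedron are not coplanar, so each of
    the two planes contains one of them. *)
Lemma critical_wedges E p q : critical_edge T E -> E = [fset p; q]%fset ->
  exists l1 l2 : 'rV[R]_3 -> R, [/\ affine_fun l1, affine_fun l2,
    is_plane [set x | l1 x = 0], is_plane [set x | l2 x = 0] &
    forall L, L \in T -> p \in L -> q \in L -> exists a b, wedge T p q l1 l2 L a b].
Proof.
move=> [Eedge [Pi1 [Pi2 [[n1 [c1 [n1_neq0 Pi1E]]] [n2 [c2 [n2_neq0 Pi2E]]] facets]]]] Epq.
pose lin (n : 'rV[R]_3) (c : R) x := \sum_(i < 3) n 0 i * x 0 i - c.
have lin_aff (n : 'rV[R]_3) (c : R) : affine_fun (lin n c) by exists n, (- c).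
have lin_plane (n : 'rV[R]_3) (c : R) :
    [set x : 'rV[R]_3 | \sum_(i < 3) n 0 i * x 0 i = c] = [set x | lin n c x = 0].
  by apply/seteqP; split => x /=; rewrite /lin => /eqP; [rewrite -subr_eq0|rewrite subr_eq0] => /eqP.
have P1 := etrans Pi1E (lin_plane n1 c1).
have P2 := etrans Pi2E (lin_plane n2 c2).
have pq : p != q.
  by have [] := Eedge; rewrite Epq cardfs2; case: eqP.
have nonzero (n : 'rV[R]_3) (c : R) L a b : n != 0 -> L \in T -> perm_eq L [:: p; q; a; b] ->
    lin n c p = 0 -> lin n c q = 0 -> lin n c a = 0 -> lin n c b = 0 -> False.
  move=> n0 LT L4 lp lq la lb.
  have l0 x : lin n c x = 0.
    rewrite -(barycentric_sum x (mesh_simplex hT LT)) affine_fun_comb ?barycentric_sum1 //.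
      by rewrite (sum_perm4 _ L4) lp lq la lb !mulr0 !addr0.
    exact: (mesh_simplex hT LT).
  have c0 : c = 0.
    by have := l0 0; rewrite /lin big1 => [/eqP|i _]; [rewrite sub0r oppr_eq0 => /eqP|rewrite mxE mulr0].
  move/rV0Pn : n0 => [i /eqP]; apply.
  have := l0 (delta_mx 0 i); rewrite /lin c0 subr0 (bigD1 i) //= mxE !eqxx mulr1.
  by rewrite big1 ?addr0 // => m mi; rewrite mxE (negbTE mi) andbF mulr0.
exists (lin n1 c1), (lin n2 c2); split => //.
- by exists n1, c1; split => //; exact: esym (lin_plane _ _).
- by exists n2, c2; split => //; exact: esym (lin_plane _ _).
move=> L LT pL qL; have sL := mesh_simplex hT LT.
have [a [b L4]] := simplex4_enum2 sL pL qL pq.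
have uL := frame_uniq L4.
have inL z : (z \in L) = (z \in [:: p; q; a; b]) by exact: perm_mem.
have facet z : z \in [:: a; b] -> 
    [/\ lin n1 c1 p = 0, lin n1 c1 q = 0 & lin n1 c1 z = 0] \/
    [/\ lin n2 c2 p = 0, lin n2 c2 q = 0 & lin n2 c2 z = 0].
  move=> zab; pose F := [fset p; q; z]%fset.
  have FL : (F `<=` L)%fset.
    apply/fsubsetP => y; rewrite !inE => /orP[/orP[]|] /eqP -> //.
    by rewrite inL; move: zab; rewrite !inE => ->; rewrite !orbT.
  have Ff : is_facet T F.
    split; last by exists L.
    rewrite /F fsetUC cardfsU1 cardfs2 pq !inE.
    move: zab uL; rewrite /= !inE !negb_or => /orP[] /eqP ->.
      by move=> /and4P[/and3P[_ pa _] /andP[qa _] _ _]; rewrite ![a == _]eq_sym pa qa.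
    by move=> /and4P[/and3P[_ _ pb] /andP[_ qb] _ _]; rewrite ![b == _]eq_sym pb qb.
  have EF : hull E `<=` hull F.
    by move=> x; apply: hull_fsub; rewrite Epq; apply/fsubsetP => y; rewrite !inE => ->.
  have inF y : y \in [:: p; q; z] -> hull F y.
    by move=> h; apply: hull_vertex; move: h; rewrite !inE -orbA.
  have [hF|hF] := facets F Ff EF; [left; move: hF|right; move: hF];
    rewrite ?P1 ?P2 => hF; split; apply: hF; apply: inF; rewrite !inE eqxx ?orbT //.
have aab : a \in [:: a; b] by rewrite mem_head.
have bab : b \in [:: a; b] by rewrite !inE eqxx orbT.
have [[h1 h2 h3]|[h1 h2 h3]] := facet a aab; have [[g1 g2 g3]|[g1 g2 g3]] := facet b bab.
- by have := nonzero _ _ _ _ _ n1_neq0 LT L4 h1 h2 h3 g3.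
- exists a, b; split => //; split => //; apply/eqP => e.
    exact: (nonzero _ _ _ _ _ n1_neq0 LT L4 h1 h2 h3 e).
  exact: (nonzero _ _ _ _ _ n2_neq0 LT L4 g1 g2 e g3).
- exists b, a; apply: wedge_sym; split => //; split => //; apply/eqP => e.
    exact: (nonzero _ _ _ _ _ n2_neq0 LT L4 h1 h2 h3 e).
  exact: (nonzero _ _ _ _ _ n1_neq0 LT L4 g1 g2 e g3).
- by have := nonzero _ _ _ _ _ n2_neq0 LT L4 h1 h2 h3 g3.
Qed.

End critical.

(** * Inner edges *)

Section inner.
Variables (R : realType) (Omega : set 'rV[R]_3) (T : {fset {fset 'rV[R]_3}}).
Hypotheses (openO : open Omega) (hT : conforming_mesh Omega T).
Implicit Types (K L F : {fset 'rV[R]_3}) (x y z d a b : 'rV[R]_3).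

Lemma affine_fun_directions (l : 'rV[R]_3 -> R) x p a b (c e : R) : affine_fun l ->
  l (x + (c *: (a - p) + e *: (b - p))) = l x + c * (l a - l p) + e * (l b - l p).
Proof.
move=> [n [k lE]]; rewrite !lE.
have E (u v : 'rV[R]_3) : \sum_(i < 3) n 0 i * u 0 i + k - (\sum_(i < 3) n 0 i * v 0 i + k) =
    \sum_(i < 3) n 0 i * (u - v) 0 i.
  rewrite opprD addrACA subrr addr0 -sumrB; apply: eq_bigr => i _.
  by rewrite !mxE mulrBr.
rewrite !E addrAC -addrA !mulr_sumr.
rewrite addrAC; congr (_ + k); rewrite addrA -!big_split; apply: eq_bigr => i _ /=.
by rewrite !mxE; ring.
Qed.

Section quadrants.
Variables (p q : 'rV[R]_3) (l1 l2 : 'rV[R]_3 -> R).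
Hypotheses (al1 : affine_fun l1) (al2 : affine_fun l2)
  (allW : forall L, L \in T -> p \in L -> q \in L -> exists a b, wedge T p q l1 l2 L a b).
Local Notation wdg := (wedge T p q l1 l2).

Lemma wedge_sign (t s u v la : R) :
  0 < t -> s != 0 -> u != 0 -> v != 0 -> 0 <= la -> t * (s * u) = la * v -> 0 < s * (u * v).
Proof.
move=> t0 s0 u0 v0 la0 e; rewrite lt_neqAle eq_sym !mulf_neq0 //=.
have E : t * (s * (u * v)) = la * v ^+ 2 by rewrite expr2 [RHS]mulrA -e; ring.
by rewrite -(pmulr_rge0 _ t0) E; apply: mulr_ge0 => //; exact: sqr_ge0.
Qed.

(** A short segment from the point x of the edge into the quadrant given by the
    signs s1 and s2, relative to that of K, stays in Omega and is covered by
    the mesh. *)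
Lemma quadrant_occupied K a b x (s1 s2 : R) : wdg K a b -> Omega x ->
  hull K x -> 0 < barycentric K p x -> 0 < barycentric K q x ->
  l1 x = 0 -> l2 x = 0 -> s1 != 0 -> s2 != 0 ->
  exists L a' b', [/\ wdg L a' b', 0 < s1 * (l1 b * l1 b') & 0 < s2 * (l2 a * l2 a')].
Proof.
move=> W Ox Kx xp xq l1x l2x s10 s20.
have [KT K4 [l1p l1q l1a l1b] [l2p l2q l2b l2a]] := W.
pose d := s2 *: (a - p) + s1 *: (b - p).
have [t t0 [L [LT Lx Lt]]] := small_ex (near_cover openO hT d Ox).
have pL : p \in L.
  by apply: (mesh_face hT KT LT Kx Lx (wedge_p W)); rewrite gt_eqF.
have qL : q \in L.
  by apply: (mesh_face hT KT LT Kx Lx (wedge_q W)); rewrite gt_eqF.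
have [a' [b' W']] := allW LT pL qL.
have [_ _ [_ _ l1a' l1b'] [_ _ l2b' l2a']] := W'.
have [_ _ la0 lb0] := (wedge_hull hT _ W').1 Lt.
exists L, a', b'; split => //.
  have := wedge_fourth hT al1 (x + t *: d) W'.
  rewrite affine_fun_line // affine_fun_directions // l1x l1p l1a !subr0 mulr0 !add0r.
  exact: (wedge_sign t0 s10 l1b l1b' lb0).
have := wedge_third hT al2 (x + t *: d) W'.
rewrite affine_fun_line // affine_fun_directions // l2x l2p l2b !subr0 mulr0 addr0 !add0r.
exact: (wedge_sign t0 s20 l2a l2a' la0).
Qed.

Lemma wedge_shared K a b L a' b' : wdg K a b -> wdg L a' b' ->
  l1 b * l1 b' < 0 -> 0 < l2 a * l2 a' ->
  #|` (K `&` L)%fset| = 3 /\ hull (K `&` L)%fset `<=` [set x | l1 x = 0].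
Proof.
move=> W W' s1 s2; have [KT K4 [l1p l1q l1a l1b] [l2p l2q l2b l2a]] := W.
have aa' := wedge_same_third hT al1 al2 W W' s2; rewrite -aa' in W'.
have KL : (K `&` L)%fset = [fset a; p; q]%fset.
  apply/fsetP => z; rewrite inE (wedge_mem _ W) (wedge_mem _ W') !inE.
  case: (eqVneq z b) => [zb|_]; case: (eqVneq z b') => [zb'|_];
    rewrite ?orbF ?orbT ?andbT ?andbb //=.
  - by move: s1; rewrite -zb -zb'; have := sqr_ge0 (l1 z); rewrite expr2; lra.
  - by rewrite orbA orbC orbA.
  - by rewrite orbA orbC orbA.
  - by rewrite orbA orbC orbA.
rewrite KL; split.
  have := frame_uniq K4; rewrite /= !inE !negb_or => /and4P[/and3P[pq pa _] /andP[qa _] _ _].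
  by rewrite -fsetUA cardfsU1 cardfs2 pq !inE ![a == _]eq_sym (negbTE pa) (negbTE qa).
move=> x [w [_ w1 ->]] /=; rewrite affine_fun_comb // big_seq big1 // => z.
by rewrite !inE => /orP[/orP[]|] /eqP ->; rewrite ?l1a ?l1p ?l1q mulr0.
Qed.

End quadrants.

Lemma edge_other_end (E : {fset 'rV[R]_3}) p : #|` E| = 2 -> p \in E ->
  exists2 q, p != q & E = [fset p; q]%fset.
Proof.
move=> cE pE; have := cardfsD1 p E; rewrite cE pE => -[] /esym/eqP.
move=> /cardfs1P[q Eq]; exists q; last by rewrite -(fsetD1K pE) Eq.
have : q \in (E `\ p)%fset by rewrite Eq inE.
by rewrite !inE eq_sym => /andP[].
Qed.

(** The edge contains a point of Omega, which is open; moving it slightly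
    towards the midpoint avoids the end points. *)
Lemma inner_edge_point E K p q : is_edge T E -> ~ outer_edge Omega T E ->
  E = [fset p; q]%fset -> p != q -> K \in T -> p \in K -> q \in K ->
  exists2 s : R, 0 < s < 1 & Omega (s *: p + (1 - s) *: q).
Proof.
move=> Ee Ein Epq pq KT pK qK.
have EK : (E `<=` K)%fset.
  by rewrite Epq; apply/fsubsetP => z; rewrite !inE => /orP[] /eqP ->.
have [x Ex Ox] : exists2 x, hull E x & Omega x.
  apply: contrapT => h; apply: Ein; split => // x Ex.
  apply: (not_Omega_boundary hT KT (hull_fsub EK Ex)) => Ox; apply: h; by exists x.
have [w [w0 w1 xE]] := Ex.
have sE (V : nmodType) (F : 'rV[R]_3 -> V) : \sum_(z <- E) F z = F p + F q.
  by rewrite Epq big_fsetU1 ?inE //= big_seq_fset1.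
rewrite sE in w1; rewrite sE in xE.
have wp : 0 <= w p by apply: w0; rewrite Epq !inE eqxx.
have wq : 0 <= w q by apply: w0; rewrite Epq !inE eqxx orbT.
have h1 : small (fun t : R => t < 1) by exists 1 => // t /andP[].
have := small_and h1 (open_line openO (2^-1 *: (p + q) - x) Ox).
move=> /small_ex[t t0 [t1 Ot]]; exists ((1 - t) * w p + t / 2).
  have -> : w p = 1 - w q by lra.
  apply/andP; split; nra.
move: Ot; congr (Omega _); rewrite xE; apply/rowP => j; rewrite !mxE.
have -> : w q = 1 - w p by lra.
by field.
Qed.

(** One tetrahedron in each quadrant, in cyclic order of the quadrants. *)
Lemma inner_numbering_exists E : critical_edge T E -> inner_edge Omega T E ->
  exists K : nat -> {fset 'rV[R]_3}, edge_numbering Omega T E 4 K.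
Proof.
move=> crit inner; have [Ee Ein] := inner; have [cE [K0 K0T EK0]] := Ee.
have [p pE] : exists p, p \in E by apply/fset0Pn; rewrite -cardfs_gt0 cE.
have [q pq Epq] := edge_other_end cE pE.
have [l1 [l2 [al1 al2 pl1 pl2 allW]]] := critical_wedges hT crit Epq.
have pK0 : p \in K0 by apply: (fsubsetP EK0); rewrite Epq !inE eqxx.
have qK0 : q \in K0 by apply: (fsubsetP EK0); rewrite Epq !inE eqxx orbT.
have [a [b W]] := allW _ K0T pK0 qK0.
have [s /andP[s0 s1] Os] := inner_edge_point Ee Ein Epq pq K0T pK0 qK0.
have [_ K4 [l1p l1q l1a l1b] [l2p l2q l2b l2a]] := W.
set x := s *: p + (1 - s) *: q in Os.
have [] := @barycentric_comb4 _ K0 p q a b s (1 - s) 0 0 (mesh_simplex hT K0T) K4.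
  by ring.
rewrite !scale0r !addr0 -/x => xp xq xa xb.
have K0x : hull K0 x.
  by apply/(wedge_hull hT _ W); rewrite xp xq xa xb; split => //; lra.
have xp0 : 0 < barycentric K0 p x by rewrite xp.
have xq0 : 0 < barycentric K0 q x by rewrite xq; lra.
have l1x : l1 x = 0 by rewrite (wedge_fourth hT al1 x W) xb mul0r.
have l2x : l2 x = 0 by rewrite (wedge_third hT al2 x W) xa mul0r.
have Q t1 t2 := quadrant_occupied al1 al2 allW W Os K0x xp0 xq0 l1x l2x (s1:=t1) (s2:=t2).
have p1 : (1 : R) != 0 by rewrite oner_eq0.
have m1 : (-1 : R) != 0 by rewrite oppr_eq0.
have [K1 [a1 [b1 [W1 q11 q12]]]] := Q 1 1 p1 p1.
have [K2 [a2 [b2 [W2 q21 q22]]]] := Q (-1) 1 m1 p1.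
have [K3 [a3 [b3 [W3 q31 q32]]]] := Q (-1) (-1) m1 m1.
have [K4' [a4 [b4 [W4 q41 q42]]]] := Q 1 (-1) p1 m1.
rewrite ?mul1r ?mulN1r ?oppr_gt0 in q11 q12 q21 q22 q31 q32 q41 q42.
have pos (u v w : R) : 0 < u * v -> 0 < u * w -> 0 < v * w.
  by move=> h1 h2; apply: (@mulr_gt0_trans _ u); rewrite mulr_gt0.
have neg (u v w : R) : u * v < 0 -> u * w < 0 -> 0 < v * w.
  by move=> h1 h2; apply: (@mulr_gt0_trans _ u); rewrite nmulr_rgt0.
have mix (u v w : R) : 0 < u * v -> u * w < 0 -> v * w < 0.
  move=> h1 h2; rewrite -oppr_gt0 -mulrN; apply: pos h1 _; by rewrite mulrN oppr_gt0.
have [c12 f12] := wedge_shared al1 al2 W1 W2 (mix _ _ _ q11 q21) (pos _ _ _ q12 q22).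
have [c23 f23] := wedge_shared al2 al1 (wedge_sym W2) (wedge_sym W3)
  (mix _ _ _ q22 q32) (neg _ _ _ q21 q31).
have [c34 f34] : #|` (K3 `&` K4')%fset| = 3 /\ hull (K3 `&` K4')%fset `<=` [set x | l1 x = 0].
  apply: (wedge_shared al1 al2 W3 W4); last exact: neg q32 q42.
  by rewrite mulrC; exact: mix q41 q31.
have [c41 f41] : #|` (K4' `&` K1)%fset| = 3 /\ hull (K4' `&` K1)%fset `<=` [set x | l2 x = 0].
  apply: (wedge_shared al2 al1 (wedge_sym W4) (wedge_sym W1)); last exact: pos q41 q11.
  by rewrite mulrC; exact: mix q12 q42.
have uniq4 L L' a5 b5 a6 b6 : wedge T p q l1 l2 L a5 b5 -> wedge T p q l1 l2 L' a6 b6 ->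
    L = L' -> a5 = a6 /\ b5 = b6.
  move=> V V' LL'; rewrite LL' in V; split; first exact: wedge_third_unique V V'.
  exact: wedge_third_unique (wedge_sym V) (wedge_sym V').
have sep L L' a5 b5 a6 b6 : wedge T p q l1 l2 L a5 b5 -> wedge T p q l1 l2 L' a6 b6 ->
    (l1 b5 * l1 b6 < 0) \/ (l2 a5 * l2 a6 < 0) -> L <> L'.
  move=> V V' s12 /(uniq4 _ _ _ _ _ _ V V')[ea eb]; move: s12; rewrite ea eb.
  by have := sqr_ge0 (l1 b6); have := sqr_ge0 (l2 a6); rewrite !expr2; case; lra.
have n12 := sep _ _ _ _ _ _ W1 W2 (or_introl (mix _ _ _ q11 q21)).
have n13 := sep _ _ _ _ _ _ W1 W3 (or_introl (mix _ _ _ q11 q31)).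
have n14 := sep _ _ _ _ _ _ W1 W4 (or_intror (mix _ _ _ q12 q42)).
have n23 := sep _ _ _ _ _ _ W2 W3 (or_intror (mix _ _ _ q22 q32)).
have n24 := sep _ _ _ _ _ _ W2 W4 (or_intror (mix _ _ _ q22 q42)).
have n43 := sep _ _ _ _ _ _ W4 W3 (or_introl (mix _ _ _ q41 q31)).
(* the numbering starts at 1; the entry at 0 is a dummy and K_5 = K_1 *)
exists (nth K1 [:: K1; K1; K2; K3; K4'; K1]).
have inpatch L a5 b5 : wedge T p q l1 l2 L a5 b5 -> edge_patch T E L.
  move=> V; apply/(edge_patchE hT L Ee Epq); have [LT _ _ _] := V.
  by split => //; [exact: wedge_p V | exact: wedge_q V].
left; split => //; split => //; split => //.
- split.
  + case=> [|[|[|[|[|i]]]]] //= _; [exact: inpatch W1|exact: inpatch W2|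
      exact: inpatch W3|exact: inpatch W4].
  + by case=> [|[|[|[|[|i]]]]] //=; case=> [|[|[|[|[|j]]]]] //= _ _ e;
      exfalso; move: e; do ?[exact: n12|exact: n13|exact: n14|exact: n23|exact: n24|
      exact: n43|move/esym].
  + move=> L /(edge_patchE hT L Ee Epq)[LT pL qL].
    have [a5 [b5 V]] := allW L LT pL qL; have [_ _ [_ _ _ h1] [_ _ _ h2]] := V.
    have [u1|u1|u1] := ltrgt0P (l1 b * l1 b5); last first.
    * by move/eqP: u1; rewrite mulf_eq0 (negbTE l1b) (negbTE h1).
    * have [u2|u2|u2] := ltrgt0P (l2 a * l2 a5); last first.
      - by move/eqP: u2; rewrite mulf_eq0 (negbTE l2a) (negbTE h2).
      - by exists 3 => //=;
          exact: (wedge_same_quadrant hT al1 al2 V W3 (neg _ _ _ u1 q31) (neg _ _ _ u2 q32)).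
      - by exists 2 => //=;
          exact: (wedge_same_quadrant hT al1 al2 V W2 (neg _ _ _ u1 q21) (pos _ _ _ u2 q22)).
    * have [u2|u2|u2] := ltrgt0P (l2 a * l2 a5); last first.
      - by move/eqP: u2; rewrite mulf_eq0 (negbTE l2a) (negbTE h2).
      - by exists 4 => //=;
          exact: (wedge_same_quadrant hT al1 al2 V W4 (pos _ _ _ u1 q41) (neg _ _ _ u2 q42)).
      - by exists 1 => //=;
          exact: (wedge_same_quadrant hT al1 al2 V W1 (pos _ _ _ u1 q11) (pos _ _ _ u2 q12)).
- by case=> [|[|[|[|[|i]]]]].
- exists [set x | l1 x = 0], [set x | l2 x = 0]; split => //.
  + by move=> e; have : [set x | l1 x = 0] a by []; rewrite e /= => /eqP; rewrite (negbTE l2a).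
  + by move=> y [/f12|/f34].
  + by move=> y [/f23|/f41].
Qed.

End inner.

(** * The functions of a critical edge *)

Section assembly.
Variables (R : realType) (Omega : set 'rV[R]_3) (T : {fset {fset 'rV[R]_3}}).
Hypotheses (hOmega : bounded_polyhedral_domain Omega) (hT : conforming_mesh Omega T).
Implicit Types (L F : {fset 'rV[R]_3}) (x z : 'rV[R]_3).

Let openO : open Omega. Proof. by have [] := hOmega. Qed.

Lemma boundary_null : null3 (boundary Omega).
Proof.
have [_ _ _ _ [B [sB ->]]] := hOmega.
by apply: (@null3_bigcup _ _ _ (fun F => hull F)) => F /sB[cF _]; exact: null3_triangle.
Qed.

(** Off this null set a point of the tetrahedron is in its interior and in no
    other tetrahedron, so that a piecewise polynomial function agrees near the
    point with one polynomial. *)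
Definition skeleton L : set 'rV[R]_3 :=
  [set x | exists2 z, z \in L & barycentric L z x = 0].

Lemma skeleton_null L : simplex 4 L -> null3 (skeleton L).
Proof.
move=> sL; apply: (@null3_bigcup _ _ (enum_fset L) (fun z => [set x | barycentric L z x = 0])).
move=> z zL; apply: (@null3_affine_zero _ _ z); first exact: barycentric_affine.
by have [_ -> _] := barycentricP sL zL; rewrite oner_eq0.
Qed.

Lemma continuous_affine_fun (l : 'rV[R]_3 -> R) : affine_fun l -> continuous l.
Proof.
move=> [n [c lE]]; rewrite (funext lE) => x.
apply: (@continuousD _ _ _ (fun y : 'rV[R]_3 => \sum_(i < 3) n 0 i * y 0 i) (fun=> c)); last first.
  exact: cst_continuous.
have c1 (i : 'I_3) : {for x, continuous (fun y : 'rV[R]_3 => n 0 i * y 0 i)}.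
  apply: (@continuousM _ _ (fun=> n 0 i) (fun y : 'rV[R]_3 => y 0 i)).
    exact: cst_continuous.
  exact: coord_continuous.
rewrite (_ : (fun y => _) = (fun y : 'rV[R]_3 => n 0 0 * y 0 0 + n 0 1 * y 0 1 + n 0 2%:R * y 0 2%:R)).
  apply: (@continuousD _ _ _ (fun y : 'rV[R]_3 => n 0 0 * y 0 0 + n 0 1 * y 0 1)) => //.
  exact: (@continuousD _ _ _ (fun y : 'rV[R]_3 => n 0 0 * y 0 0)).
by apply/funext => y; rewrite sum_ord3.
Qed.

Lemma near_hull L x : simplex 4 L -> hull L x -> ~ skeleton L x ->
  \forall y \near x, forall z, z \in L -> 0 < barycentric L z y.
Proof.
move=> sL /(hull_barycentric _ sL) Lx nx.
have : forall z, z \in enum_fset L -> \forall y \near x, 0 < barycentric L z y.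
  move=> z zL; have zpos : 0 < barycentric L z x.
    rewrite lt_neqAle eq_sym Lx // andbT; apply/eqP => z0; apply: nx; by exists z.
  have := continuous_affine_fun (barycentric_affine sL zL).
  by move=> /(_ x)/cvgr_gt; apply.
suff allL (r : seq 'rV[R]_3) : (forall z, z \in r -> \forall y \near x, 0 < barycentric L z y) ->
    \forall y \near x, forall z, z \in r -> 0 < barycentric L z y.
  by move=> h; exact: (allL (enum_fset L)).
elim: r => [|w r IH] h; first by apply: (@filterE _ (nbhs x)) => y z.
have h1 := h w (mem_head _ _).
have h2 : \forall y \near x, forall z, z \in r -> 0 < barycentric L z y.
  by apply: IH => z zr; apply: h; rewrite inE zr orbT.
near=> y => z; rewrite inE => /predU1P[->|].
  by near: y.
by move: z; near: y.
Unshelve. all: by end_near.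
Qed.

(** All vertices of L have positive weight at x, so conformity puts them into
    the other tetrahedron. *)
Lemma mesh_unique L L' x : L \in T -> L' \in T -> hull L x -> hull L' x ->
  ~ skeleton L x -> L = L'.
Proof.
move=> LT L'T Lx L'x nx; apply/eqP; rewrite eqEfcard.
have [[cL _] [cL' _]] := (mesh_simplex hT LT, mesh_simplex hT L'T).
rewrite cL cL' leqnn andbT; apply/fsubsetP => z zL.
apply: (mesh_face hT LT L'T Lx L'x zL).
by apply/eqP => z0; apply: nx; exists z.
Qed.

Lemma Rintegral_sum d (X : measurableType d) (mu : {measure set X -> \bar R})
    (D : set X) (I : eqType) (r : seq I) (F : I -> X -> R) : measurable D ->
  (forall i, i \in r -> mu.-integrable D (EFin \o F i)) ->
  mu.-integrable D (fun t => (\sum_(i <- r) F i t)%:E) /\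
  \int[mu]_(t in D) (\sum_(i <- r) F i t) = \sum_(i <- r) \int[mu]_(t in D) F i t.
Proof.
move=> mD; elim: r => [|i r IH] Fr.
  under eq_fun do rewrite big_nil; split; first exact: integrable0.
  under eq_Rintegral do rewrite big_nil.
  by rewrite big_nil Rintegral_cst // mul0r.
have [int_r E] := IH (fun j jr => Fr j (mem_behead (s := i :: r) jr)).
have int_i := Fr i (mem_head _ _).
split.
  under eq_fun do rewrite big_cons EFinD.
  exact: integrableD.
under eq_Rintegral do rewrite big_cons.
by rewrite RintegralD // E big_cons.
Qed.

Section pressure.
Variables (k n : nat) (K : nat -> {fset 'rV[R]_3}) (p : 'rV[R]_3).
Hypotheses (KT : forall i, (1 <= i <= n)%N -> K i \in T)
  (pK : forall i, (1 <= i <= n)%N -> p \in K i).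

Let P := @jacobi R k.-1 0 3.

Lemma jacobiP : is_jacobi 0 3 k.-1 P.
Proof. by have [Q HQ] := jacobi03_exists R k.-1; apply: xgetPex; exists Q. Qed.

Let sK i (ri : (1 <= i <= n)%N) : simplex 4 (K i) := mesh_simplex hT (KT ri).

Let piece i x := (-1) ^+ i / vol (hull (K i)) * P.[1 - 2 * barycentric (K i) p x].

Let piece_poly i : (1 <= i <= n)%N -> poly_fun k.-1 (piece i).
Proof.
move=> ri; apply: poly_funZ; apply: poly_fun_horner.
  by have [-> _ _] := jacobiP.
apply: poly_funD; first exact: poly_fun_cst.
under eq_fun do rewrite -mulNr; apply: poly_funZ.
by apply: barycentric_poly; [exact: sK | exact: pK].
Qed.

Let in_range i : i \in index_iota 1 n.+1 -> (1 <= i <= n)%N.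
Proof. by rewrite mem_index_iota ltnS. Qed.

Lemma edge_functionE x : edge_function k n K p x =
  \sum_(i <- index_iota 1 n.+1) (piece i \_ (hull (K i))) x.
Proof.
apply: eq_bigr => i _; rewrite patchE indicE.
by case: ifP => _; rewrite ?mulr1 ?mulr0 ?mul0r.
Qed.

(** Each tetrahedron contributes a point evaluation at p, in which the factor
    1 / |K_i| of the edge function cancels the volume. *)
Lemma edge_function_integral (h : 'rV[R]_3 -> R) (N : set 'rV[R]_3)
    (G : nat -> 'rV[R]_3 -> R) : null3 N ->
  (forall i, (1 <= i <= n)%N -> poly_fun k.-1 (G i)) ->
  (forall i x, (1 <= i <= n)%N -> hull (K i) x -> ~ N x -> h x = G i x) ->
  int3 Omega (fun x => edge_function k n K p x * h x) =
  6 * kuhn_weight P * \sum_(1 <= i < n.+1) (-1) ^+ i * G i p.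
Proof.
move=> N0 Gk hG.
pose F i x := ((fun x => piece i x * G i x) \_ (hull (K i))) x.
rewrite (@int3_off_null _ Omega setT (N `|` boundary Omega) _
  (fun x => \sum_(i <- index_iota 1 n.+1) F i x)); first last.
- move=> x /not_orP[nN nB]; rewrite patch_setT patchE.
  have [/set_mem Ox|/negP nO] := boolP (x \in Omega).
    rewrite edge_functionE mulr_suml big_seq [RHS]big_seq; apply: eq_bigr => i /in_range ri.
    rewrite /F !patchE; case: ifP => [/set_mem Kx|_]; last by rewrite mul0r.
    by rewrite (hG i x ri Kx nN).
  rewrite big_seq big1 // => i /in_range ri; rewrite /F patchE ifF //.
  apply/negP => /set_mem Kx; apply: nB.
  apply: (not_Omega_boundary hT (KT ri) Kx) => Ox; apply: nO; exact: mem_set.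
- by apply: null3U => //; exact: boundary_null.
have intF i : (1 <= i <= n)%N -> (leb3 R).-integrable setT (EFin \o (fun y => F i (vec3 y))).
  move=> ri; have mH := measurable_hull (sK ri); have [r Hr] := hull_box3 (K i).
  have := poly_fun_integrable (poly_funM (piece_poly ri) (Gk i ri)) mH Hr.
  rewrite -{1}(setTI (@vec3 R @^-1` hull (K i))).
  move/(integrable_restrict _ mH measurableT); apply: eq_integrable => //.
  move=> y _ /=; rewrite /F !patchE.
  rewrite (_ : (y \in _) = (vec3 y \in hull (K i))); first by case: ifP.
  by apply/idP/idP; rewrite !inE.
have [_ E] := @Rintegral_sum _ _ (leb3 R) setT _ (index_iota 1 n.+1)
  (fun i y => F i (vec3 y)) measurableT (fun i ri => intF i (in_range ri)).
rewrite /int3 preimage_setT E mulr_sumr [LHS]big_seq [RHS]big_seq.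
apply: eq_bigr => i /in_range ri.
transitivity (int3 (hull (K i)) (fun x => piece i x * G i x)).
  by rewrite /int3 [RHS]Rintegral_mkcond.
have vi := vol_hull_gt0 (sK ri) (pK ri).
have PE := tetrahedron_point_evaluation (sK ri) (pK ri) jacobiP (Gk i ri).
have mH := measurable_hull (sK ri); have [r Hr] := hull_box3 (K i).
pose c := (-1) ^+ i / vol (hull (K i)).
transitivity (c * int3 (hull (K i)) (fun x => P.[1 - 2 * barycentric (K i) p x] * G i x)).
  rewrite /int3 -RintegralZl //.
    by apply: eq_Rintegral => y _; rewrite /piece mulrA.
  have Pp : poly_fun k.-1 (fun x => P.[1 - 2 * barycentric (K i) p x]).
    apply: poly_fun_horner; first by have [-> _ _] := jacobiP.
    apply: poly_funD; first exact: poly_fun_cst.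
    under eq_fun do rewrite -mulNr; apply: poly_funZ.
    by apply: barycentric_poly; [exact: sK | exact: pK].
  exact: poly_fun_integrable (poly_funM Pp (Gk i ri)) mH Hr.
rewrite PE /c; field.
by rewrite gt_eqF.
Qed.

Lemma measurable_edge_function :
  measurable_fun setT (fun y : coords3 R => edge_function k n K p (vec3 y)).
Proof.
under eq_fun do rewrite edge_functionE.
have E (y : coords3 R) : \sum_(i <- index_iota 1 n.+1) (piece i \_ (hull (K i))) (vec3 y) =
    \sum_(i <- index_iota 1 n.+1 | (1 <= i <= n)%N)
      ((fun y => piece i (vec3 y)) \_ (@vec3 R @^-1` hull (K i))) y.
  rewrite big_seq [RHS]big_seq_cond; apply: eq_big => [i|i _].
    by rewrite mem_index_iota ltnS andbb.
  by rewrite !patchE (_ : (y \in _) = (vec3 y \in hull (K i))).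
rewrite (funext E); under eq_fun do rewrite big_mkcond.
apply: measurable_sum => i; have [ri|] := boolP (1 <= i <= n)%N; last first.
  by move=> _; exact: measurable_cst.
apply/measurable_restrict => //; first exact: measurable_hull (sK ri).
exact: measurable_funTS (poly_fun_measurable (piece_poly ri)).
Qed.

Lemma edge_function_bounded : exists M : R, forall x, `|edge_function k n K p x| <= M.
Proof.
have h i : exists M : R, (1 <= i <= n)%N -> forall x, hull (K i) x -> `|piece i x| <= M.
  have [ri|] := boolP (1 <= i <= n)%N; last by exists 0.
  have [r Hr] := hull_box3 (K i).
  have [M HM] := poly_fun_bounded r (piece_poly ri).
  exists M => _ x Kx; apply: HM => m.
  have : box3 r (unvec3 x) by apply: Hr; rewrite /= unvec3K.
  by move=> /box3E/(_ m); rewrite unvec3K.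
have /choice[M HM] := h; exists (\sum_(i <- index_iota 1 n.+1) `|M i|) => x.
rewrite edge_functionE (le_trans (ler_norm_sum _ _ _)) //.
rewrite big_seq [leRHS]big_seq; apply: ler_sum => i /in_range ri; rewrite patchE.
case: ifP => [/set_mem Kx|_]; last by rewrite normr0.
by rewrite (le_trans (HM i ri x Kx)) // ler_norm.
Qed.

Lemma edge_function_eq0 x : (forall i, (1 <= i <= n)%N -> ~ hull (K i) x) ->
  edge_function k n K p x = 0.
Proof.
move=> h; rewrite edge_functionE big_seq big1 // => i /in_range ri.
by rewrite patchE ifF //; apply/negP => /set_mem; exact: h.
Qed.

Lemma edge_function_on i x : (forall i j, (1 <= i <= n)%N -> (1 <= j <= n)%N -> K i = K j -> i = j) ->
  (1 <= i <= n)%N -> hull (K i) x -> ~ skeleton (K i) x ->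
  edge_function k n K p x = piece i x.
Proof.
move=> K_inj ri Kx nx; rewrite edge_functionE (bigD1_seq i) ?iota_uniq //=; last first.
  by rewrite mem_index_iota ltnS.
rewrite patchE ifT ?mem_set // big_seq_cond big1 ?addr0 // => j /andP[/in_range rj ji].
rewrite patchE ifF //; apply/negP => /set_mem Kjx; move/eqP: ji; apply.
by apply: K_inj => //; rewrite (mesh_unique (KT ri) (KT rj) Kx Kjx nx).
Qed.

Lemma edge_function_P_m :
  (forall i j, (1 <= i <= n)%N -> (1 <= j <= n)%N -> K i = K j -> i = j) ->
  P_m Omega T k.-1 (edge_function k n K p).
Proof.
move=> K_inj; split.
  split; first exact: measurable_funTS measurable_edge_function.
  have box_K : exists r, forall i, (1 <= i <= n)%N -> @vec3 R @^-1` hull (K i) `<=` box3 r.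
    have /choice[r Hr] := fun i => hull_box3 (K i).
    exists (\sum_(i <- index_iota 1 n.+1) `|r i|) => i ri y /Hr/box3E h.
    apply/box3E => j; apply: le_trans (h j) _; apply: le_trans (ler_norm _) _.
    rewrite (bigD1_seq i) ?iota_uniq ?mem_index_iota ?ltnS //= lerDl.
    exact: sumr_ge0.
  have [r Hr] := box_K; have [M HM] := edge_function_bounded.
  have [N [mN N0 bN]] := boundary_null.
  (* Omega may be replaced by a box: they differ where the function is zero,
     apart from points of the boundary *)
  rewrite integral_mkcond (integral_off_null mN N0 (g :=
    (fun y => ((edge_function k n K p (vec3 y)) ^+ 2)%:E) \_ (box3 r))); last first.
    move=> y nN; rewrite !patchE.
    have [Kx|nK] := pselect (exists2 i, (1 <= i <= n)%N & hull (K i) (vec3 y)).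
      have [i ri Ki] := Kx.
      rewrite !ifT //; apply/mem_set; first exact: (Hr i ri).
      rewrite /=; apply: contrapT => nO; apply: nN; apply: bN.
      exact: (not_Omega_boundary hT (KT ri) Ki nO).
    rewrite edge_function_eq0 ?expr0n /=; first by case: ifP; case: ifP.
    by move=> i ri Ki; apply: nK; exists i.
  rewrite -integral_mkcond.
  have : (leb3 R).-integrable (box3 r) (EFin \o (fun y => (edge_function k n K p (vec3 y)) ^+ 2)).
    apply: measurable_bounded_integrable; first exact: measurable_box3.
    - exact: leb3_bounded (measurable_box3 r) (@subset_refl _ _).
    - apply: measurable_funTS; apply: measurable_funX; exact: measurable_edge_function.
    exists (M ^+ 2); split; first exact: num_real.
    move=> B MB y _ /=; apply: le_trans (ltW MB).
    by rewrite normrX lerXn2r ?nnegrE ?HM // (le_trans _ (HM 0)).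
  move=> /integrableP[_]; apply: le_lt_trans.
  apply: le_trans (lee_abs _) _; apply: le_abse_integral; first exact: measurable_box3.
  apply/measurable_EFinP; apply: measurable_funTS; apply: measurable_funX.
  exact: measurable_edge_function.
move=> L LT; have sL := mesh_simplex hT LT.
have [[i ri LE]|h] := pselect (exists2 i, (1 <= i <= n)%N & L = K i).
  exists (piece i); first exact: piece_poly.
  apply/ae3_null; apply: null3_sub (skeleton_null sL) => x /= nE.
  apply: contrapT => nx; apply: nE; rewrite LE => Kx; apply: edge_function_on => //.
  by rewrite -LE.
exists (fun=> 0); first exact: poly_fun_cst.
apply/ae3_null; apply: null3_sub (skeleton_null sL) => x /= nE.
apply: contrapT => nx; apply: nE => Lx; apply: edge_function_eq0 => i ri Kx.
by apply: h; exists i => //; exact: mesh_unique LT (KT ri) Lx Kx nx.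
Qed.

End pressure.
End assembly.

(** * Critical pressures *)

Section critical_pressure.
Variables (R : realType) (Omega : set 'rV[R]_3) (T : {fset {fset 'rV[R]_3}}).
Hypotheses (hOmega : bounded_polyhedral_domain Omega) (hT : conforming_mesh Omega T).

Lemma edge_numberingP E n K p : is_edge T E -> edge_numbering Omega T E n K -> p \in E ->
  exists q, [/\ E = [fset p; q]%fset,
    forall i, (1 <= i <= n)%N -> [/\ K i \in T, p \in K i & q \in K i],
    forall i j, (1 <= i <= n)%N -> (1 <= j <= n)%N -> K i = K j -> i = j,
    forall L, L \in T -> p \in L -> q \in L -> exists2 i, (1 <= i <= n)%N & L = K i &
    forall i, (1 <= i < n)%N -> #|` shared_facet K i| = 3].
Proof.
move=> eE nE pE; have [q _ Epq] := edge_other_end eE.1 pE.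
have [enumK sharedK] : enumerates_patch T E n K /\
    forall i, (1 <= i < n)%N -> #|` shared_facet K i| = 3.
  case: nE => [[_ [-> [eK _ sK _]]]|[_ [_ eK sK]]]; split => // i /andP[i1 i4].
  by apply: sK; rewrite i1 ltnW.
have [patchK K_inj K_all] := enumK.
exists q; split => //.
  by move=> i /patchK/(edge_patchE hT _ eE Epq).
by move=> L LT pL qL; apply: K_all; apply/(edge_patchE hT _ eE Epq).
Qed.

(** Off the skeletons of the K_i the divergence is that of the polynomials on
    the pieces; the alternating sum of its values at p is a sum over the
    components of v of entries of vanishing alternating gradients. *)
Lemma edge_function_orthogonal_div E n K p k v : critical_edge T E ->
  edge_numbering Omega T E n K -> p \in E -> vector_S_k0 Omega T k v ->
  ip_L2 Omega (edge_function k n K p) (divergence v) = 0.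
Proof.
move=> critE nE pE Sv; have openO : open Omega by have [] := hOmega.
have [q [Epq Kpq K_inj K_all K_adj]] := edge_numberingP critE.1 nE pE.
have [l1 [l2 [al1 al2 _ _ allW]]] := critical_wedges hT critE Epq.
have KT i (ri : (1 <= i <= n)%N) : K i \in T by have [] := Kpq i ri.
have pK i (ri : (1 <= i <= n)%N) : p \in K i by have [] := Kpq i ri.
have gE (c : 'I_3) (i : nat) : exists g : 'rV[R]_3 -> R, (1 <= i <= n)%N ->
    poly_fun k g /\ forall x, hull (K i) x -> v x 0 c = g x.
  have [ri|] := boolP (1 <= i <= n)%N; last by exists (fun=> 0).
  by have [_ /(_ _ (KT i ri))[g gk vg] _] := Sv c; exists g.
have /choice[g gP] : forall c, exists f : nat -> 'rV[R]_3 -> R, forall i, (1 <= i <= n)%N ->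
    poly_fun k (f i) /\ forall x, hull (K i) x -> v x 0 c = f i x.
  by move=> c; have /choice[f fP] := gE c; exists f.
pose N := [set x | exists2 i, i \in index_iota 1 n.+1 & skeleton (K i) x].
have N0 : null3 N.
  apply: null3_bigcup => i; rewrite mem_index_iota ltnS => ri.
  exact: skeleton_null (mesh_simplex hT (KT i ri)).
pose G i x := \sum_(c < 3) partial c (g c i) x.
rewrite /ip_L2 (edge_function_integral hOmega hT KT pK (N := N) (G := G)) //; first last.
- move=> i x ri Kx nx; apply: eq_bigr => c _.
  have sKi := mesh_simplex hT (KT i ri).
  have nKx : ~ skeleton (K i) x.
    by move=> h; apply: nx; exists i => //; rewrite mem_index_iota ltnS.
  apply: near_eq_derive.
  have := near_hull sKi Kx nKx; apply: filterS => y ypos.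
  apply: ((gP c i ri).2 y); apply/(hull_barycentric _ sKi) => z zK; exact: ltW (ypos z zK).
- move=> i ri; apply: poly_fun_sum => c _; apply: poly_fun_partial.
  exact: (gP c i ri).1.
rewrite /G; under eq_bigr do rewrite mulr_sumr.
rewrite exchange_big big1 ?mulr0 //= => c _.
have [_ _ v0] := Sv c.
apply: (alternating_gradient openO hT (k := k) (f := fun x => v x 0 c) c al1 al2 allW Kpq) => //.
- by move=> i ri; exact: (gP c i ri).1.
- by move=> i ri; exact: (gP c i ri).2.
Qed.

Lemma poly_roots_finite (P : {poly R}) : P != 0 -> exists s : seq R, forall x, root P x -> x \in s.
Proof.
move=> P0; apply: contrapT => h.
suff /(_ (size P).-1) : forall m, exists s : seq R, [/\ size s = m.+1, uniq s & all (root P) s].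
  move=> [s [cs us rs]]; have := max_poly_roots P0 rs us.
  by rewrite cs prednK ?ltnn // lt0n size_poly_eq0.
elim=> [|m [s [cs us rs]]].
  have [x rx] : exists x, root P x.
    by apply: contrapT => h0; apply: h; exists [::] => x rx; case: h0; exists x.
  by exists [:: x]; rewrite /= rx.
have [x rx xs] : exists2 x, root P x & x \notin s.
  apply: contrapT => h0; apply: h; exists s => x rx; apply/negPn/negP => xs.
  by apply: h0; exists x.
by exists (x :: s); rewrite /= cs xs us rx rs.
Qed.

(** The barycentre of the tetrahedron is a limit of points of Omega, so some of
    them lie in the interior of the tetrahedron. *)
Lemma mesh_box L : L \in T -> exists (a : 'rV[R]_3) (r : R), 0 < r /\
  forall x : 'rV[R]_3, (forall i : 'I_3, `|x 0 i - a 0 i| <= r) -> Omega x /\ hull L x.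
Proof.
move=> LT; have openO : open Omega by have [] := hOmega.
have sL := mesh_simplex hT LT.
pose c : 'rV[R]_3 := \sum_(z <- L) 4^-1 *: z.
have cz z : z \in L -> barycentric L z c = 4^-1.
  move=> zL; apply: (barycentric_unique (w := fun=> 4^-1) sL) => //.
  have [q [a [b eL]]] := simplex4_enum sL zL.
  by rewrite (perm_big _ eL) !big_cons big_nil /=; field.
have Lc : hull L c by apply/(hull_barycentric _ sL) => z zL; rewrite cz // invr_ge0.
have nc : ~ skeleton L c.
  by move=> [z zL]; rewrite cz //; apply/eqP; rewrite invr_eq0 pnatr_eq0.
have nearL := near_hull sL Lc nc.
have cO : closure Omega c := mesh_closure hT LT Lc.
have [a [Oa aL]] := cO _ nearL.
have nLa : ~ skeleton L a by move=> [z zL] z0; have := aL z zL; rewrite z0 ltxx.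
have La : hull L a by apply/(hull_barycentric _ sL) => z zL; exact: ltW (aL z zL).
have : \forall y \near a, Omega y /\ forall z, z \in L -> 0 < barycentric L z y.
  near=> y; split; near: y; first exact: open_nbhs_nbhs.
  exact: near_hull sL La nLa.
move=> /nbhs_ballP[e /= e0 He]; exists a, (e / 2); split; first by rewrite divr_gt0.
move=> x xa; have [|Ox xL] := He x; last first.
  by split => //; apply/(hull_barycentric _ sL) => z zL; exact: ltW (xL z zL).
split=> // i j; rewrite (ord1 i) /ball /= distrC (le_lt_trans (xa j)) //.
by rewrite ltr_pdivrMr // ltr_pMr // ltrDl.
Unshelve. all: by end_near.
Qed.

Lemma barycentric_level_null L z (c : R) : simplex 4 L -> z \in L ->
  null3 [set x | barycentric L z x = c].
Proof.
move=> sL zL; have [q [a [b eL]]] := simplex4_enum sL zL.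
have : uniq [:: z; q; a; b] by rewrite -(perm_uniq eL) fset_uniq.
rewrite /= inE negb_or => /andP[/andP[zq _] _].
have qL : q \in L by have /perm_mem/(_ q) := eL; rewrite !inE eqxx orbT.
have [_ zz zq0] := barycentricP sL zL.
have [y yc] : exists y, barycentric L z y != c.
  have [c0|c0] := eqVneq c 0; last first.
    by exists q; rewrite zq0 // eq_sym.
  by exists z; rewrite zz c0 oner_eq0.
apply: (null3_sub (B := [set x | barycentric L z x - c = 0])).
  by move=> x /= ->; rewrite subrr.
apply: (null3_affine_zero (x := y)); last by rewrite subr_eq0.
have [n [e lE]] := barycentric_affine sL zL.
by exists n, (e - c) => x; rewrite lE addrA.
Qed.

(** On a box inside Omega and K_1 the function is a non-zero multiple of P (1
    - 2 lambda_p), whose zeros lie on finitely many parallel planes. *)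
Lemma edge_function_neq0 n K p k : (1 <= n)%N ->
  (forall i, (1 <= i <= n)%N -> K i \in T) ->
  (forall i, (1 <= i <= n)%N -> p \in K i) ->
  (forall i j, (1 <= i <= n)%N -> (1 <= j <= n)%N -> K i = K j -> i = j) ->
  ~ zero_in_L2 Omega (edge_function k n K p).
Proof.
rewrite /zero_in_L2 => n0 KT pK K_inj /ae3_null p0.
have r1 : (1 <= 1 <= n)%N by [].
have s1 := mesh_simplex hT (KT _ r1); have p1 := pK _ r1.
have [sP _ _] := jacobiP R k.
have P0 : jacobi k.-1 0 3 != 0 :> {poly R} by rewrite -size_poly_eq0 sP.
have [s rs] := poly_roots_finite P0.
have [a [r [r0 ra]]] := mesh_box (KT _ r1).
pose Z := [set x | exists2 t, t \in s & barycentric (K 1) p x = (1 - t) / 2].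
have Z0 : null3 Z by apply: null3_bigcup => t _; exact: barycentric_level_null.
have := null3U (null3U p0 (skeleton_null s1)) Z0.
apply: (box_not_null3 r0) => x /ra[Ox Kx].
have [sx|nx] := pselect (skeleton (K 1) x); first by left; right.
have [Zx|nZ] := pselect (Z x); first by right.
left; left => /= /(_ Ox); rewrite (edge_function_on hT k p KT K_inj r1 Kx nx).
apply/eqP; rewrite !mulf_neq0 ?signr_eq0 ?invr_neq0 //.
  by rewrite gt_eqF // (vol_hull_gt0 s1 p1).
apply/eqP => e; apply: nZ; exists (1 - 2 * barycentric (K 1) p x).
  by apply: rs; apply/rootP.
by field.
Qed.

Lemma edge_function_critical E n K p k : critical_edge T E -> inner_edge Omega T E ->
  edge_numbering Omega T E n K -> p \in E ->
  critical_pressure Omega T k (edge_function k n K p).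
Proof.
move=> critE innE nE pE.
have n4 : n = 4 by case: nE => [[_ []]|[/innE.2]].
have [q [Epq Kpq K_inj K_all K_adj]] := edge_numberingP critE.1 nE pE.
have KT i (ri : (1 <= i <= n)%N) : K i \in T by have [] := Kpq i ri.
have pK i (ri : (1 <= i <= n)%N) : p \in K i by have [] := Kpq i ri.
split; first exact: (edge_function_P_m hOmega hT k KT pK K_inj).
- by apply: (edge_function_neq0 _ KT pK K_inj); rewrite n4.
- transitivity (int3 Omega (fun x => edge_function k n K p x * (fun=> 1) x)).
    by congr int3; apply/funext => x; rewrite mulr1.
  rewrite (edge_function_integral hOmega hT KT pK (N := set0) (G := fun _ _ => 1)) //.
  + rewrite n4 /index_iota /= !big_cons big_nil.
    by rewrite !mulr1 addr0 !exprS expr0; ring.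
  + by apply: null3_sub (boundary_null hOmega).
  + by move=> i _; exact: poly_fun_cst.
- by move=> v Sv; exact: edge_function_orthogonal_div critE nE pE Sv.
Qed.

(** All quotients in the supremum for this pressure are zero. *)
Lemma critical_pressure_unstable k p : critical_pressure Omega T k p ->
  ~ inf_sup_stable Omega T k.
Proof.
move=> [Pp p0 ip0 divp] [gamma g0 /=]; apply/negP; rewrite -ltNge.
apply: le_lt_trans (_ : (0%:E < _)%E); last by rewrite lte_fin.
apply: ge_ereal_inf; eexists; first by exists p; split.
apply: ge_ereal_sup => _ [v [Sv _ ->]].
by rewrite /inf_sup_quotient divp // mul0r.
Qed.
End critical_pressure.

Theorem proposition5p8 (R : realType) (Omega : set 'rV[R]_3)
    (T : {fset {fset 'rV[R]_3}}) (k : nat)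
    (hOmega : bounded_polyhedral_domain Omega)
    (hT : conforming_mesh Omega T)
    (hk : (1 <= k)%N) :
  (forall E : {fset 'rV[R]_3}, critical_edge T E ->
     forall (iota : nat) (K : nat -> {fset 'rV[R]_3}),
       edge_numbering Omega T E iota K ->
       forall p : 'rV[R]_3, p \in E ->
       forall v : 'rV[R]_3 -> 'rV[R]_3, vector_S_k0 Omega T k v ->
         ip_L2 Omega (edge_function k iota K p) (divergence v) = 0)
  /\
  (forall E : {fset 'rV[R]_3}, critical_edge T E -> inner_edge Omega T E ->
     (forall (iota : nat) (K : nat -> {fset 'rV[R]_3}),
        edge_numbering Omega T E iota K ->
        forall p : 'rV[R]_3, p \in E ->
          critical_pressure Omega T k (edge_function k iota K p))
     /\ ~ inf_sup_stable Omega T k).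
Proof.
split=> [E critE n K nE p pE v Sv | E critE innE].
  exact: edge_function_orthogonal_div critE nE pE Sv.
split=> [n K nE p pE|]; first exact: edge_function_critical critE innE nE pE.
have [openO _ _ _ _] := hOmega.
have [K nE] := inner_numbering_exists openO hT critE innE.
have [p pE] : exists p, p \in E.
  have [[cE _] _] := critE; apply/fset0Pn.
  by apply/eqP => E0; rewrite E0 cardfs0 in cE.
exact: critical_pressure_unstable (edge_function_critical hOmega hT k critE innE nE pE).
Qed.
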